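(* Let $L$ be an algebraically closed field with $\mathrm{char}(L)=p\neq 0$. Let $D$ be a smooth projective algebraic curve over $L$, and let $F\subset D\times P^m$ be an irreducible projective curve over $L$ (not assumed smooth) such that the projection $pr:F\to D$ is a finite surjective morphism which is separable. Then, if $(ab)\in F$ is a non-singular point of $F$ (lying over $a\in D$), $$Mult_{(ab)}(F/D)=mult^{alg}_{(ab)}(F/D),$$ that is, Zariski multiplicity and algebraic multiplicity coincide. In particular, the cover $F/D$ is Zariski unramified at $(ab)$ if and only if there exists an open $U\subset F$, containing $(ab)$, such that $pr:U\to D$ is etale.
   Context: All curves are over the algebraically closed field $L$; points are $L$-points unless stated otherwise. The cover $pr:F\to D$ is separable if the field extension $L(D)\subset L(F)$ induced by $pr$ is separable. Zariski multiplicity: let $K\supsetneq L$ be an algebraically closed field with a nontrivial valuation, trivial on $L$, whose residue field is $L$ (a ''nonstandard model'' of $L$; e.g. an algebraic closure of $L((\epsilon))$), and let $P^n(K)\to P^n(L)$ be the associated specialisation (reduction) maps. For a point $x$ of a projective variety over $L$, ${\mathcal V}_x$ denotes the infinitesimal neighbourhood of $x$, i.e. the set of $K$-points of the ambient projective space specialising to $x$. For $(ab)\in F$ with $a\in D$, choose $a'\in D(K)\cap {\mathcal V}_a$ generic in $D$ over $L$ (i.e. $a'\notin D(L)$). Then $$Mult_{(ab)}(F/D)=\mathrm{Card}\{b'\in{\mathcal V}_b : (a',b')\in F(K)\},$$ which does not depend on the choice of $a'$. The cover is Zariski unramified at $(ab)$ if $Mult_{(ab)}(F/D)=1$. Algebraic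 multiplicity: $mult^{alg}_{(ab)}(F/D)$ is the length of ${\mathcal O}_{(ab),F}/m_a{\mathcal O}_{(ab),F}$, where $m_a$ is the maximal ideal of ${\mathcal O}_{a,D}$; at a non-singular point $(ab)$ of $F$ it equals $ord_{(ab)}(pr^*x)$ for $x$ a local uniformiser of $D$ at $a$. *)

(* Defs.v *)
From HB Require Import structures.
From mathcomp Require Import all_boot all_order all_algebra all_field.
From mathcomp Require Import boolp classical_sets functions cardinality topology.
From mathcomp Require Import mpoly.

Set Implicit Arguments.
Unset Strict Implicit.
Unset Printing Implicit Defensive.

Import Order.TTheory GRing.Theory Num.Theory.
Local Open Scope classical_set_scope.
Local Open Scope ring_scope.
Local Open Scope quotient_scope.

Definition chain (T : Type) (C : set (set T)) (n : nat) (Z : nat -> set T) :=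
  (forall i, (i <= n)%N -> C (Z i)) /\
  (forall i, (i < n)%N -> Z i `<` Z i.+1).

Definition max_chain (T : Type) (C : set (set T)) (n : nat) :=
  (exists Z, chain C n Z) /\ (forall m Z, chain C m Z -> (m <= n)%N).

(* Submodules of M/N are identified with submodules of M containing N. *)
Definition has_length (R : comNzRingType) (M : lmodType R) (N : set M) (n : nat) :=
  max_chain [set S : set M | submod_closed (mem S) /\ N `<=` S] n.

Section Rings.
Variable R : comNzRingType.

Definition ideal_gen (S : set R) : set R :=
  [set z | exists2 s : seq (R * R),
     (forall u, u \in s -> S u.2) & z = \sum_(u <- s) u.1 * u.2].

(* In a local ring this is the maximal ideal. *)
Definition nonunits : set R := [set z | ~ exists y, y * z = 1].

Definition krull_dim (n : nat) :=
  max_chain [set P : set R | idealr_closed (mem P) /\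
                             prime_idealr_closed (mem P)] n.

(* A Noetherian local ring is regular when its maximal ideal is generated by
   as many elements as its Krull dimension. *)
Definition regular_local :=
  exists2 n, krull_dim n &
    exists s : n.-tuple R, nonunits = ideal_gen [set z | z \in (s : seq R)].

End Rings.

Section Flat.
Variables (R S : comNzRingType) (f : R -> S).

(* Balanced biadditive maps on N x S, where S is an R-module through f. *)
Definition balanced (N : lmodType R) (W : zmodType) (b : N -> S -> W) :=
  [/\ forall n n' s, b (n + n') s = b n s + b n' s,
      forall n s s', b n (s + s') = b n s + b n s' &
      forall r n s, b (r *: n) s = b n (f r * s)].

(* The tensor \sum n (x) s vanishes in the tensor product of N and S over R,
   phrased through the universal property of the latter. *)
Definition tensor_zero (N : lmodType R) (t : seq (N * S)) :=
  forall (W : zmodType) (b : N -> S -> W),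
    balanced b -> \sum_(u <- t) b u.1 u.2 = 0.

Definition flat :=
  forall (M N : lmodType R) (g : {linear M -> N}), injective g ->
  forall t : seq (M * S),
    tensor_zero [seq (g u.1, u.2) | u <- t] -> tensor_zero t.

(* For local rings whose residue fields are both the algebraically closed
   ground field, the separability condition on residue fields is void. *)
Definition unramified :=
  ideal_gen (f @` @nonunits R) = @nonunits S.

Definition etale_local := flat /\ unramified.

End Flat.

(* An ambient space is described by a multigraded polynomial ring, together
   with, over each field, a type of points and a choice of coordinates for each
   point, so that forms can be evaluated at points.  The same data serve over
   every field. *)

Record ambient := Ambient {
  nvars : nat;
  degree : nmodType;
  weight : 'I_nvars -> degree;
  point : fieldType -> choiceType;
  coord : forall k : fieldType, point k -> 'I_nvars -> k
}.

Definition affine_space (N : nat) : ambient :=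
  @Ambient N nat (fun=> 0) (fun k => 'rV[k]_N) (fun k x i => x ord0 i).

(* A point of projective space is represented by its unique vector of
   homogeneous coordinates whose first nonzero entry is 1. *)
Definition normalized (k : fieldType) (n : nat) (x : 'rV[k]_n) : bool :=
  [exists i, (x ord0 i == 1) &&
             [forall j : 'I_n, (j < i)%N ==> (x ord0 j == 0)]].

Definition proj_point (n : nat) (k : fieldType) : choiceType :=
  {x : 'rV[k]_n.+1 | normalized x}.

Definition pcoord (n : nat) (k : fieldType) (x : proj_point n k) : 'I_n.+1 -> k :=
  fun i => val x ord0 i.

Definition proj_space (n : nat) : ambient :=
  @Ambient n.+1 nat (fun=> 1%N) (proj_point n) (@pcoord n).

Definition biproj_space (r m : nat) : ambient :=
  @Ambient (r.+1 + m.+1) (nat * nat)%type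
    (fun i => match fintype.split i with inl _ => (1%N, 0%N) | inr _ => (0%N, 1%N) end)
    (fun k => (proj_point r k * proj_point m k)%type)
    (fun k x i => match fintype.split i with
                  | inl j => pcoord x.1 j
                  | inr j => pcoord x.2 j end).

Definition pts (A : ambient) (k : fieldType) : Type := point A k.
HB.instance Definition _ A k := Choice.on (pts A k).

Section Forms.
Variables (A : ambient) (k : fieldType).
Local Notation mpol := {mpoly k[nvars A]}.
Implicit Types (q : mpol) (x : pts A k) (d : degree A).

Definition mweight (m : 'X_{1..nvars A}) : degree A :=
  \sum_(i < nvars A) weight i *+ m i.

Definition is_form d q := forall m, m \in msupp q -> mweight m = d.

Definition ev q x : k := q.@[coord x].

Lemma form0 d : is_form d 0.
Proof. by move=> m; rewrite msupp0. Qed.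

Lemma formC c : is_form 0 c%:MP.
Proof.
move=> m; rewrite msuppC; case: ifP => //= _; rewrite inE => /eqP ->.
by rewrite /mweight big1 // => i _; rewrite mnmE mulr0n.
Qed.

Lemma formD d q q' : is_form d q -> is_form d q' -> is_form d (q + q').
Proof.
move=> h h' m /msuppD_le; rewrite mem_cat => /orP[]; [exact: h|exact: h'].
Qed.

Lemma formN d q : is_form d q -> is_form d (- q).
Proof. by move=> h m; rewrite (perm_mem (msuppN q)); exact: h. Qed.

Lemma formM d d' q q' : is_form d q -> is_form d' q' -> is_form (d + d') (q * q').
Proof.
move=> h h' m /msuppM_le /allpairsP [[m1 m2] /= [/h <- /h' <- ->]].
rewrite /mweight -big_split /=; apply: eq_bigr => i _.
by rewrite mnmDE mulrnDr.
Qed.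

Lemma formX i : is_form (weight i) 'X_i.
Proof.
move=> m; rewrite msuppX inE => /eqP ->.
rewrite /mweight (bigD1 i) //= mnm1E eqxx mulr1n big1 ?addr0 // => j ji.
by rewrite mnm1E eq_sym (negbTE ji) mulr0n.
Qed.

Lemma form_sum (I : Type) (s : seq I) (P : pred I) d (G : I -> mpol) :
  (forall i, P i -> is_form d (G i)) -> is_form d (\sum_(i <- s | P i) G i).
Proof.
move=> h; elim/big_ind: _ => // [|q q']; [exact: form0|exact: formD].
Qed.

Lemma formXn d q n : is_form d q -> is_form (d *+ n) (q ^+ n).
Proof.
move=> h; elim: n => [|n IH]; first by rewrite expr0 mulr0n; exact: formC.
by rewrite exprS mulrS; exact: formM.
Qed.

Lemma form_prod (I : Type) (s : seq I) (D : I -> degree A) (G : I -> mpol) :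
  (forall i, is_form (D i) (G i)) ->
  is_form (\sum_(i <- s) D i) (\prod_(i <- s) G i).
Proof.
move=> h; elim: s => [|i s IH]; first by rewrite !big_nil; exact: formC.
by rewrite !big_cons; exact: formM.
Qed.

Definition zopen : set (set (pts A k)) :=
  [set U | exists2 Q : set mpol, (forall q, Q q -> exists d, is_form d q) &
           U = [set x | exists2 q, Q q & ev q x != 0]].

Lemma zopenT : zopen setT.
Proof.
exists [set 1] => [q ->|]; first by exists 0; exact: formC.
by apply/seteqP; split=> // x _; exists 1 => //; rewrite /ev meval1 oner_neq0.
Qed.

Lemma zopenI : setI_closed zopen.
Proof.
move=> _ _ [Q hQ ->] [Q' hQ' ->].
exists [set q | exists q1 q2, [/\ Q q1, Q' q2 & q = q1 * q2]].
  move=> _ [q1 [q2 [/hQ [d1 h1] /hQ' [d2 h2] ->]]].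
  by exists (d1 + d2); exact: formM.
apply/seteqP; split=> x /=.
  move=> [[q1 Qq1 n1] [q2 Qq2 n2]]; exists (q1 * q2); first by exists q1, q2.
  by rewrite /ev mevalM mulf_neq0.
move=> [_ [q1 [q2 [Qq1 Qq2 ->]]]]; rewrite /ev mevalM mulf_eq0 negb_or.
by case/andP=> n1 n2; split; [exists q1|exists q2].
Qed.

Lemma zopen_bigU (I : Type) (f : I -> set (pts A k)) :
  (forall i, zopen (f i)) -> zopen (\bigcup_i f i).
Proof.
move=> /(_ _)/cid2-/all_sig2 h; case: h => Q hQ fE.
exists (\bigcup_i Q i) => [q [i _] /hQ //|].
apply/seteqP; split=> x /=.
  by move=> [i _]; rewrite fE /= => -[q Qq n]; exists q => //; exists i.
by move=> [q [i _ Qq] n]; exists i => //; rewrite fE /=; exists q.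
Qed.

HB.instance Definition _ :=
  isOpenTopological.Build (pts A k) zopenT zopenI zopen_bigU.

End Forms.

Section Topology.
Variable T : topologicalType.

Definition irreducible (Z : set T) :=
  Z !=set0 /\
  forall A B, closed A -> closed B -> Z `<=` A `|` B -> Z `<=` A \/ Z `<=` B.

(* X is meant to be closed, so that its closed subsets are closed in T. *)
Definition dimension (X : set T) (n : nat) :=
  max_chain [set Z : set T | [/\ closed Z, irreducible Z & Z `<=` X]] n.

Lemma irreducible1 (x : T) : irreducible [set x].
Proof.
split; first by exists x.
by move=> A B _ _ /(_ x erefl) [Ax|Bx]; [left|right] => y ->.
Qed.

Lemma irreducible_meet (Z U V : set T) : irreducible Z -> open U -> open V ->
  Z `&` U !=set0 -> Z `&` V !=set0 -> Z `&` (U `&` V) !=set0.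
Proof.
move=> [_ irrZ] oU oV [x [Zx Ux]] [y [Zy Vy]]; apply: contrapT => nZ.
have [||z Zz|ZU|ZV] := irrZ (~` U) (~` V).
- exact: open_closedC.
- exact: open_closedC.
- apply: contrapT => /not_orP[/contrapT Uz /contrapT Vz].
  by apply: nZ; exists z.
- exact: ZU Ux.
- exact: ZV Vy.
Qed.

End Topology.

Section Regular.
Variables (A : ambient) (k : fieldType).
Implicit Types (X U : set (pts A k)) (f : pts A k -> k).

(* Functions on X are represented by functions on the whole ambient space,
   whose values outside X are irrelevant. *)
Definition regular_at X (x : pts A k) f :=
  exists U (d : degree A) (g h : {mpoly k[nvars A]}),
    [/\ open U, U x, is_form d g, is_form d h &
        forall y, X y -> U y -> ev h y != 0 /\ f y = ev g y / ev h y].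

Definition regular_on X f := forall x, X x -> regular_at X x f.

End Regular.

Definition morphism (A B : ambient) (k : fieldType)
    (X : set (pts A k)) (Y : set (pts B k)) (phi : pts A k -> pts B k) :=
  [/\ forall x, X x -> Y (phi x),
      {within X, continuous phi} &
      forall (V : set (pts B k)) (f : pts B k -> k), open V ->
        regular_on (Y `&` V) f -> regular_on (X `&` phi @^-1` V) (f \o phi)].

Definition affine_variety (A : ambient) (k : fieldType) (X : set (pts A k)) :=
  exists (N : nat) (Y : set (pts (affine_space N) k)), closed Y /\
  exists phi psi, [/\ morphism X Y phi, morphism Y X psi,
    forall x, X x -> psi (phi x) = x & forall y, Y y -> phi (psi y) = y].

(* Y is covered by open affine subsets whose preimages are affine, with
   coordinate ring a finitely generated module. *)
Definition finite_morphism (A B : ambient) (k : fieldType)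
    (X : set (pts A k)) (Y : set (pts B k)) (phi : pts A k -> pts B k) :=
  morphism X Y phi /\
  forall y, Y y -> exists V : set (pts B k),
    let X' := X `&` phi @^-1` V in let Y' := Y `&` V in
    [/\ open V, V y, affine_variety Y', affine_variety X' &
        exists (n : nat) (s : 'I_n -> pts A k -> k),
          (forall i, regular_on X' (s i)) /\
          forall f, regular_on X' f ->
            exists c : 'I_n -> pts B k -> k,
              (forall i, regular_on Y' (c i)) /\
              forall x, X' x -> f x = \sum_(i < n) c i (phi x) * s i x].

(* The germs at a center Z are those of the local ring of X along Z: a point
   gives the local ring at that point, X itself gives the function field. *)
Record center (A : ambient) (k : fieldType) (X : set (pts A k)) := Center {
  center_set :> set (pts A k);
  center_sub : center_set `<=` X;
  center_irr : irreducible center_set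
}.

Section Stalk.
Variables (A : ambient) (k : fieldType) (X : set (pts A k)) (Z : center X).
Implicit Types (U : set (pts A k)) (f : pts A k -> k).

Definition regular_near : {pred (pts A k -> k)} := fun f =>
  `[< exists U, [/\ open U, Z `&` U !=set0 & regular_on (X `&` U) f] >].

Lemma regular_at_cst (X' : set (pts A k)) c x : regular_at X' x (fun=> c).
Proof.
exists setT, 0, c%:MP, 1; split=> //; [exact: openT|exact: formC|exact: formC|].
by move=> y _ _; rewrite /ev meval1 mevalC oner_neq0 divr1.
Qed.

Lemma regular_at_sub (X1 X2 : set (pts A k)) x f : X1 `<=` X2 -> regular_at X2 x f -> regular_at X1 x f.
Proof.
move=> sX [U [d [g [h [oU Ux hg hh E]]]]]; exists U, d, g, h; split=> // y X1y.
by apply: E; apply: sX.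
Qed.

Lemma regular_atB (X' : set (pts A k)) x f f' :
  regular_at X' x f -> regular_at X' x f' -> regular_at X' x (f - f').
Proof.
move=> [U [d [g [h [oU Ux fg fh E]]]]] [U' [d' [g' [h' [oU' Ux' fg' fh' E']]]]].
exists (U `&` U'), (d + d'), (g * h' - g' * h), (h * h'); split=> //.
- exact: openI.
- apply: formD; first exact: formM.
  by apply: formN; rewrite addrC; exact: formM.
- exact: formM.
move=> y Xy [/(E y Xy) [n ef] /(E' y Xy) [n' ef']].
rewrite /ev !(mevalB, mevalM) mulf_neq0 //; split=> //.
change (f y - f' y =
  (ev g y * ev h' y - ev g' y * ev h y) / (ev h y * ev h' y)).
by rewrite ef ef' -mulNr addf_div // mulNr.
Qed.

Lemma regular_atM (X' : set (pts A k)) x f f' :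
  regular_at X' x f -> regular_at X' x f' -> regular_at X' x (f * f').
Proof.
move=> [U [d [g [h [oU Ux fg fh E]]]]] [U' [d' [g' [h' [oU' Ux' fg' fh' E']]]]].
exists (U `&` U'), (d + d'), (g * g'), (h * h'); split=> //.
- exact: openI.
- exact: formM.
- exact: formM.
move=> y Xy [/(E y Xy) [n ef] /(E' y Xy) [n' ef']].
rewrite /ev !mevalM mulf_neq0 //; split=> //.
change (f y * f' y = (ev g y * ev g' y) / (ev h y * ev h' y)).
by rewrite ef ef' mulf_div.
Qed.

Lemma regular_near_op (op : (pts A k -> k) -> (pts A k -> k) -> pts A k -> k) :
  (forall X' x f f', regular_at X' x f -> regular_at X' x f' ->
     regular_at X' x (op f f')) ->
  forall f f', f \in regular_near -> f' \in regular_near ->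
    op f f' \in regular_near.
Proof.
move=> H f f' /asboolP [U [oU ZU Uf]] /asboolP [U' [oU' ZU' Uf']].
apply/asboolP; exists (U `&` U'); split; first exact: openI.
  by apply: irreducible_meet => //; exact: center_irr.
move=> x [Xx [Ux Ux']]; apply: H.
  by apply: (regular_at_sub _ (Uf x _)) => // y [Xy [Uy _]].
by apply: (regular_at_sub _ (Uf' x _)) => // y [Xy [_ U'y]].
Qed.

Lemma regular_near_subring : subring_closed regular_near.
Proof.
split=> [|f f'|f f'].
- apply/asboolP; exists setT; split; first exact: openT.
    by have [[x Zx] _] := center_irr Z; exists x.
  by move=> x _; exact: regular_at_cst.
- exact: (@regular_near_op (fun f f' => f - f') regular_atB).
- exact: (@regular_near_op (fun f f' => f * f') regular_atM).
Qed.

HB.instance Definition _ :=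
  GRing.isSubringClosed.Build (pts A k -> k) regular_near regular_near_subring.

Record local_fun := LocalFun {
  local_val :> pts A k -> k;
  _ : local_val \in regular_near }.

HB.instance Definition _ := [isSub for local_val].
HB.instance Definition _ := [Choice of local_fun by <:].
HB.instance Definition _ :=
  GRing.SubChoice_isSubComPzRing.Build _ _ local_fun regular_near_subring.

Lemma local_fun1_neq0 : (1 : local_fun) != 0.
Proof.
have [[x Zx] _] := center_irr Z.
apply/eqP => /(congr1 (fun g : local_fun => g x)) /eqP.
by rewrite /= oner_eq0.
Qed.

HB.instance Definition _ :=
  GRing.PzSemiRing_isNonZero.Build local_fun local_fun1_neq0.

Definition zero_near : {pred local_fun} := fun u =>
  `[< exists U, [/\ open U, Z `&` U !=set0 &
                    forall x, X x -> U x -> u x = 0] >].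

Lemma zero_near_ideal : idealr_closed zero_near.
Proof.
split.
- apply/asboolP; exists setT; split; [exact: openT| |by []].
  by have [[x Zx] _] := center_irr Z; exists x.
- apply/asboolP => -[U [_ [x [Zx Ux]] /(_ x (center_sub Zx) Ux)]] /eqP.
  by rewrite /= oner_eq0.
move=> a u v /asboolP [U [oU ZU U0]] /asboolP [V [oV ZV V0]].
apply/asboolP; exists (U `&` V); split; first exact: openI.
  by apply: irreducible_meet => //; exact: center_irr.
move=> x Xx [Ux Vx]; change (a x * u x + v x = 0).
by rewrite U0 // V0 // mulr0 addr0.
Qed.

HB.instance Definition _ :=
  isIdealr.Build local_fun zero_near zero_near_ideal.

Definition stalk := {ideal_quot zero_near}.
HB.instance Definition _ := GRing.ComNzRing.on stalk.

Definition germ (u : local_fun) : stalk := \pi_stalk u.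

Lemma germK (z : stalk) : germ (repr z) = z.
Proof. exact: reprK. Qed.

Lemma germE (u v : local_fun) :
  germ u = germ v <-> exists U, [/\ open U, Z `&` U !=set0 &
                                   forall x, X x -> U x -> u x = v x].
Proof.
split.
  move/eqP; rewrite -Quotient.idealrBE => /asboolP [U [oU ZU E]].
  exists U; split=> // x Xx Ux; apply/eqP; rewrite -subr_eq0; apply/eqP.
  exact: (E x Xx Ux).
move=> [U [oU ZU E]]; apply/eqP; rewrite -Quotient.idealrBE.
apply/asboolP; exists U; split=> // x Xx Ux.
by change (u x - v x = 0); rewrite E // subrr.
Qed.

End Stalk.

Section FunctionField.
Variables (A : ambient) (k : fieldType) (X : set (pts A k)).
Hypothesis irrX : irreducible X.

Definition center_self : center X := Center (@subset_refl _ X) irrX.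

Definition function_field := stalk center_self.
HB.instance Definition _ := GRing.ComNzRing.on function_field.

Lemma function_field_inv (z : function_field) :
  z != 0 -> exists y, y * z = 1.
Proof.
rewrite -(germK z); set u := repr z => nz.
have /asboolP [U [oU [x [Xx Ux]] Ur]] := valP u.
have [V [d [g [h [oV Vx fg fh E]]]]] := Ur x (conj Xx Ux).
pose W := U `&` V `&` [set y | ev g y != 0].
have oW : open W.
  apply: openI; first exact: openI.
  exists [set g] => [q ->|]; first by exists d.
  by apply/seteqP; split=> y /=; [exists g|case=> q ->].
have [y [Xy Wy]] : X `&` W !=set0.
  apply: contrapT => nW; case/eqP: nz.
  transitivity (germ (0 : local_fun center_self)); last by rewrite /germ rmorph0.
  apply: (germE _ _).2; exists (U `&` V); split; first exact: openI.
    by exists x.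
  move=> y Xy [Uy Vy]; have [_ ->] := E y (conj Xy Uy) Vy.
  have [->|n] := eqVneq (ev g y) 0; first by rewrite mul0r.
  by case: nW; exists y.
have vP : (fun y => (u y)^-1) \in regular_near center_self.
  apply/asboolP; exists W; split=> //; first by exists y.
  move=> t [Xt Wt]; exists W, d, h, g; split=> // s [Xs Ws] _.
  have [[Us Vs] gs] := Ws; split=> //.
  by have [_ ->] := E s (conj Xs Us) Vs; rewrite invf_div.
exists (germ (LocalFun vP)).
change (germ (LocalFun vP) * germ u = 1 :> stalk center_self).
transitivity (germ (LocalFun vP * u)); first by rewrite /germ rmorphM.
transitivity (germ (1 : local_fun center_self)); last by rewrite /germ rmorph1.
apply: (germE _ _).2; exists W; split=> //; first by exists y.
move=> s Xs [[Us Vs] gs]; change ((u s)^-1 * u s = 1).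
rewrite mulVf //; have [hs ->] := E s (conj Xs Us) Vs.
by rewrite mulf_neq0 // invr_eq0.
Qed.

Definition ff_inv (z : function_field) : function_field :=
  if pselect (exists y, y * z = 1) is left e then projT1 (cid e) else 0.

Lemma ff_mulVf (z : function_field) : z != 0 -> ff_inv z * z = 1.
Proof.
move=> /function_field_inv e; rewrite /ff_inv; case: pselect => // e'.
by case: (cid e').
Qed.

Lemma ff_inv0 : ff_inv 0 = 0.
Proof.
rewrite /ff_inv; case: pselect => // e; have [y] := e.
by rewrite mulr0 => /esym/eqP; rewrite oner_eq0.
Qed.

HB.instance Definition _ :=
  GRing.ComNzRing_isField.Build function_field ff_mulVf ff_inv0.

End FunctionField.

Section LocalRing.
Variables (A : ambient) (k : fieldType) (X : set (pts A k)).
Variables (x : pts A k) (Xx : X x).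

Lemma point_sub : [set x] `<=` X. Proof. by move=> _ ->. Qed.

Definition center_point : center X := Center point_sub (irreducible1 x).

Definition local_ring := stalk center_point.
HB.instance Definition _ := GRing.ComNzRing.on local_ring.

End LocalRing.

Definition nonsingular (A : ambient) (k : fieldType) (X : set (pts A k))
    (x : pts A k) (Xx : X x) := regular_local (local_ring Xx).

Definition smooth (A : ambient) (k : fieldType) (X : set (pts A k)) :=
  forall x (Xx : X x), nonsingular Xx.

Section Projection.
Variables (r m : nat) (k : fieldType).

Definition bipoint (a : pts (proj_space r) k) (b : pts (proj_space m) k) :
  pts (biproj_space r m) k := (a, b).

Definition pr (x : pts (biproj_space r m) k) : pts (proj_space r) k := x.1.

Definition pr_form (q : {mpoly k[r.+1]}) : {mpoly k[r.+1 + m.+1]} :=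
  q \mPo [tuple 'X_(lshift m.+1 i) | i < r.+1].

Lemma ev_pr_form (q : {mpoly k[nvars (proj_space r)]})
    (x : pts (biproj_space r m) k) :
  ev (A := biproj_space r m) (pr_form q) x = ev q (pr x).
Proof.
rewrite /ev /pr_form comp_mpoly_meval.
apply: meval_eq => i; rewrite tnth_map tnth_ord_tuple mevalXU /=.
by rewrite (unsplitK (inl _ i)).
Qed.

Lemma form_pr (q : {mpoly k[nvars (proj_space r)]}) d :
  is_form (A := proj_space r) d q ->
  is_form (A := biproj_space r m) (d, 0%N) (pr_form q).
Proof.
move=> qd; rewrite /pr_form comp_mpolyEX big_seq; apply: form_sum => t /qd td.
rewrite -mul_mpolyC -[(d, 0%N)]add0r; apply: formM; first exact: formC.
rewrite comp_mpolyX.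
have -> : (d, 0%N) = \sum_(i < r.+1) ((1%N, 0%N) : degree (biproj_space r m)) *+ t i.
  rewrite -td /mweight.
  rewrite (big_morph (fun a : nat => (a, 0%N) : degree (biproj_space r m))
    (id1 := 0) (op1 := +%R)) //.
  apply: eq_bigr => i _; move: (fun_of_multinom t i) => e.
  by elim: e => [|e IH] //; rewrite [RHS]mulrS -IH [in LHS]mulrS.
apply: form_prod => i; apply: formXn; rewrite tnth_map tnth_ord_tuple.
have := @formX (biproj_space r m) k (lshift m.+1 i).
by rewrite /= (unsplitK (inl _ i)).
Qed.

Lemma open_pr (U : set (pts (proj_space r) k)) :
  open U -> open (pr @^-1` U).
Proof.
move=> [Q hQ ->].
exists [set pr_form q | q in Q].
  by move=> _ [q /hQ [d qd] <-]; exists (d, 0%N); exact: form_pr.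
apply/seteqP; split=> x /=.
  by move=> [q Qq n]; exists (pr_form q); [exists q|rewrite ev_pr_form].
by move=> [_ [q Qq <-]]; rewrite ev_pr_form => n; exists q.
Qed.

Lemma regular_at_pr (X : set (pts (biproj_space r m) k))
    (Y : set (pts (proj_space r) k)) x f :
  X `<=` pr @^-1` Y -> regular_at Y (pr x) f -> regular_at X x (f \o pr).
Proof.
move=> XY [U [d [g [h [oU Ux fg fh E]]]]].
exists (pr @^-1` U), (d, 0%N), (pr_form g), (pr_form h); split=> //.
- exact: open_pr.
- exact: form_pr.
- exact: form_pr.
by move=> y /XY Yy Uy; rewrite !ev_pr_form; exact: E.
Qed.

End Projection.

Section Pullback.
Variables (r m : nat) (k : fieldType).
Variables (X : set (pts (biproj_space r m) k)) (Y : set (pts (proj_space r) k)).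
Variables (Z : center X) (W : center Y).

Record dominates : Prop := Dominates {
  dom_sub : X `<=` @pr r m k @^-1` Y;
  dom_meet : forall U, open U -> W `&` U !=set0 ->
    Z `&` @pr r m k @^-1` U !=set0
}.

Hypothesis ZW : dominates.

Lemma pullback_subproof (u : local_fun W) :
  u \o @pr r m k \in regular_near Z.
Proof.
have /asboolP [U [oU WU Ur]] := valP u.
apply/asboolP; exists (@pr r m k @^-1` U); split.
- exact: open_pr.
- exact: dom_meet.
move=> x [Xx Ux]; apply: (@regular_at_pr _ _ _ _ (Y `&` U)).
  by move=> y [Xy Uy]; split=> //; exact: dom_sub.
by apply: Ur; split=> //; exact: (dom_sub ZW).
Qed.

Definition pullback_fun (u : local_fun W) : local_fun Z :=
  LocalFun (pullback_subproof u).

Definition pullback (z : stalk W) : stalk Z := germ (pullback_fun (repr z)).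

Lemma pullback_germ u : pullback (germ u) = germ (pullback_fun u).
Proof.
have /germE [U [oU WU E]] : germ (repr (germ u)) = germ u by rewrite germK.
apply/germE; exists (@pr r m k @^-1` U); split.
- exact: open_pr.
- exact: dom_meet.
by move=> x Xx Ux; apply: E => //; exact: (dom_sub ZW).
Qed.

Lemma pullback_is_zmod_morphism : zmod_morphism pullback.
Proof.
move=> y z; rewrite -(germK y) -(germK z).
rewrite -[X in pullback X]/(germ _ - germ _).
have -> u v : germ u - germ v = germ (u - v) :> stalk W by rewrite /germ rmorphB.
rewrite !pullback_germ.
have -> u v : germ u - germ v = germ (u - v) :> stalk Z by rewrite /germ rmorphB.
by congr germ; apply/val_inj.
Qed.

Lemma pullback_is_monoid_morphism : monoid_morphism pullback.
Proof.
split.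
  have -> : 1 = germ (1 : local_fun W) by rewrite /germ rmorph1.
  rewrite pullback_germ -[RHS](rmorph1 \pi_(stalk Z)).
  by congr germ; apply/val_inj.
move=> y z; rewrite -(germK y) -(germK z).
have -> u v : germ u * germ v = germ (u * v) :> stalk W by rewrite /germ rmorphM.
rewrite !pullback_germ.
have -> u v : germ u * germ v = germ (u * v) :> stalk Z by rewrite /germ rmorphM.
by congr germ; apply/val_inj.
Qed.

HB.instance Definition _ :=
  GRing.isZmodMorphism.Build (stalk W) (stalk Z) pullback
    pullback_is_zmod_morphism.
HB.instance Definition _ :=
  GRing.isMonoidMorphism.Build (stalk W) (stalk Z) pullback
    pullback_is_monoid_morphism.

End Pullback.

Section Cover.
Variables (r m : nat) (k : fieldType).
Variables (F : set (pts (biproj_space r m) k)) (D : set (pts (proj_space r) k)).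
Hypothesis FD : F `<=` @pr r m k @^-1` D.

Section Local.
Variables (x : pts (biproj_space r m) k) (Fx : F x).

Definition base_point : D (pr x) := FD Fx.

Lemma dominates_point : dominates (center_point Fx) (center_point base_point).
Proof.
split=> // U oU [_ [-> Ux]]; by exists x.
Qed.

Definition local_pullback : local_ring base_point -> local_ring Fx :=
  pullback dominates_point.
HB.instance Definition _ := GRing.RMorphism.on local_pullback.

Definition algebraic_mult (n : nat) :=
  has_length (M := (local_ring Fx)^o)
    (ideal_gen (local_pullback @` @nonunits (local_ring base_point))) n.

End Local.

Definition etale_on (U : set (pts (biproj_space r m) k)) :=
  forall x (Fx : F x), U x -> etale_local (@local_pullback x Fx).

Hypothesis pr_surj : D `<=` @pr r m k @` F.

Lemma dominates_self (irrF : irreducible F) (irrD : irreducible D) :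
  dominates (center_self irrF) (center_self irrD).
Proof.
split=> // U oU [a [Da Ua]]; have [x Fx xa] := pr_surj Da.
by exists x; split=> //; rewrite /preimage /= xa.
Qed.

Variables (irrF : irreducible F) (irrD : irreducible D).

Definition ff_pullback : function_field irrD -> function_field irrF :=
  pullback (dominates_self irrF irrD).
HB.instance Definition _ := GRing.RMorphism.on ff_pullback.

Definition separable_cover :=
  forall z : function_field irrF, exists q : {poly function_field irrD},
    separable_poly q /\ root (map_poly ff_pullback q) z.

End Cover.

(* The value at 0, conventionally +oo, is left unspecified and never used. *)
Record valuation (K : fieldType) := Valuation {
  value_group : porderZmodType;
  value_total : total (<=%R : rel value_group);
  value_add : forall x y z : value_group, x <= y -> z + x <= z + y;
  val_of :> K -> value_group;
  val_ofM : forall x y, x != 0 -> y != 0 ->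
    val_of (x * y) = val_of x + val_of y;
  val_ofD : forall x y, x != 0 -> y != 0 -> x + y != 0 ->
    Order.min (val_of x) (val_of y) <= val_of (x + y)
}.

Section Specialisation.
Variables (k K : fieldType) (iota : {rmorphism k -> K}) (v : valuation K).

Definition valuation_ring : set K := [set x | x = 0 \/ 0 <= v x].

Definition valuation_ideal : set K := [set x | x = 0 \/ 0 < v x].

(* The last clause says that k maps onto the residue field of v. *)
Definition nonstandard_model :=
  [/\ exists2 x, x != 0 & v x != 0,
      forall c, c != 0 -> v (iota c) = 0 &
      forall x, valuation_ring x -> exists c, valuation_ideal (x - iota c)].

(* x specialises to y: after rescaling, the homogeneous coordinates of x lie in
   the valuation ring and reduce to those of y. *)
Definition infinitesimal_nbhd (n : nat) (y : pts (proj_space n) k) :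
    set (pts (proj_space n) K) :=
  [set x | exists2 c, c != 0 &
     forall i, valuation_ideal (c * pcoord x i - iota (pcoord y i))].

(* X is cut out over K by all the forms over k that vanish on its k-points,
   which is legitimate because k is algebraically closed. *)
Definition Kpoints (A : ambient) (X : set (pts A k)) : set (pts A K) :=
  [set x | forall d (q : {mpoly k[nvars A]}), is_form d q ->
     (forall y, X y -> ev q y = 0) -> ev (A := A) (map_mpoly iota q) x = 0].

Definition standard (A : ambient) (X : set (pts A k)) (x : pts A K) :=
  exists2 y : pts A k, X y & forall i, coord x i = iota (coord y i).

Definition zariski_fibre (r m : nat) (F : set (pts (biproj_space r m) k))
    (a' : pts (proj_space r) K) (b : pts (proj_space m) k) :
    set (pts (proj_space m) K) :=
  [set b' | infinitesimal_nbhd b b' /\ Kpoints F (bipoint a' b')].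

(* The Zariski multiplicity at (ab) is read off from any generic a' in the
   infinitesimal neighbourhood of a; a' is kept as a parameter. *)
Definition zariski_mult (r m : nat) (F : set (pts (biproj_space r m) k))
    (a' : pts (proj_space r) K) (b : pts (proj_space m) k) (n : nat) :=
  (zariski_fibre F a' b #= `I_n)%card.

Definition zariski_unramified (r m : nat) (F : set (pts (biproj_space r m) k))
    (a' : pts (proj_space r) K) (b : pts (proj_space m) k) :=
  zariski_mult F a' b 1.

End Specialisation.

(* Main.v *)
Require Import Defs.
From HB Require Import structures.
From mathcomp Require Import all_boot all_order all_algebra all_field.
From mathcomp Require Import boolp classical_sets functions cardinality topology.
From mathcomp Require Import mpoly ring.

Set Implicit Arguments.
Unset Strict Implicit.
Unset Printing Implicit Defensive.
Import Order.TTheory GRing.Theory Num.Theory.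
Local Open Scope classical_set_scope.
Local Open Scope ring_scope.
Local Open Scope quotient_scope.
Local Notation coord := Defs.coord.
Local Notation mweight := Defs.mweight.

(** Let R and O be the local rings of D at a and of F at (ab). Both are discrete
valuation rings, with uniformisers t and s, and t = u s^n in O for a unit u.
The ideals of O above m_a O = (s^n) are the (s^e) with e <= n, so the algebraic
multiplicity is n ([princ_length]). It remains to count the b' near b with
(a', b') on F.

Two rational functions on a curve are algebraically dependent over L
([algebraically_dependent]): otherwise a homomorphism extension theorem
([ext_ring]) produces a K-point whose closure over L sits strictly between a
point and the curve. This gives the structure of R and O ([regular_unif]), and
it shows that no nonzero function on D vanishes at a', so that evaluation at a'
embeds L(D) in K and R in the valuation ring V. A point b' of the fibre then
amounts to a homomorphism from O to V extending R -> V, and b' is determined by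
the value of s ([point_over_sep]).

At most n points ([points_at_most]): replacing s^n by u^-1 t repeatedly gives
s^n = P(s) + t^N w with P over R of degree below n, for every N. Hence at each
of the values e of s, the monic polynomial X^n - P is divisible by a'(t)^N,
where a'(t) is the image of t in V. Divided differences at n+1 distinct values
would make a fixed nonzero element, algebraic over L(D), divisible by every
power of a'(t), which is impossible ([archimedean]).

At least n points: the minimal equation of s over L(D), made primitive over R,
has its coefficients of index below n in (t) ([equation_coef]), so at least n of
its roots in K lie in the maximal ideal of V ([roots_in_ideal]), and they are
distinct because the cover is separable. A root e extends the embedding of L(D)
to the coordinate functions of F, giving a point (a', b') of F with s equal to
e; by properness b' specialises to some b1 in the fibre over a. The uniformiser
s is a combination of coordinate functions chosen not to vanish at the other
points of this finite fibre ([separating_poly], [generic_uniformizer]), so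
b1 = b ([lift_root]).

For the last assertion, n = 1 means that m_a O is the maximal ideal of O, that
is, that the cover is unramified at (ab). It is flat everywhere, its local rings
being torsion-free over discrete valuation rings ([torsion_free_flat]). It is
unramified off the zeros of a nonzero form, by separability
([generically_unramified]), and these zeros are isolated near the nonsingular
point (ab) ([isolated_zero]); so being unramified at (ab) propagates to a
neighbourhood. *)

(** * Extending homomorphisms to algebraically closed fields *)

Section ClosedField.
Variable k : closedFieldType.

Lemma nonroot_exists (p : {poly k}) : p != 0 -> exists c, p.[c] != 0.
Proof.
move=> p0.
have /closed_rootP [c] : size (p * 'X + 1) != 1%N.
  by rewrite size_MXaddC (negbTE p0) /= eqSS size_poly_eq0.
rewrite rootE !hornerE => /eqP E; exists c; apply/eqP => pc.
by move/eqP: E; rewrite pc mul0r add0r oner_eq0.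
Qed.

End ClosedField.

Section PolyExtension.
Variables (A M : comNzRingType) (j : {rmorphism A -> M}) (z : M).

(** Evaluation at z of polynomials with coefficients acting through j, as a ring
  morphism that can itself serve as j for a further variable. *)
Definition pev : {poly A} -> M := horner_morph (fun x => mulrC z (j x)).
HB.instance Definition _ := GRing.RMorphism.on pev.

Lemma pevE p : pev p = (map_poly j p).[z]. Proof. by []. Qed.

Lemma pevC c : pev c%:P = j c.
Proof. by rewrite pevE map_polyC hornerC. Qed.

Lemma pevX : pev 'X = z.
Proof. by rewrite pevE map_polyX hornerX. Qed.

Lemma pevZ c p : pev (c *: p) = j c * pev p.
Proof. by rewrite -mul_polyC rmorphM /= pevC. Qed.

End PolyExtension.

(** This replaces a factorisation of phi through the image of j, which need not be
  available as a ring. *)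
Definition compat (A B C : comNzRingType) (j : A -> B) (phi : A -> C) :=
  forall x, j x = 0 -> phi x = 0.

Section Extension.
Variables (A : comNzRingType) (M : idomainType) (j : {rmorphism A -> M}) (z : M).
Local Notation ev := (pev j z).

(** The minimal polynomial of z over the image of j, without fractions: it is not
  monic, and polynomials count as zero when their image under j is. *)
Definition min_rel (G : {poly A}) :=
  [/\ ev G = 0, j (lead_coef G) != 0 &
      forall p : {poly A}, (size p < size G)%N -> ev p = 0 -> map_poly j p = 0].

(** Hence a polynomial of least size, among those with a property that depends
  only on the images under j and ev, has its leading coefficient off the kernel of j. *)
Lemma drop_lead (p : {poly A}) : p != 0 -> j (lead_coef p) = 0 ->
  exists q : {poly A}, [/\ (size q < size p)%N, ev q = ev p & map_poly j q = map_poly j p].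
Proof.
move=> p0 l0; exists (p - lead_coef p *: 'X^((size p).-1)); split.
- have sp : (0 < size p)%N by rewrite lt0n size_poly_eq0.
  rewrite -[X in (_ < X)%N](prednK sp) ltnS; apply/leq_sizeP => i; rewrite leq_eqVlt.
  rewrite coefB coefZ coefXn => /orP[/eqP <-|lt].
    by rewrite eqxx mulr1 lead_coefE subrr.
  rewrite gtn_eqF // mulr0 subr0 nth_default //.
  by rewrite -(prednK sp).
- by rewrite rmorphB /= pevZ l0 mul0r subr0.
- by rewrite rmorphB /= map_polyZ l0 scale0r subr0.
Qed.

Lemma min_size_poly (P : {poly A} -> Prop) : (exists p, P p) ->
  exists2 p, P p & forall q : {poly A}, (size q < size p)%N -> ~ P q.
Proof.
move=> [p0 Pp0].
have ex : exists n, `[< exists2 p, P p & size p = n >].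
  by exists (size p0); apply/asboolP; exists p0.
have [_ /asboolP[p Pp <-] pmin] := ex_minnP ex.
exists p => // q qp Pq.
have := pmin (size q); rewrite leqNgt qp => /(_ _)/negP; case=> //.
by apply/asboolP; exists q.
Qed.

Lemma min_relP : (exists2 p, ev p = 0 & map_poly j p != 0) -> exists G, min_rel G.
Proof.
move=> [p0 e0 n0].
have [|G [eG nG] Gmin] := @min_size_poly (fun p => ev p = 0 /\ map_poly j p != 0).
  by exists p0.
exists G; split=> //.
  apply/eqP => l0; have [|q [sq eq mq]] := drop_lead _ l0.
    by apply: contra_neq nG => ->; rewrite rmorph0.
  by apply: (Gmin q sq); rewrite eq mq.
move=> p sp ep; apply: contrapT => /eqP np.
exact: (Gmin p sp).
Qed.

Lemma pseudo_div (p d : {poly A}) : d != 0 ->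
  exists e q r, lead_coef d ^+ e *: p = q * d + r /\ (size r < size d)%N.
Proof.
move=> d0; have := Pdiv.ComRing.rdivp_eq d p => E.
by do 3 eexists; split; [exact: E|rewrite Pdiv.CommonRing.ltn_rmodp].
Qed.

Lemma map_eq0_ev p : map_poly j p = 0 -> ev p = 0.
Proof. by rewrite pevE => ->; rewrite horner0. Qed.

Section Min.
Variables (G : {poly A}) (mG : min_rel G).

Lemma min_neq0 : G != 0.
Proof. by case: mG => _ + _; apply: contra_neq => ->; rewrite lead_coef0 rmorph0. Qed.

Lemma size_map_inj (p : {poly A}) : j (lead_coef p) != 0 -> size (map_poly j p) = size p.
Proof.
move=> h; rewrite size_poly_eq // rmorph_eq0 //.
Qed.

Lemma min_size : (1 < size G)%N.
Proof.
have [eG lG Gmin] := mG.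
have := min_neq0; rewrite -size_poly_eq0 -lt0n => s0.
rewrite ltn_neqAle s0 andbT eq_sym; apply/negP => /size_poly1P[c c0 Gc].
by move: eG lG; rewrite Gc pevC lead_coefC => ->; rewrite eqxx.
Qed.

(** The remainder of the pseudo-division of p by G is a relation of smaller size
  than G, hence trivial. *)
Lemma min_dvd p : ev p = 0 -> exists e q r,
  lead_coef G ^+ e *: p = q * G + r /\ map_poly j r = 0.
Proof.
have [eG lG Gmin] := mG => ep.
have [e [q [r [E sr]]]] := pseudo_div p min_neq0.
exists e, q, r; split=> //; apply: Gmin => //.
by have := congr1 ev E; rewrite pevZ ep mulr0 rmorphD rmorphM /= eG mulr0 add0r => <-.
Qed.

Section Root.
Variables (k : comNzRingType) (phi : {rmorphism A -> k}).
Hypothesis cphi : compat j phi.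

Lemma compat_map p : map_poly j p = 0 -> map_poly phi p = 0.
Proof.
move=> h; apply/polyP => i; rewrite coef_map coef0; apply: cphi.
by rewrite -coef_map h coef0.
Qed.

End Root.

(** By [min_dvd] every relation on z is a multiple of G up to a power of its leading
  coefficient, which phi does not kill; so it holds at any root of the image of G. *)
Lemma compat_root (k : idomainType) (phi : {rmorphism A -> k}) (c : k) :
  compat j phi -> phi (lead_coef G) != 0 -> pev phi c G = 0 ->
  compat ev (pev phi c).
Proof.
move=> cphi lG eG p /min_dvd [e [q [r [E r0]]]].
have /eqP := congr1 (pev phi c) E; rewrite pevZ rmorphD rmorphM /= eG mulr0 add0r.
rewrite (_ : pev phi c r = 0); last by rewrite pevE (compat_map cphi) ?horner0.
by rewrite rmorphXn mulf_eq0 expf_eq0 (negbTE lG) andbF /= => /eqP.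
Qed.

(** Consider a polynomial p of least size among those with p(z) nonzero and a
  multiple of b(z). Were it not constant, the pseudo-division of G by p would produce
  either a smaller such polynomial, as remainder, or a relation on z smaller than G, as
  quotient. *)
Lemma alg_inv b : ev b != 0 -> exists a U, j a != 0 /\ ev (a%:P - U * b) = 0.
Proof.
have [eG lG Gmin] := mG => nb.
pose P p := ev p != 0 /\ exists U, ev (p - U * b) = 0.
have [|p [np [U eU]] pmin] := @min_size_poly P.
  by exists b; split=> //; exists 1; rewrite mul1r subrr rmorph0.
have p0 : p != 0 by apply: contra_neq np => ->; rewrite rmorph0.
have pG : (size p < size G)%N.
  rewrite ltnNge; apply/negP => sGp.
  have [e [q [r [E sr]]]] := pseudo_div p min_neq0.
  have er : ev r = j (lead_coef G) ^+ e * ev p.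
    by rewrite -rmorphXn -pevZ E rmorphD rmorphM /= eG mulr0 add0r.
  apply: (pmin r); first exact: leq_trans sr sGp.
  split; first by rewrite er mulf_neq0 // expf_neq0.
  exists ((lead_coef G ^+ e)%:P * U); rewrite -mulrA rmorphB /= er rmorphM /= pevC rmorphXn.
  by rewrite -mulrBr; move: eU; rewrite rmorphB /= => ->; rewrite mulr0.
have lp : j (lead_coef p) != 0.
  apply/eqP => l0; have [q [sq eq _]] := drop_lead p0 l0.
  apply: (pmin q sq); split; first by rewrite eq.
  by exists U; rewrite rmorphB /= eq -rmorphB.
suff sp1 : size p = 1%N.
  have /size_poly1P[c c0 pc] : size p == 1%N by rewrite sp1.
  exists c, U; rewrite -pc; split=> //; by move: lp; rewrite pc lead_coefC.
apply/eqP; rewrite eqn_leq lt0n size_poly_eq0 p0 andbT leqNgt; apply/negP => sp.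
(* If p is not constant, q turns out to be a nonzero relation smaller than G. *)
have [e [q [r [E sr]]]] := pseudo_div G p0.
have er : ev r = - (ev q * ev p).
  have /eqP := congr1 ev E; rewrite pevZ eG mulr0 rmorphD rmorphM /= eq_sym addrC addr_eq0.
  by move/eqP.
have er0 : ev r = 0.
  apply: contrapT => /eqP nr; apply: (pmin r sr); split=> //.
  exists (- q * U); move: eU; rewrite !rmorphB !rmorphM /= rmorphN er => /eqP.
  by rewrite subr_eq0 => /eqP ->; ring.
have r0 : map_poly j r = 0 by apply: Gmin => //; exact: ltn_trans sr pG.
have q0 : ev q = 0.
  by move/eqP: er; rewrite er0 eq_sym oppr_eq0 mulf_eq0 (negbTE np) orbF => /eqP.
have EM : j (lead_coef p) ^+ e *: map_poly j G = map_poly j q * map_poly j p.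
  by rewrite -rmorphXn -map_polyZ E rmorphD rmorphM /= r0 addr0.
have nM : map_poly j G != 0 by rewrite -size_poly_eq0 size_map_inj // size_poly_eq0 min_neq0.
have nqM : map_poly j q != 0.
  apply: contra_neq nM => q'; move/eqP: EM.
  by rewrite q' mul0r -mul_polyC mulf_eq0 polyC_eq0 expf_eq0 (negbTE lp) andbF => /eqP.
have sqM : (size (map_poly j q) < size (map_poly j G))%N.
  have := congr1 (fun u : {poly M} => size u) EM; rewrite size_scale ?expf_neq0 // => ->.
  have sj := size_map_inj lp.
  rewrite size_mul // -?size_poly_eq0 ?sj ?size_poly_eq0 // -(prednK (ltnW sp)) addnS /= -[X in (X < _)%N]addn0 ltn_add2l.
  by rewrite -ltnS (prednK (ltnW sp)).
(* q may have spurious leading terms in the kernel of j: they are cut off. *)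
have [q' [sq' eq' mq']] : exists q' : {poly A}, [/\ (size q' < size G)%N, ev q' = 0 & map_poly j q' != 0].
  exists (take_poly (size (map_poly j q)) q).
  have mt : map_poly j (take_poly (size (map_poly j q)) q) = map_poly j q.
    apply/polyP => i; rewrite coef_map coef_take_poly.
    case: ltnP => [_|lei]; first by rewrite coef_map.
    by rewrite [RHS]nth_default //; exact: (rmorph0 j).
  split; last by rewrite mt.
    apply: leq_ltn_trans (size_take_poly _ _) _.
    by rewrite -(size_map_inj lG).
  by rewrite pevE mt -pevE.
by move/eqP: mq'; apply; exact: Gmin.
Qed.

End Min.

(** If z is transcendental over A, its image only has to avoid the roots of one
  polynomial. If z is algebraic, it is sent to a root of the minimal relation, and b
  survives because by [alg_inv] it divides a constant that does. *)
Lemma ext_step (b : {poly A}) : ev b != 0 -> exists a, j a != 0 /\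
  forall (k : closedFieldType) (phi : {rmorphism A -> k}), compat j phi ->
  phi a != 0 -> exists c, compat ev (pev phi c) /\ pev phi c b != 0.
Proof.
move=> nb.
have [ex|nex] := pselect (exists2 p, ev p = 0 & map_poly j p != 0).
  have [G mG] := min_relP ex; have [a [U [ja eU]]] := alg_inv mG nb.
  have lG : j (lead_coef G) != 0 by case: mG.
  exists (a * lead_coef G); split; first by rewrite rmorphM mulf_neq0.
  move=> k phi cphi; rewrite rmorphM mulf_eq0 negb_or => /andP[pa pl].
  have /closed_rootP[c rc] : size (map_poly phi G) != 1%N.
    rewrite size_poly_eq ?(gtn_eqF (min_size mG)) //.
  have cc : compat ev (pev phi c).
    by apply: (compat_root mG) => //; apply/eqP; rewrite pevE.
  exists c; split=> //; have /eqP := cc _ eU.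
  rewrite rmorphB /= pevC rmorphM /= subr_eq0 => /eqP E.
  by apply: contra_neq pa => e0; rewrite E e0 mulr0.
have [i ni] : exists i, j b`_i != 0.
  apply: contrapT => h; case/eqP: nb; apply: map_eq0_ev.
  apply/polyP => i; rewrite coef_map coef0; apply: contrapT => /eqP ni.
  by apply: h; exists i.
exists b`_i; split=> // k phi cphi ki.
have [c nc] : exists c, (map_poly phi b).[c] != 0.
  apply: nonroot_exists; apply: contra_neq ki => h.
  by rewrite -coef_map h coef0.
exists c; split=> // p ep; rewrite pevE (compat_map cphi) ?horner0 //.
by apply: contrapT => /eqP np; apply: nex; exists p.
Qed.

End Extension.

(** The extension theorem for homomorphisms to an algebraically closed field. B is an
  iterated polynomial ring over A mapping onto A[s] in M, rather than A[s] itself, so that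
  homomorphisms out of it are defined by the images of the variables; those which are
  compatible with jB are the homomorphisms out of A[s]. *)
Lemma ext_ring (k : closedFieldType) (M : idomainType) (s : seq M) (A : comNzRingType)
    (j : {rmorphism A -> M}) :
  exists (B : comNzRingType) (i : {rmorphism A -> B}) (jB : {rmorphism B -> M}),
  [/\ forall x, jB (i x) = j x,
      forall z, z \in s -> exists x, jB x = z &
      forall b, jB b != 0 -> exists a, j a != 0 /\
        forall (phi : {rmorphism A -> k}), compat j phi -> phi a != 0 ->
        exists phiB : {rmorphism B -> k},
          [/\ forall x, phiB (i x) = phi x, compat jB phiB & phiB b != 0]].
Proof.
elim: s A j => [|z s IH] A j.
  exists A, idfun, j; split=> // b nb; exists b; split=> // phi cphi nphi.
  by exists phi.
have [B [i [jB [ji surj ext]]]] := IH _ (pev j z : {rmorphism {poly A} -> M}).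
exists B, (i \o polyC), jB; split.
- by move=> x; rewrite /= ji /= pevC.
- move=> y; rewrite inE => /orP[/eqP ->|/surj //].
  by exists (i 'X); rewrite ji /= pevX.
move=> b /ext [a [na ext1]].
have [a' [na' ext2]] := ext_step na.
exists a'; split=> // phi cphi nphi.
have [c [cc nc]] := ext2 _ _ cphi nphi.
have [phiB [E cB nB]] := ext1 (pev phi c : {rmorphism {poly A} -> k}) cc nc.
by exists phiB; split=> // x; rewrite /= E /= pevC.
Qed.

(** * Valuation rings and divided differences *)

Section Valuation.
Variables (K : fieldType) (v : valuation K).
Local Notation V := (valuation_ring v).
Local Notation m := (valuation_ideal v).

Lemma valD_ge0 (x y : value_group v) : 0 <= x -> 0 <= y -> 0 <= x + y.
Proof. by move=> x0 y0; apply: le_trans x0 _; rewrite -[leLHS]addr0; exact: value_add. Qed.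

Lemma valD_gt0 (x y : value_group v) : 0 < x -> 0 <= y -> 0 < x + y.
Proof.
move=> x0 y0; apply: lt_le_trans x0 _; rewrite -[leLHS]addr0; exact: value_add.
Qed.

Lemma val_le_lt (x : value_group v) : (x <= 0) || (0 < x).
Proof.
have /orP[h|->//] := @value_total _ v 0 x.
by case: (eqVneq x 0) => [->|n]; rewrite ?lexx // lt_neqAle eq_sym n h orbT.
Qed.

Lemma valN_ge0 (x : value_group v) : x <= 0 -> 0 <= - x.
Proof. by move=> h; have := @value_add _ v _ _ (- x) h; rewrite addNr addr0. Qed.

Lemma valN_gt0 (x : value_group v) : x < 0 -> 0 < - x.
Proof.
move=> h; rewrite lt_neqAle valN_ge0 ?ltW // andbT eq_sym oppr_eq0.
by rewrite lt_eqF.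
Qed.

Lemma val1 : v 1 = 0.
Proof.
apply: (@addrI _ (v 1)); rewrite addr0 -val_ofM ?oner_neq0 //.
by rewrite mulr1.
Qed.

Lemma valV x : x != 0 -> v x^-1 = - v x.
Proof.
move=> n; apply: (@addrI _ (v x)); rewrite subrr -val_ofM ?invr_eq0 //.
by rewrite mulfV // val1.
Qed.

Lemma valN x : x != 0 -> v (- x) = v x.
Proof.
move=> n; have N1 : (-1 : K) != 0 by rewrite oppr_eq0 oner_neq0.
have h : v (-1) + v (-1) = 0 by rewrite -val_ofM // mulrNN mulr1 val1.
rewrite -mulN1r val_ofM //.
suff -> : v (-1) = 0 by rewrite add0r.
have /orP[le|lt] := val_le_lt (v (-1)).
  have /orP[le'|lt] := val_le_lt (- v (-1)).
    apply: le_anti; rewrite le /=.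
    by have := valN_ge0 le'; rewrite opprK.
  have := valD_gt0 lt (valN_ge0 le); rewrite -opprD h oppr0.
  by rewrite ltxx.
by have := valD_gt0 lt (ltW lt); rewrite h ltxx.
Qed.

Lemma vring0 : V 0. Proof. by left. Qed.
Lemma videal0 : m 0. Proof. by left. Qed.
Lemma vring1 : V 1. Proof. by right; rewrite val1. Qed.

Lemma vringP x : x != 0 -> V x <-> 0 <= v x.
Proof. by move=> n; split=> [[E|//]|]; [rewrite E eqxx in n|right]. Qed.

Lemma videalP x : x != 0 -> m x <-> 0 < v x.
Proof. by move=> n; split=> [[E|//]|]; [rewrite E eqxx in n|right]. Qed.

Lemma vringN x : V x -> V (- x).
Proof.
case: (eqVneq x 0) => [->|n]; first by rewrite oppr0.
by rewrite !vringP ?oppr_eq0 // valN.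
Qed.

Lemma videalN x : m x -> m (- x).
Proof.
case: (eqVneq x 0) => [->|n]; first by rewrite oppr0.
by rewrite !videalP ?oppr_eq0 // valN.
Qed.

Lemma videalW x : m x -> V x.
Proof. by case=> [->|/ltW]; [left|right]. Qed.

Lemma val_min_ge (x y : value_group v) : 0 <= x -> 0 <= y -> 0 <= Order.min x y.
Proof. by rewrite /Order.min; case: ifP. Qed.

Lemma val_min_gt (x y : value_group v) : 0 < x -> 0 < y -> 0 < Order.min x y.
Proof. by rewrite /Order.min; case: ifP. Qed.

Lemma vringD x y : V x -> V y -> V (x + y).
Proof.
case: (eqVneq x 0) => [->|nx]; first by rewrite add0r.
case: (eqVneq y 0) => [->|ny]; first by rewrite addr0.
case: (eqVneq (x + y) 0) => [->|n]; first by move=> _ _; exact: vring0.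
rewrite !vringP // => hx hy; apply: le_trans (val_ofD _ _ _ _) => //.
exact: val_min_ge.
Qed.

Lemma videalD x y : m x -> m y -> m (x + y).
Proof.
case: (eqVneq x 0) => [->|nx]; first by rewrite add0r.
case: (eqVneq y 0) => [->|ny]; first by rewrite addr0.
case: (eqVneq (x + y) 0) => [->|n]; first by move=> _ _; exact: videal0.
rewrite !videalP // => hx hy; apply: lt_le_trans (val_ofD _ _ _ _) => //.
exact: val_min_gt.
Qed.

Lemma vringB x y : V x -> V y -> V (x - y).
Proof. by move=> hx /vringN; exact: vringD. Qed.

Lemma videalB x y : m x -> m y -> m (x - y).
Proof. by move=> hx /videalN; exact: videalD. Qed.

Lemma vringM x y : V x -> V y -> V (x * y).
Proof.
case: (eqVneq x 0) => [->|nx]; first by rewrite mul0r.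
case: (eqVneq y 0) => [->|ny]; first by rewrite mulr0.
by rewrite !vringP ?mulf_neq0 // val_ofM //; exact: valD_ge0.
Qed.

Lemma videalM x y : m x -> V y -> m (x * y).
Proof.
case: (eqVneq x 0) => [->|nx]; first by rewrite mul0r.
case: (eqVneq y 0) => [->|ny]; first by rewrite mulr0 => _ _; exact: videal0.
by rewrite !videalP ?vringP ?mulf_neq0 // val_ofM //; exact: valD_gt0.
Qed.

Lemma videalMl x y : V x -> m y -> m (x * y).
Proof. by rewrite mulrC => *; exact: videalM. Qed.

Lemma vringX x n : V x -> V (x ^+ n).
Proof.
move=> h; elim: n => [|n IH]; first exact: vring1.
by rewrite exprS; exact: vringM.
Qed.

Lemma videal1 : ~ m 1.
Proof. by rewrite videalP ?oner_neq0 // val1 ltxx. Qed.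

Lemma videalVN x : ~ V x -> m x^-1.
Proof.
case: (eqVneq x 0) => [->|nx]; first by case; left.
rewrite vringP // videalP ?invr_eq0 // valV // => h.
have /orP[le|lt] := val_le_lt (v x); last by case: h; exact: ltW.
apply: valN_gt0; rewrite lt_neqAle le andbT; apply/eqP => E.
by apply: h; rewrite E.
Qed.

Lemma vringV x : ~ m x -> V x^-1.
Proof.
case: (eqVneq x 0) => [->|nx]; first by case; left.
rewrite vringP ?invr_eq0 // videalP // valV // => h.
apply: valN_ge0; by have /orP[] := val_le_lt (v x).
Qed.

Lemma vring_sum I (r : seq I) (P : pred I) (f : I -> K) :
  (forall i, P i -> V (f i)) -> V (\sum_(i <- r | P i) f i).
Proof. by move=> h; elim/big_ind: _ => //; [exact: vring0|exact: vringD]. Qed.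

Lemma videal_sum I (r : seq I) (P : pred I) (f : I -> K) :
  (forall i, P i -> m (f i)) -> m (\sum_(i <- r | P i) f i).
Proof. by move=> h; elim/big_ind: _ => //; [exact: videal0|exact: videalD]. Qed.

Definition vdvd (x y : K) := exists2 w, V w & y = x * w.

Lemma vdvdB x y z : vdvd x y -> vdvd x z -> vdvd x (y - z).
Proof.
move=> [w Vw ->] [u Vu ->]; exists (w - u); [exact: vringB|by rewrite mulrBr].
Qed.

Lemma vdvdM x y z : vdvd x y -> V z -> vdvd x (z * y).
Proof. by move=> [w Vw ->] Vz; exists (z * w); [exact: vringM|rewrite mulrCA]. Qed.

(** Replacing G by its first divided difference at e0, multiplied by the
  product of the e - e0, lowers the degree and keeps the divisibility by c at the other
  points. The list ds depends on the points alone: it is fixed before c and G, so that c may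
  later run through all the powers of an element. *)
Lemma divided_difference (es : seq K) : uniq es -> (forall e, e \in es -> V e) ->
  exists ds : seq (K * K), [/\ (forall x, x \in ds -> [&& x.1 \in es, x.2 \in es & x.1 != x.2]) &
  forall (c d : K) (G : {poly K}), (size G <= size es)%N -> (0 < size es)%N ->
    G`_(size es).-1 = d ->
    (forall e, e \in es -> vdvd c G.[e]) ->
    vdvd c (\prod_(x <- ds) (x.1 - x.2) * d)].
Proof.
elim: es => [|e0 es IH]; first by exists [::]; split.
move=> /= /andP[e0es ues] Ves.
have [|ds [dsP H]] := IH ues; first by move=> e ees; apply: Ves; rewrite inE ees orbT.
exists ([seq (e, e0) | e <- es] ++ ds); split.
  move=> x; rewrite mem_cat => /orP[/mapP[e ees ->]|/dsP/and3P[h1 h2 h3]] /=.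
    by rewrite !inE eqxx ees orbT /=; apply: contraNneq e0es => <-.
  by rewrite !inE h1 h2 h3 !orbT.
move=> c d G sG _ Gd Gdvd; rewrite big_cat /= big_map /=.
have Ve0 : V e0 by apply: Ves; rewrite mem_head.
case: es => [|e1 es] in e0es ues Ves IH dsP H sG Gd Gdvd *.
  rewrite big_nil mul1r.
  have -> : \prod_(x <- ds) (x.1 - x.2) = 1.
    by case: ds dsP {H} => [|x ds dsP]; [rewrite big_nil|have := dsP x (mem_head _ _)].
  rewrite mul1r; have := Gdvd e0 (mem_head _ _).
  by rewrite (size1_polyC sG) hornerC -Gd.
set es' := e1 :: es in e0es ues Ves IH dsP H sG Gd Gdvd *.
pose Q := (G - G.[e0]%:P) %/ ('X - e0%:P).
have EG : G - G.[e0]%:P = Q * ('X - e0%:P).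
  by rewrite divpK // dvdp_XsubCl rootE !hornerE subrr.
have QE i : G`_i.+1 = Q`_i - e0 * Q`_i.+1.
  have := congr1 (fun p : {poly K} => p`_i.+1) EG.
  rewrite coefB coefC /= subr0 => ->.
  by rewrite mulrBr coefB coefMX /= coefMC mulrC.
have sQ : (size Q <= size es')%N.
  have [->|Q0] := eqVneq Q 0; first by rewrite size_poly0.
  have : (size (Q * ('X - e0%:P))%R <= (size es').+1)%N.
    rewrite -EG; apply: leq_trans (size_polyD _ _) _; rewrite geq_max sG /= size_polyN.
    exact: leq_trans (size_polyC_leq1 _) _.
  by rewrite size_Mmonic ?monicXsubC // size_XsubC addn2.
(* The factor e - e0 of kap turns Q.[e] back into a difference of values of G. *)
pose kap := \prod_(e <- es') (e - e0).
have := H c (kap * d) (kap *: Q) (leq_trans (size_scale_leq _ _) sQ) isT.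
rewrite mulrA [X in vdvd c (X * d)]mulrC; apply.
  rewrite coefZ; congr (_ * _); rewrite -Gd.
  rewrite -[X in _ = G`_X]/((size es).+1) QE (nth_default 0 (_ : size Q <= (size es).+1)%N) //.
  by rewrite mulr0 subr0.
move=> e ees; rewrite hornerZ /kap (perm_big _ (perm_to_rem ees)) big_cons.
rewrite mulrAC mulrC; apply: vdvdM; last first.
  rewrite big_seq; elim/big_ind: _ => //; [exact: vring1|exact: vringM|].
  move=> i /mem_rem ies; apply: vringB => //; apply: Ves; by rewrite inE ies orbT.
have := congr1 (fun p : {poly K} => p.[e]) EG; rewrite !hornerE => /=.
rewrite mulrC => <-; apply: vdvdB; apply: Gdvd; rewrite ?mem_head //.
by rewrite inE ees orbT.
Qed.

End Valuation.

(** * Roots in the maximal ideal of a valuation *)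

Section NewtonPolygon.
Variables (K : closedFieldType) (v : valuation K).
Local Notation V := (valuation_ring v).
Local Notation m := (valuation_ideal v).

(** Each factor X - x is kept when x is in the maximal ideal, and replaced by
  1 - X/x otherwise. Modulo the maximal ideal these become X and a polynomial with constant
  term 1, so that w is the order at 0 of the reduction of Q. *)
Lemma split_primitive (rs : seq K) : exists (c : K) (Q : {poly K}) (w : nat),
  [/\ c != 0, \prod_(x <- rs) ('X - x%:P) = c *: Q, forall i, V Q`_i,
     ~ m Q`_w /\ (forall i, (i < w)%N -> m Q`_i) & w = count (fun x => `[< m x >]) rs].
Proof.
elim: rs => [|x rs [c [Q [w [c0 E QV [Qw Qm] wE]]]]].
  exists 1, 1, 0%N; split=> //; rewrite ?oner_neq0 ?big_nil ?scale1r //.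
    by move=> i; rewrite coef1; case: eqP => _; [exact: (vring1 v)|exact: (vring0 v)].
  by split=> //; rewrite coef1 eqxx; exact: (@videal1 _ v).
rewrite big_cons E /=; case: (pselect (m x)) => [mx|nx]; rewrite ?(asboolT mx) ?(asboolF nx).
  exists c, (('X - x%:P) * Q), w.+1.
  have QE i : (('X - x%:P) * Q)`_i = (if i is i'.+1 then Q`_i' else 0) - x * Q`_i.
    by rewrite mulrBl coefB coefXM coefCM; case: i.
  split=> //; first by rewrite scalerAr.
  - move=> i; rewrite QE; apply: vringB; first by case: i => [|i]; [exact: (vring0 v)|].
    by apply: vringM => //; exact: videalW.
  - split=> [|i]; rewrite QE.
      move=> h; apply: Qw; rewrite -[Q`_w](subrK (x * Q`_w.+1)).
      by apply: videalD => //; apply: videalM.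
    move=> iw; apply: videalB; first by case: i iw => [_|i]; [exact: videal0|exact: Qm].
    exact: videalM.
  - by rewrite wE.
have x0 : x != 0 by apply/eqP => x0; apply: nx; left.
have Vx := vringV nx.
exists (- x * c), ((1 - x^-1 *: 'X) * Q), w.
have QE i : ((1 - x^-1 *: 'X) * Q)`_i = Q`_i - x^-1 * (if i is i'.+1 then Q`_i' else 0).
  by rewrite mulrBl mul1r coefB -scalerAl coefZ coefXM; case: i.
split=> //.
- by rewrite mulf_neq0 // oppr_eq0.
- rewrite [- x * c]mulrC -scalerA -scalerAr; congr (c *: _); rewrite scalerAl; congr (_ * Q).
  by rewrite scalerBr scalerA mulNr mulfV // scaleN1r opprK addrC scaleNr alg_polyC.
- move=> i; rewrite QE; apply: vringB => //; apply: vringM => //; by case: i => [|i]; [exact: (vring0 v)|].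
- split=> [|i iw]; rewrite QE.
    move=> h; apply: Qw; set y := (X in _ - X) in h.
    rewrite -[Q`_w](subrK y); apply: videalD => //; apply: videalMl => //.
    by case: (w) Qm => [_|w' Qm]; [exact: videal0|exact: Qm].
  apply: videalB; first exact: Qm.
  apply: videalMl => //; case: i iw => [_|i iw]; first exact: videal0.
  by apply: Qm; exact: ltnW.
Qed.

(** The part of Newton polygons that concerns slopes above 0: otherwise H would
  differ from the polynomial Q of [split_primitive] by a factor in the maximal ideal, which
  its coefficient 1 excludes. *)
Lemma roots_in_ideal (H : {poly K}) n : (forall i, V H`_i) -> (exists i, H`_i = 1) ->
  (forall i, (i < n)%N -> m H`_i) ->
  exists rs : seq K, H = lead_coef H *: \prod_(x <- rs) ('X - x%:P) /\
    (n <= count (fun x => `[< m x >]) rs)%N.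
Proof.
move=> HV [i1 H1] Hm; have [rs E] := closed_field_poly_normal H.
exists rs; split=> //.
have [c [Q [w [c0 EQ QV [Qw Qm] <-]]]] := split_primitive rs.
rewrite leqNgt; apply/negP => wn.
have HE : H = (lead_coef H * c) *: Q by rewrite {1}E EQ scalerA.
move: (lead_coef H * c) => d in HE.
have md : m d.
  have Q0 : Q`_w != 0 by apply/eqP => h; apply: Qw; left.
  rewrite -[d](mulfK Q0); apply: videalM; last exact: vringV.
  by rewrite -coefZ -HE; exact: Hm.
by apply: (@videal1 _ v); rewrite -H1 HE coefZ; apply: videalM.
Qed.

End NewtonPolygon.

(** * Discrete valuation rings and the length of their quotients *)

Definition domain_like (R : comNzRingType) := forall x y : R, x * y = 0 -> x = 0 \/ y = 0.

(** Either a discrete valuation ring, or a field with t = 0: a regular local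
  ring of dimension at most one can be either, and these properties are common to both. *)
Record uniformizing (R : comNzRingType) (t : R) : Prop := Uniformizing {
  unif_dom : domain_like R;
  unif_nonunit : forall z : R, nonunits z <-> exists y, z = y * t;
  unif_dec : forall g : R, g != 0 -> exists k u w, w * u = 1 /\ g = u * t ^+ k
}.

Section Unif.
Variables (R : comNzRingType) (t : R).
Hypothesis tU : uniformizing t.

Lemma unif_t_nonunit w : w * t <> 1.
Proof.
move=> h; have : nonunits t by apply/(unif_nonunit tU); exists 1; rewrite mul1r.
by apply; exists w.
Qed.

Lemma unif_cancel (x y z : R) : x != 0 -> x * y = x * z -> y = z.
Proof.
move=> x0 /eqP; rewrite -subr_eq0 -mulrBr => /eqP /(unif_dom tU) [E|/eqP].
  by rewrite E eqxx in x0.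
by rewrite subr_eq0 => /eqP.
Qed.

Lemma unif_expf k : t != 0 -> t ^+ k != 0.
Proof.
move=> t0; elim: k => [|k IH]; first by rewrite expr0 oner_neq0.
rewrite exprS; apply/eqP => /(unif_dom tU) [E|E].
  by rewrite E eqxx in t0.
by rewrite E eqxx in IH.
Qed.

Lemma unif_pow_dvd k l y : t != 0 -> t ^+ k = y * t ^+ l -> (l <= k)%N.
Proof.
move=> t0 E; rewrite leqNgt; apply/negP => kl.
apply: (@unif_t_nonunit (y * t ^+ (l - k.+1))).
apply: (unif_cancel (unif_expf k t0)); rewrite mulr1 [RHS]E.
by rewrite -[in RHS](subnKC kl) addSn exprS exprD; ring.
Qed.

Lemma unif_total (x y : R) : (exists w, y = w * x) \/ (exists w, x = w * y).
Proof.
have [->|/(unif_dec tU) [k [u [u' [uu ->]]]]] := eqVneq x 0.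
  by right; exists 0; rewrite mul0r.
have [->|/(unif_dec tU) [l [w [w' [ww ->]]]]] := eqVneq y 0.
  by left; exists 0; rewrite mul0r.
have [kl|/ltnW lk] := leqP k l; [left; exists (w * u' * t ^+ (l - k))|right; exists (u * w' * t ^+ (k - l))].
  by rewrite -{1}(subnK kl) exprD; transitivity (w * (u' * u) * (t ^+ (l - k) * t ^+ k)); [rewrite uu mulr1|ring].
by rewrite -{1}(subnK lk) exprD; transitivity (u * (w' * w) * (t ^+ (k - l) * t ^+ l)); [rewrite ww mulr1|ring].
Qed.

Definition princ (n : nat) : set R^o := [set z | exists y : R, z = y * t ^+ n].

Lemma princ_submod n : submod_closed (mem (princ n)).
Proof.
split; first by rewrite inE; exists 0; rewrite mul0r.
move=> c x y; rewrite !inE => -[x' ->] [y' ->].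
exists (c * x' + y'); rewrite mulrDl -mulrA; reflexivity.
Qed.

Lemma princ_sub i k : (i <= k)%N -> princ k `<=` princ i.
Proof.
by move=> ik z [y ->]; exists (y * t ^+ (k - i)); rewrite -mulrA -exprD subnK.
Qed.

(** Every element is a unit times a power of t, so the ideal is generated by the
  smallest power of t that it contains. *)
Lemma ideal_princ n (S : set R^o) : t != 0 -> submod_closed (mem S) -> princ n `<=` S ->
  exists2 e, (e <= n)%N & S = princ e.
Proof.
move=> t0 [S0 Sl] nS.
have Sm (c x : R) : S x -> S (c * x).
  by move=> Sx; have := Sl c x 0; rewrite !inE addr0; apply=> //; rewrite inE in S0.
have ex : exists e, `[< S (t ^+ e) >].
  by exists n; apply/asboolP; apply: nS; exists 1; rewrite mul1r.
have [e /asboolP Se emin] := ex_minnP ex.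
exists e; first by apply: emin; apply/asboolP; apply: nS; exists 1; rewrite mul1r.
apply/seteqP; split=> [z Sz|z [y ->]]; last exact: Sm.
have [->|/(unif_dec tU) [k [u [u' [uu zE]]]]] := eqVneq (z : R) 0.
  by exists 0; rewrite mul0r.
have : S (t ^+ k).
  have -> : t ^+ k = u' * z by rewrite zE mulrA uu mul1r.
  exact: Sm.
move=> /asboolT /emin ek; exists (u * t ^+ (k - e)).
by rewrite -mulrA -exprD subnK.
Qed.

(** By [ideal_princ] the ideals containing t^n are linearly ordered by the exponents
  of their generators. *)
Lemma princ_length n : t != 0 -> has_length (princ n) n.
Proof.
move=> t0; split.
  exists (fun i => princ (n - i)); split=> i ilt.
    by split; [exact: princ_submod|apply: princ_sub; exact: leq_subr].
  split; first by apply: princ_sub; rewrite leq_sub2l.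
  move=> /(_ (t ^+ (n - i.+1))) []; first by exists 1; rewrite mul1r.
  move=> y /(unif_pow_dvd t0); rewrite leqNgt => /negP; apply.
  by rewrite ltn_sub2l.
move=> m Z [ZC Zlt].
suff H i : (i <= m)%N -> exists2 e, Z i = princ e & (e + i <= n)%N.
  by have [e _] := H m (leqnn _); apply: leq_trans; exact: leq_addl.
elim: i => [|i IH] im.
  have [Zs Zn] := ZC 0%N im; have [e en Ze] := ideal_princ t0 Zs Zn.
  by exists e => //; rewrite addn0.
have [e Ze ei] := IH (ltnW im).
have [Zs Zn] := ZC _ im; have [e' en' Ze'] := ideal_princ t0 Zs Zn.
exists e' => //; rewrite addnS; apply: leq_trans ei; rewrite ltn_add2r ltnNge.
apply/negP => ee; have [_] := Zlt i im; apply.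
by rewrite Ze Ze'; exact: princ_sub.
Qed.

End Unif.

(** * Flatness over a valuation ring *)

Section Flatness.
Variables (R S : comNzRingType) (f : {rmorphism R -> S}).
Hypothesis Rtot : forall x y : R, (exists w, y = w * x) \/ (exists w, x = w * y).
Hypothesis tf : forall (r : R) (s : S), f r * s = 0 -> r = 0 \/ s = 0.

Definition lspan (l : seq S) (x : S) := exists c : nat -> R, x = \sum_(i < size l) f (c i) * l`_i.

Definition indep (l : seq S) := forall c : nat -> R,
  \sum_(i < size l) f (c i) * l`_i = 0 -> forall i, (i < size l)%N -> c i = 0.

Lemma lspan0 l : lspan l 0.
Proof. by exists (fun=> 0); rewrite big1 // => i _; rewrite rmorph0 mul0r. Qed.

Lemma lspanD l x y : lspan l x -> lspan l y -> lspan l (x + y).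
Proof.
move=> [c ->] [d ->]; exists (fun i => c i + d i); rewrite -big_split.
by apply: eq_bigr => i _; rewrite rmorphD mulrDl.
Qed.

Lemma lspanZ l r x : lspan l x -> lspan l (f r * x).
Proof.
move=> [c ->]; exists (fun i => r * c i); rewrite mulr_sumr.
by apply: eq_bigr => i _; rewrite rmorphM mulrA.
Qed.

Lemma lspan_mem l x : x \in l -> lspan l x.
Proof.
move=> xl; exists (fun i => (i == index x l)%:R).
have xi : (index x l < size l)%N by rewrite index_mem.
rewrite (bigD1 (Ordinal xi)) //= eqxx rmorph1 mul1r nth_index // big1 ?addr0 // => i ni.
by rewrite (negbTE (ni : val i != index x l)) rmorph0 mul0r.
Qed.

Lemma lspan_sub l l' : (forall x, x \in l -> lspan l' x) -> forall x, lspan l x -> lspan l' x.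
Proof.
move=> h x [c ->]; elim/big_ind: _ => [|y z|i _]; [exact: lspan0|exact: lspanD|].
by apply: lspanZ; apply: h; exact: mem_nth.
Qed.

(** Totality of divisibility picks a coefficient of least valuation. It serves to
  shorten linear relations and to make polynomials primitive. *)
Lemma min_coef n (c : nat -> R) : (exists2 i, (i < n)%N & c i != 0) ->
  exists i0 d, [/\ (i0 < n)%N, c i0 != 0 & forall i, (i < n)%N -> c i = d i * c i0].
Proof.
elim: n => [|n IH] [i] //.
have [/IH [i0 [d [i0n n0 dE]]] _ _|nex] := pselect (exists2 i, (i < n)%N & c i != 0).
  case: (Rtot (c i0) (c n)) => -[w E].
    exists i0, (fun i => if i == n then w else d i); split=> [||k]; rewrite ?ltnS ?(ltnW i0n) //.
    rewrite leq_eqVlt; case: eqP => [-> _|_ /=]; [exact: E|exact: dE].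
  exists n, (fun i => if i == n then 1 else d i * w); split=> [||k]; rewrite ?ltnS //.
    by apply: contra_neq n0; rewrite E => ->; rewrite mulr0.
  rewrite leq_eqVlt; case: eqP => [-> _|_ /= /dE ->]; first by rewrite mul1r.
  by rewrite -mulrA -E.
rewrite ltnS leq_eqVlt => /orP[/eqP -> n0|lt n0]; last by case: nex; exists i.
exists n, (fun i => (i == n)%:R); split=> // k; rewrite ltnS leq_eqVlt.
case: eqP => [-> _|_ /= lt']; first by rewrite mul1r.
by rewrite mul0r; apply: contrapT => /eqP h; apply: nex; exists k.
Qed.

(** A spanning list of least length is free: there being no torsion, a relation can be
  divided by a coefficient of least valuation, and then expresses one entry through the
  others. *)
Lemma basis_exists (l : seq S) : exists e : seq S, indep e /\ (forall x, x \in l -> lspan e x).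
Proof.
pose P n := exists2 e : seq S, size e = n & forall x, x \in l -> lspan e x.
have ex : exists n, `[< P n >].
  by exists (size l); apply/asboolP; exists l => // x; exact: lspan_mem.
have [n /asboolP[e en el] nmin] := ex_minnP ex.
exists e; split=> // c c0 i ilt; apply: contrapT => /eqP ni.
have [|i0 [d [i0n n0 dE]]] := @min_coef (size e) c; first by exists i.
have E : \sum_(i < size e) f (d i) * e`_i = 0.
  have : f (c i0) * (\sum_(i < size e) f (d i) * e`_i) = 0.
    rewrite mulr_sumr -[RHS]c0; apply: eq_bigr => k _.
    by rewrite (dE k) // rmorphM; ring.
  by move/tf => [h|//]; rewrite h eqxx in n0.
have d1 : d i0 = 1.
  have : f (c i0 * (d i0 - 1)) * 1 = 0.
    by rewrite mulr1 mulrBr mulr1 mulrC -dE // subrr rmorph0.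
  move=> /tf [h|/eqP]; last by rewrite oner_eq0.
  have : f (c i0) * f (d i0 - 1) = 0 by rewrite -rmorphM h rmorph0.
  move=> /tf [h'|h']; first by rewrite h' eqxx in n0.
  have : f (d i0 - 1) * 1 = 0 by rewrite h' mul0r.
  move=> /tf [/eqP|/eqP]; last by rewrite oner_eq0.
  by rewrite subr_eq0 => /eqP.
pose e' := take i0 e ++ drop i0.+1 e.
have se' : (size e' < size e)%N.
  rewrite size_cat size_take size_drop i0n -[X in (_ < X)%N](subnKC i0n) addSn ltnS //.
suff : `[< P (size e') >] by move/nmin; rewrite -en leqNgt se'.
apply/asboolP; exists e' => // x xl; apply: (lspan_sub _ (el x xl)) => y ye.
have ee : e = take i0 e ++ e`_i0 :: drop i0.+1 e by rewrite -drop_nth // cat_take_drop.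
have [->|ny] := eqVneq y e`_i0; last first.
  apply: lspan_mem; move: ye; rewrite ee mem_cat inE (negbTE ny) /=.
  by rewrite mem_cat.
have -> : e`_i0 = f (-1) * \sum_(k < size e | k != Ordinal i0n) f (d k) * e`_k.
  move: E; rewrite (bigD1 (Ordinal i0n)) //= d1 rmorph1 mul1r => /eqP; rewrite addr_eq0 => /eqP ->.
  by rewrite rmorphN1 mulN1r.
apply: lspanZ; elim/big_ind: _ => [|u w|k nk]; [exact: lspan0|exact: lspanD|].
apply: lspanZ; apply: lspan_mem; rewrite mem_cat.
have [ki|ki] := ltnP k i0.
  by rewrite -(nth_take 0 ki) mem_nth // size_take i0n.
have ki' : (i0 < k)%N by rewrite ltn_neqAle ki andbT eq_sym.
apply/orP; right; rewrite -(subnKC ki') -nth_drop mem_nth //.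
by rewrite size_drop ltn_sub2r // (leq_ltn_trans ki').
Qed.

Section Target.
Variable N : lmodType R.
Local Notation W0 := ((S -> R) -> N).

Definition lin_on (l : seq S) (phi : S -> R) :=
  (forall x y, lspan l x -> lspan l y -> phi (x + y) = phi x + phi y) /\
  (forall r x, lspan l x -> phi (f r * x) = r * phi x).

Lemma lin_on_sub l l' phi : (forall x, x \in l -> x \in l') -> lin_on l' phi -> lin_on l phi.
Proof.
move=> sub [hD hZ].
have h : forall x, lspan l x -> lspan l' x by apply: lspan_sub => x /sub; exact: lspan_mem.
by split=> [x y /h hx /h hy|r x /h hx]; [exact: hD|exact: hZ].
Qed.

(** A target for balanced maps in which one can compute. The tensor of n and s goes
  to the function phi |-> phi(s) n on all the functions phi : S -> R; as each
  instance of bilinearity involves finitely many elements of S, functions are identified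
  when they agree on the phi that are linear on the span of some finite list. *)
Definition negligible : {pred W0} := fun F => `[< exists l, forall phi, lin_on l phi -> F phi = 0 >].

Lemma negligible_zmod : zmod_closed negligible.
Proof.
split; first by apply/asboolP; exists [::].
move=> F G /asboolP[l lF] /asboolP[l' lG]; apply/asboolP; exists (l ++ l') => phi lp.
have F0 : F phi = 0 by apply/lF/(lin_on_sub _ lp) => x xl; rewrite mem_cat xl.
have G0 : G phi = 0 by apply/lG/(lin_on_sub _ lp) => x xl; rewrite mem_cat xl orbT.
by change (F phi - G phi = 0); rewrite F0 G0 subr0.
Qed.

HB.instance Definition _ := GRing.isZmodClosed.Build W0 negligible negligible_zmod.

Definition tens := {ideal_quot negligible}.
HB.instance Definition _ := GRing.Zmodule.on tens.
Definition tens_bil (n : N) (s : S) : tens := \pi_tens (fun phi : S -> R => phi s *: n).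

Lemma tens_balanced : balanced f tens_bil.
Proof.
have key F G : negligible (F - G) -> \pi_tens F = \pi_tens G.
  by move=> h; apply/eqP; rewrite -Quotient.idealrBE.
split=> [n n' s|n s s'|r n s]; rewrite /tens_bil -?(raddfD \pi_tens); apply: key; apply/asboolP.
- exists [::] => phi _; change (phi s *: (n + n') - (phi s *: n + phi s *: n') = 0).
  by rewrite scalerDr subrr.
- exists [:: s; s'] => phi [hD _].
  change (phi (s + s') *: n - (phi s *: n + phi s' *: n) = 0).
  by rewrite hD ?scalerDl ?subrr //; apply: lspan_mem; rewrite !inE eqxx ?orbT.
- exists [:: s] => phi [_ hZ].
  change (phi s *: (r *: n) - phi (f r * s) *: n = 0).
  rewrite hZ ?scalerA; last by apply: lspan_mem; rewrite !inE eqxx.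
  by rewrite mulrC subrr.
Qed.

(** The contraction with phi is well defined on tensors only when phi is linear on all
  of S; linearity on the span of a finite list suffices for a given vanishing tensor. *)
Lemma tens_zeroP (t : seq (N * S)) : tensor_zero f t ->
  exists l, forall phi, lin_on l phi -> \sum_(u <- t) phi u.2 *: u.1 = 0.
Proof.
move=> /(_ _ _ tens_balanced); rewrite /tens_bil -(raddf_sum \pi_tens) -[RHS](raddf0 \pi_tens).
move/eqP; rewrite -Quotient.idealrBE subr0 => /asboolP[l H]; exists l => phi /H; by rewrite fct_sumE.
Qed.

End Target.

(** A finitely generated submodule of S is free by [basis_exists]. Take one
  containing the entries of t and the list on which the vanishing of the image of t is
  tested: its coordinate functions are linear, so the coordinates of the image of t, and by
  injectivity those of t, are zero. *)
Lemma torsion_free_flat : flat f.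
Proof.
move=> M N g ginj t /tens_zeroP [l0 H] W b [bDl bDr bZ].
have [e [ie el]] := basis_exists (l0 ++ [seq u.2 | u <- t]).
(* Coordinates on the basis e, extended arbitrarily off its span. *)
have [c cE] : {c : S -> nat -> R | forall x, lspan e x -> x = \sum_(i < size e) f (c x i) * e`_i}.
  apply: cid; suff /choice[c] : forall x, exists c : nat -> R, lspan e x -> x = \sum_(i < size e) f (c i) * e`_i.
    by exists c.
  move=> x; have [[c E]|n] := pselect (lspan e x); first by exists c.
  by exists (fun=> 0) => /n.
have cu x (d : nat -> R) (i : nat) : (i < size e)%N -> lspan e x -> x = \sum_(i < size e) f (d i) * e`_i -> c x i = d i.
  move=> il ex E; apply/eqP; rewrite -subr_eq0; apply/eqP; move: i il.
  apply: (ie (fun i => c x i - d i)).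
  apply: (@etrans _ _ (\sum_(i < size e) f (c x i) * e`_i - \sum_(i < size e) f (d i) * e`_i)).
    by rewrite -sumrB; apply: eq_bigr => i _; rewrite rmorphB mulrBl.
  by rewrite -(cE x ex) -E subrr.
have clin (i : nat) : (i < size e)%N -> lin_on e (fun x => c x i).
  move=> il; split=> [x y hx hy|r x hx].
    apply: (cu _ (fun i => c x i + c y i)) => //; first exact: lspanD.
    transitivity (\sum_(i < size e) f (c x i) * e`_i + \sum_(i < size e) f (c y i) * e`_i).
      by rewrite -!cE.
    rewrite -big_split.
    by apply: eq_bigr => k _; rewrite rmorphD mulrDl.
  apply: (cu _ (fun i => r * c x i)) => //; first exact: lspanZ.
  transitivity (f r * \sum_(i < size e) f (c x i) * e`_i); first by rewrite -cE.
  rewrite mulr_sumr; apply: eq_bigr => k _.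
  by rewrite rmorphM mulrA.
have el0 x : lspan l0 x -> lspan e x.
  by apply: lspan_sub => y yl; apply: el; rewrite mem_cat yl.
have z (i : nat) : (i < size e)%N -> \sum_(u <- t) c u.2 i *: u.1 = 0.
  move=> il; apply: ginj; rewrite linear0 linear_sum.
  have : lin_on l0 (fun x => c x i).
    have [hD hZ] := clin i il.
    by split=> [x y hx hy|r x hx]; [apply: hD; apply: el0|apply: hZ; apply: el0].
  move=> /H; rewrite big_map => E; rewrite -[RHS]E.
  by apply: eq_bigr => u _; rewrite linearZ.
have b0 n : b n 0 = 0 by apply: (@addrI _ (b n 0)); rewrite -bDr !addr0.
have b0l s : b 0 s = 0 by apply: (@addrI _ (b 0 s)); rewrite -bDl !addr0.
have bsum n I (r : seq I) (F : I -> S) : b n (\sum_(i <- r) F i) = \sum_(i <- r) b n (F i).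
  by apply: (big_morph (b n)) => // x y; exact: bDr.
have bsuml s I (r : seq I) (F : I -> M) : b (\sum_(i <- r) F i) s = \sum_(i <- r) b (F i) s.
  by apply: (big_morph (b^~ s)) => // x y; exact: bDl.
transitivity (\sum_(u <- t) \sum_(i < size e) b (c u.2 i *: u.1) e`_i).
  apply: eq_big_seq => u ut.
  transitivity (b u.1 (\sum_(i < size e) f (c u.2 i) * e`_i)).
    by rewrite -cE //; apply: el; rewrite mem_cat map_f ?orbT.
  rewrite bsum; by apply: eq_bigr => i _; rewrite bZ.
rewrite exchange_big big1 // => i _.
by rewrite -bsuml z ?b0l.
Qed.

End Flatness.

(** * Evaluation of polynomials *)

Section Eval.
Variable n : nat.

(** Parametricity of evaluation: its naturality and its congruences are the cases
  where T is the graph of a morphism and a congruence modulo an ideal. *)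
Lemma mmap_rel (R S S' : nzRingType) (T : S -> S' -> Prop) (f : R -> S) (f' : R -> S') u u' :
  T 0 0 -> T 1 1 -> (forall x y x' y', T x x' -> T y y' -> T (x + y) (x' + y')) ->
  (forall x y x' y', T x x' -> T y y' -> T (x * y) (x' * y')) ->
  (forall c, T (f c) (f' c)) -> (forall i, T (u i) (u' i)) ->
  forall q : {mpoly R[n]}, T (mmap f u q) (mmap f' u' q).
Proof.
move=> T0 T1 TD TM Tf Tu q; rewrite /mmap; elim/big_ind2: _ => // [*|m _]; first exact: TD.
apply: (TM) => //; rewrite /mmap1; elim/big_ind2: _ => // [*|i _]; first exact: TM.
by elim: (m i) => [|e IH]; rewrite ?expr0 // !exprS; exact: TM.
Qed.

Variable R : comNzRingType.

Section Hev.
Variables (S : comNzRingType) (f : {rmorphism R -> S}) (u : 'I_n -> S).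

Definition hev (q : {mpoly R[n]}) : S := mmap f u q.
Lemma hev_zmod : zmod_morphism hev. Proof. exact: mmap_is_additive. Qed.
Lemma hev_monoid : monoid_morphism hev.
Proof. by have [h1 h2] := mmap_is_multiplicative u f; split. Qed.
HB.instance Definition _ := GRing.isZmodMorphism.Build _ _ hev hev_zmod.
HB.instance Definition _ := GRing.isMonoidMorphism.Build _ _ hev hev_monoid.

Lemma hevC c : hev c%:MP = f c. Proof. exact: mmapC. Qed.
Lemma hevX i : hev 'X_i = u i.
Proof. by rewrite /hev mmapX mmap1U. Qed.
End Hev.

Lemma hev_comp (S S' : comNzRingType) (g : {rmorphism S -> S'}) (f : {rmorphism R -> S})
    (f' : {rmorphism R -> S'}) u u' q :
  (forall c, g (f c) = f' c) -> (forall i, g (u i) = u' i) ->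
  g (hev f u q) = hev f' u' q.
Proof.
move=> ff uu; apply: (@mmap_rel _ _ _ (fun x y => g x = y)) => //.
- exact: rmorph0.
- exact: rmorph1.
- by move=> x y x' y' <- <-; rewrite rmorphD.
- by move=> x y x' y' <- <-; rewrite rmorphM.
Qed.

Lemma hev_meval u q : hev (idfun : {rmorphism R -> R}) u q = q.@[u].
Proof. by []. Qed.

Lemma map_mpoly_hev (S : comNzRingType) (f : {rmorphism R -> S}) (u : 'I_n -> S) q :
  (map_mpoly f q).@[u] = hev f u q.
Proof.
rewrite /map_mpoly; apply: (@mmap_rel _ _ _ (fun x y => x.@[u] = y)).
- exact: meval0.
- exact: meval1.
- by move=> x y x' y' <- <-; rewrite mevalD.
- by move=> x y x' y' <- <-; rewrite mevalM.
- by move=> c; rewrite /= mevalC.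
- by move=> i; rewrite mevalXU.
Qed.

(** J is an ideal of the subring V; the membership in V is carried along because the
  product of a congruence needs it. *)
Lemma hev_cong (S : comNzRingType) (V J : S -> Prop) (f : {rmorphism R -> S}) u u' :
  V 0 -> V 1 -> (forall x y, V x -> V y -> V (x + y)) -> (forall x y, V x -> V y -> V (x * y)) ->
  J 0 -> (forall x y, J x -> J y -> J (x + y)) -> (forall x y, V x -> J y -> J (x * y)) ->
  (forall c, V (f c)) -> (forall i, V (u i)) -> (forall i, V (u' i)) ->
  (forall i, J (u i - u' i)) ->
  forall q, [/\ V (hev f u q), V (hev f u' q) & J (hev f u q - hev f u' q)].
Proof.
move=> V0 V1 VD VM J0 JD JM Vf Vu Vu' Juu.
apply: (@mmap_rel _ _ _ (fun x y => [/\ V x, V y & J (x - y)])).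
- by rewrite subrr; split.
- by rewrite subrr; split.
- move=> x y x' y' [Vx Vx' Jx] [Vy Vy' Jy]; split; [exact: VD|exact: VD|].
  by rewrite opprD addrACA; exact: JD.
- move=> x y x' y' [Vx Vx' Jx] [Vy Vy' Jy]; split; [exact: VM|exact: VM|].
  have -> : x * y - x' * y' = x * (y - y') + y' * (x - x') by ring.
  by apply: JD; exact: JM.
- by move=> c; rewrite subrr; split.
- by move=> i; split.
Qed.

End Eval.

(** * Multigraded coordinates and affine charts *)

Section Scaling.
Variable A : ambient.
Local Notation n := (nvars A).
Implicit Types (k : fieldType).

Definition scaling (k : fieldType) (chi : degree A -> k) :=
  [/\ chi 0 = 1, forall d d', chi (d + d') = chi d * chi d' & forall d, chi d != 0].

(** Two vectors of coordinates of one point: proportional for a projective space,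
  proportional in each block for a biprojective space. Scaling by characters of the monoid
  of degrees treats both at once. *)
Definition sim (k : fieldType) (u w : 'I_n -> k) :=
  exists2 chi : degree A -> k, scaling chi & forall i, u i = chi (weight i) * w i.

Lemma sim_sym k (u w : 'I_n -> k) : sim u w -> sim w u.
Proof.
move=> [chi [c0 cD cn] E]; exists (fun d => (chi d)^-1).
  split=> [|d d'|d]; rewrite ?c0 ?invr1 ?cD ?invfM ?invr_eq0 //.
by move=> i; rewrite E mulKf.
Qed.

Lemma sim_trans k (u w z : 'I_n -> k) : sim u w -> sim w z -> sim u z.
Proof.
move=> [chi [c0 cD cn] E] [chi' [c0' cD' cn'] E'].
exists (fun d => chi d * chi' d); last by move=> i; rewrite E E' mulrA.
split=> [|d d'|d]; rewrite ?c0 ?c0' ?mulr1 ?cD ?cD' ?mulf_neq0 //; ring.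
Qed.

Lemma sim_form (L k : fieldType) (f : {rmorphism L -> k}) (u w : 'I_n -> k) : sim u w ->
  exists2 chi : degree A -> k, (forall d, chi d != 0) &
    forall d q, is_form d q -> hev f u q = chi d * hev f w q.
Proof.
move=> [chi [c0 cD cn] E]; exists chi => // d q qd.
rewrite /hev /mmap mulr_sumr; apply: eq_big_seq => m /qd md.
rewrite mulrCA; congr (_ * _); rewrite -md /mweight /mmap1.
rewrite (big_morph chi cD c0) -big_split /=; apply: eq_bigr => i _.
rewrite E exprMn; congr (_ * _).
elim: (m i) => [|e IH]; first by rewrite expr0 mulr0n c0.
by rewrite exprS mulrS cD IH.
Qed.

(** An affine chart: each coordinate is divided by another one of the same weight. It
  does not depend on the field, so that the same chart serves for an L-point and for the
  K-points that specialise to it. *)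
Record chart := Chart {
  den : 'I_n -> 'I_n;
  den_weight : forall i, weight (den i) = weight i;
  den_idem : forall i, den (den i) = den i;
  den_sim : forall (k : fieldType) (w : 'I_n -> k), (forall i, w (den i) != 0) ->
    sim (fun i => w i / w (den i)) w;
  den_pt : forall (k : fieldType) (w : 'I_n -> k), (forall i, w (den i) != 0) ->
    exists x : pts A k, sim w (coord x)
}.

Definition in_chart (c : chart) (k : fieldType) (w : 'I_n -> k) := forall i, w (den c i) != 0.

Definition charted :=
  (forall (k : fieldType) (x : pts A k), exists c, in_chart c (coord x)) /\
  (forall (k : fieldType) (x y : pts A k), sim (coord x) (coord y) -> x = y).

Definition aff (c : chart) (k : fieldType) (w : 'I_n -> k) : 'I_n -> k := fun i => w i / w (den c i).

Lemma aff_den c k (w : 'I_n -> k) i : in_chart c w -> aff c w (den c i) = 1.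
Proof. by move=> h; rewrite /aff den_idem divff. Qed.

Lemma aff_sim c k (u w : 'I_n -> k) : in_chart c w -> in_chart c u ->
  aff c u =1 aff c w -> sim u w.
Proof.
move=> hw hu E; apply: sim_trans (sim_sym (den_sim hu)) _.
apply: sim_trans (den_sim hw); exists (fun=> 1).
  by split=> // [d d'|d]; rewrite ?mulr1 ?oner_neq0.
by move=> i; rewrite mul1r; exact: E.
Qed.

Lemma sim_aff c k (u w : 'I_n -> k) : sim u w -> in_chart c w ->
  in_chart c u /\ aff c u =1 aff c w.
Proof.
move=> [chi [c0 cD cn] E] hw; split=> i.
  by rewrite E mulf_neq0 //; exact: hw.
by rewrite /aff !E den_weight -mulf_div divff ?mul1r.
Qed.

End Scaling.

(** * Charts of projective and biprojective spaces *)

Section ProjCharts.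

Lemma proj_pt_exists n (k : fieldType) (w : 'I_n.+1 -> k) : (exists i, w i != 0) ->
  exists (x : pts (proj_space n) k) (c : k), c != 0 /\ forall i, w i = c * pcoord x i.
Proof.
move=> [i0 n0].
have [i ni imin] := @arg_minnP _ i0 (fun i => w i != 0) (fun i => val i) n0.
have P : normalized (\row_j (w j / w i)).
  apply/existsP; exists i; rewrite mxE divff // eqxx /=; apply/forallP => j.
  apply/implyP => ji; rewrite mxE mulf_eq0 invr_eq0 (negbTE ni) orbF.
  by apply: contraTT ji => /imin; rewrite -leqNgt.
exists (exist (fun x : 'rV[k]_n.+1 => normalized x) _ P), (w i); split=> // j.
by rewrite /pcoord /= mxE mulrCA divff // mulr1.
Qed.

Lemma proj_pt_neq0 n (k : fieldType) (x : proj_point n k) : exists i, pcoord x i != 0.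
Proof.
case: x => x px; have /existsP[i /andP[/eqP xi _]] := px; exists i.
by rewrite /pcoord /= xi oner_neq0.
Qed.

Lemma proj_pt_inj n (k : fieldType) (x y : proj_point n k) (c : k) : c != 0 ->
  (forall i, pcoord x i = c * pcoord y i) -> x = y.
Proof.
case: x y => x px [y py] c0 E; apply/val_inj => /=.
have E' i : x ord0 i = c * y ord0 i by exact: E.
have [i /andP[/eqP xi /forallP xm]] := existsP px.
have [j /andP[/eqP yj /forallP ym]] := existsP py.
have ij : i = j.
  apply: ord_inj; case: (ltngtP i j) => // lt.
    have /implyP/(_ lt)/eqP yi := ym i; move: xi; rewrite E' yi mulr0 => /eqP.
    by rewrite eq_sym oner_eq0.
  have /implyP/(_ lt)/eqP := xm j; rewrite E' yj mulr1 => /eqP.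
  by rewrite (negbTE c0).
have c1 : c = 1 by move: xi; rewrite E' ij yj mulr1.
by apply/rowP => l; rewrite E' c1 mul1r.
Qed.

Section P.
Variable r : nat.
Local Notation A := (proj_space r).

Lemma proj_scaling (k : fieldType) (c : k) : c != 0 ->
  scaling (fun d : degree A => c ^+ (d : nat)).
Proof.
move=> c0; split=> [|d d'|d]; rewrite ?expr0 //; first exact: exprD.
by rewrite expf_neq0.
Qed.

Lemma proj_sim (k : fieldType) (u w : 'I_r.+1 -> k) c : c != 0 ->
  (forall i, u i = c * w i) -> sim (A := A) u w.
Proof.
move=> c0 E; exists (fun d : degree A => c ^+ (d : nat)); first exact: proj_scaling.
by move=> i; rewrite expr1 E.
Qed.

Lemma proj_simE (k : fieldType) (u w : 'I_r.+1 -> k) : sim (A := A) u w ->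
  exists2 c, c != 0 & forall i, u i = c * w i.
Proof. by move=> [chi [_ _ cn] E]; exists (chi 1%N). Qed.

Definition proj_chart (i0 : 'I_r.+1) : chart A.
Proof.
refine (@Chart A (fun=> i0) _ _ _ _) => //.
  move=> k w w0; apply: (@proj_sim _ _ _ (w i0)^-1); first by rewrite invr_eq0; exact: (w0 i0).
  by move=> i; rewrite mulrC.
move=> k w w0; have [|x [c [c0 E]]] := @proj_pt_exists _ _ w; first by exists i0; exact: (w0 i0).
by exists x; exact: (proj_sim c0).
Defined.

Lemma proj_charted : charted A.
Proof.
split=> k x.
  by have [i ni] := proj_pt_neq0 x; exists (proj_chart i) => j.
by move=> y /proj_simE [c c0 E]; exact: (proj_pt_inj c0).
Qed.
End P.

Section BP.
Variables r m : nat.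
Local Notation A := (biproj_space r m).

Lemma biproj_scaling (k : fieldType) (c c' : k) : c != 0 -> c' != 0 ->
  scaling (fun d : degree A => c ^+ d.1 * c' ^+ d.2).
Proof.
move=> c0 c0'; split=> [|d d'|d]; first by rewrite !expr0 mulr1.
  by rewrite !exprD mulrACA.
by rewrite mulf_neq0 ?expf_neq0.
Qed.

Lemma biproj_sim (k : fieldType) (u w : 'I_(r.+1 + m.+1) -> k) c c' : c != 0 -> c' != 0 ->
  (forall i, u (lshift _ i) = c * w (lshift _ i)) ->
  (forall i, u (rshift _ i) = c' * w (rshift _ i)) -> sim (A := A) u w.
Proof.
move=> c0 c0' E E'; exists (fun d : degree A => c ^+ d.1 * c' ^+ d.2); first exact: biproj_scaling.
move=> i /=; case: (fintype.splitP i) => j ij /=.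
  have -> : i = lshift _ j by exact/val_inj.
  by rewrite E expr1 expr0 mulr1.
have -> : i = rshift _ j by exact/val_inj.
by rewrite E' expr1 expr0 mul1r.
Qed.

Lemma biproj_simE (k : fieldType) (u w : 'I_(r.+1 + m.+1) -> k) : sim (A := A) u w ->
  exists c c', [/\ c != 0, c' != 0, forall i, u (lshift _ i) = c * w (lshift _ i) &
  forall i, u (rshift _ i) = c' * w (rshift _ i)].
Proof.
move=> [chi [_ _ cn] E]; exists (chi (1%N, 0%N)), (chi (0%N, 1%N)); split=> // i.
  by rewrite E /= (unsplitK (inl _ i)).
by rewrite E /= (unsplitK (inr _ i)).
Qed.

Lemma bicoordl (k : fieldType) (x : pts A k) i : coord x (lshift _ i) = pcoord x.1 i.
Proof. by rewrite /= (unsplitK (inl _ i)). Qed.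
Lemma bicoordr (k : fieldType) (x : pts A k) i : coord x (rshift _ i) = pcoord x.2 i.
Proof. by rewrite /= (unsplitK (inr _ i)). Qed.

Definition bden (i0 : 'I_r.+1) (j0 : 'I_m.+1) (i : 'I_(r.+1 + m.+1)) : 'I_(r.+1 + m.+1) :=
  if fintype.split i is inl _ then lshift _ i0 else rshift _ j0.

Lemma bdenl i0 j0 i : bden i0 j0 (lshift _ i) = lshift _ i0.
Proof. by rewrite /bden (unsplitK (inl _ i)). Qed.
Lemma bdenr i0 j0 i : bden i0 j0 (rshift _ i) = rshift _ j0.
Proof. by rewrite /bden (unsplitK (inr _ i)). Qed.

Definition biproj_chart (i0 : 'I_r.+1) (j0 : 'I_m.+1) : chart A.
Proof.
refine (@Chart A (bden i0 j0) _ _ _ _).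
- move=> i; rewrite /= {1}/bden; case: (fintype.split i) => j.
    by rewrite (unsplitK (inl _ i0)).
  by rewrite (unsplitK (inr _ j0)).
- move=> i; rewrite {2 3}/bden; case: (fintype.split i) => j; first by rewrite bdenl.
  by rewrite bdenr.
- move=> k w w0.
  have w1 : w (lshift _ i0) != 0 by have := w0 (lshift _ i0); rewrite bdenl.
  have w2 : w (rshift _ j0) != 0 by have := w0 (rshift _ j0); rewrite bdenr.
  apply: (@biproj_sim _ _ _ (w (lshift _ i0))^-1 (w (rshift _ j0))^-1); rewrite ?invr_eq0 //.
    by move=> i; rewrite bdenl mulrC.
  by move=> i; rewrite bdenr mulrC.
move=> k w w0.
have w1 : w (lshift _ i0) != 0 by have := w0 (lshift _ i0); rewrite bdenl.
have w2 : w (rshift _ j0) != 0 by have := w0 (rshift _ j0); rewrite bdenr.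
have [|x [c [c0 E]]] := @proj_pt_exists _ _ (fun i => w (lshift _ i)); first by exists i0.
have [|y [c' [c0' E']]] := @proj_pt_exists _ _ (fun i => w (rshift _ i)); first by exists j0.
exists (x, y); apply: (biproj_sim c0 c0') => i; first by rewrite bicoordl E.
by rewrite bicoordr E'.
Defined.

Lemma biproj_chart_in i0 j0 (k : fieldType) (w : 'I_(r.+1 + m.+1) -> k) :
  w (lshift _ i0) != 0 -> w (rshift _ j0) != 0 -> in_chart (biproj_chart i0 j0) w.
Proof. by move=> h1 h2 i; rewrite /= /bden; case: (fintype.split i). Qed.

Lemma biproj_charted : charted A.
Proof.
split=> k [x y].
  have [i ni] := proj_pt_neq0 x; have [j nj] := proj_pt_neq0 y.
  by exists (biproj_chart i j); apply: biproj_chart_in; rewrite ?bicoordl ?bicoordr.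
move=> [x' y'] /biproj_simE [c [c' [c0 c0' E E']]]; congr pair.
  by apply: (proj_pt_inj c0) => i; have := E i; rewrite !bicoordl.
by apply: (proj_pt_inj c0') => i; have := E' i; rewrite !bicoordr.
Qed.
End BP.
End ProjCharts.

(** * Stalks as rings of fractions of forms *)

Section Closed.
Variables (A : ambient) (k : fieldType).
Implicit Types (X : set (pts A k)).

Lemma open_nonzero d (q : {mpoly k[nvars A]}) : is_form d q ->
  open [set y : pts A k | ev q y != 0].
Proof.
move=> qd; exists [set q] => [_ ->|]; first by exists d.
by apply/seteqP; split=> y /=; [exists q|case=> _ ->].
Qed.

Lemma closed_zero d (q : {mpoly k[nvars A]}) : is_form d q ->
  closed [set y : pts A k | ev q y = 0].
Proof.
move=> qd; rewrite -[X in closed X]setCK; apply: open_closedC.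
rewrite (_ : ~` _ = [set y : pts A k | ev q y != 0]); first exact: (open_nonzero qd).
by apply/seteqP; split=> y /=; [move=> /eqP|move=> /eqP].
Qed.

Lemma closed_form X x : closed X -> ~ X x ->
  exists d q, [/\ is_form d q, ev q x != 0 & forall y, X y -> ev q y = 0].
Proof.
move=> /closed_openC [Q Qd E] nx.
have : [set x0 | exists2 q, Q q & ev q x0 != 0] x by rewrite -E.
move=> [q Qq qx]; have [d qd] := Qd q Qq; exists d, q; split=> // y Xy.
apply: contrapT => /eqP qy.
have : (~` X) y by rewrite E; exists q.
by apply.
Qed.

(** The zeros of a form are closed, and a nonempty open part of an irreducible set
  is dense. *)
Lemma form_dense X d q (U : set (pts A k)) : irreducible X -> is_form d q ->
  open U -> X `&` U !=set0 -> (forall y, X y -> U y -> ev q y = 0) ->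
  forall y, X y -> ev q y = 0.
Proof.
move=> [_ irr] qd oU [x [Xx Ux]] H.
have [||y Xy|h|h] := irr [set y | ev q y = 0] (~` U).
- exact: closed_zero qd.
- exact: open_closedC.
- by have [Uy|nU] := pselect (U y); [left; exact: H|right].
- by move=> y /h.
- by case: (h x Xx).
Qed.

Lemma form_prime X d d' q q' : irreducible X -> is_form d q -> is_form d' q' ->
  (forall y, X y -> ev q y * ev q' y = 0) ->
  (forall y, X y -> ev q y = 0) \/ (forall y, X y -> ev q' y = 0).
Proof.
move=> [_ irr] qd qd' H.
have [||y Xy|h|h] := irr [set y | ev q y = 0] [set y | ev q' y = 0].
- exact: closed_zero qd.
- exact: closed_zero qd'.
- by have /eqP := H y Xy; rewrite mulf_eq0 => /orP[/eqP|/eqP]; [left|right].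
- by left=> y /h.
- by right=> y /h.
Qed.

End Closed.

Section Fractions.
Variables (A : ambient) (k : fieldType) (X : set (pts A k)).
Local Notation mpol := {mpoly k[nvars A]}.

Definition nzero (Z : set (pts A k)) (h : mpol) := exists2 z, Z z & ev h z != 0.

Definition frac_on (Z : set (pts A k)) (g h : mpol) :=
  exists d, [/\ is_form d g, is_form d h & nzero Z h].

Lemma frac_on_sub (Z W : set (pts A k)) g h : Z `<=` W -> frac_on Z g h -> frac_on W g h.
Proof. by move=> ZW [d [gd hd [z Zz hz]]]; exists d; split=> //; exists z => //; exact: ZW. Qed.

Variable Z : center X.
Implicit Types (g h : mpol) (z : stalk Z).

Definition frac g h : pts A k -> k := fun y => ev g y / ev h y.

Lemma frac_regular g h : frac_on Z g h -> frac g h \in regular_near Z.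
Proof.
move=> [d [gd hd [z Zz hz]]]; apply/asboolP; exists [set y | ev h y != 0]; split.
- exact: open_nonzero hd.
- by exists z.
move=> x [Xx hx]; exists [set y | ev h y != 0], d, g, h; split=> //.
exact: open_nonzero hd.
Qed.

(** Total, so that fractions can be written down before they are known to be
  regular. *)
Definition fr g h : stalk Z :=
  if pselect (frac g h \in regular_near Z) is left p then germ (LocalFun p) else 0.

Lemma fr_germ g h : frac_on Z g h -> exists p : frac g h \in regular_near Z, fr g h = germ (LocalFun p).
Proof. by move=> /frac_regular p; rewrite /fr; case: pselect => // p'; exists p'. Qed.

Lemma germ_frE (u : local_fun Z) g h (U : set (pts A k)) : frac_on Z g h ->
  open U -> Z `&` U !=set0 -> (forall y, X y -> U y -> u y = ev g y / ev h y) -> germ u = fr g h.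
Proof.
by move=> gh oU ZU E; have [p ->] := fr_germ gh; apply/germE; exists U; split.
Qed.

Lemma stalkP z : exists g h, frac_on Z g h /\ z = fr g h.
Proof.
have /asboolP [U [oU [x [Zx Ux]] Ur]] := valP (repr z).
have [V [d [g [h [oV Vx gd hd E]]]]] := Ur x (conj (center_sub Zx) Ux).
have gh : frac_on Z g h.
  exists d; split=> //; exists x => //.
  by have [] := E x (conj (center_sub Zx) Ux) Vx.
exists g, h; split=> //; rewrite -[LHS]germK; apply: (germ_frE gh (U := U `&` V)).
- exact: openI.
- by exists x.
by move=> y Xy [Uy Vy]; have [_ ->] := E y (conj Xy Uy) Vy.
Qed.

Lemma frac_onM g h g' h' : frac_on Z g h -> frac_on Z g' h' -> frac_on Z (g * g') (h * h').
Proof.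
move=> [d [gd hd [z Zz hz]]] [d' [gd' hd' [z' Zz' hz']]].
exists (d + d'); split; [exact: Defs.formM|exact: Defs.formM|].
have [y [Zy [hy hy']]] : Z `&` ([set y | ev h y != 0] `&` [set y | ev h' y != 0]) !=set0.
  apply: irreducible_meet.
  - exact: center_irr.
  - exact: (open_nonzero hd).
  - exact: (open_nonzero hd').
  - by exists z.
  - by exists z'.
by exists y => //; rewrite /ev mevalM mulf_neq0.
Qed.

Lemma frac_onX g h g' h' : frac_on Z g h -> frac_on Z g' h' -> frac_on Z (g * h' - g' * h) (h * h').
Proof.
move=> gh gh'; have [d [_ hd hz]] := frac_onM gh gh'.
have [d1 [g1 h1 _]] := gh; have [d2 [g2 h2 _]] := gh'.
exists (d1 + d2); split=> //; last exact: Defs.formM.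
by apply: Defs.formD; [exact: Defs.formM|apply: Defs.formN; rewrite addrC; exact: Defs.formM].
Qed.

(** Germs are equal when they agree near Z; irreducibility of X spreads this to all of
  X, which reduces computations in stalks to identities between values of forms. *)
Lemma fr_eqP g h g' h' : irreducible X -> frac_on Z g h -> frac_on Z g' h' ->
  fr g h = fr g' h' <-> forall y, X y -> ev g y * ev h' y = ev g' y * ev h y.
Proof.
move=> irrX gh gh'; have [p E] := fr_germ gh; have [p' E'] := fr_germ gh'.
have [d [_ hhd hhz]] := frac_onM gh gh'; have [d2 [qd _ _]] := frac_onX gh gh'.
rewrite E E' germE; split=> [[U [oU [z [Zz Uz]] H]] y Xy|H]; last first.
  exists [set y | ev (h * h') y != 0]; split.
  - exact: open_nonzero hhd.
  - by case: hhz => z Zz hz; exists z.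
  move=> y Xy; rewrite /= /ev mevalM mulf_eq0 negb_or => /andP[hy hy'].
  by apply/eqP; rewrite /frac eqr_div //; apply/eqP/H.
suff : ev (g * h' - g' * h) y = 0.
  by rewrite /ev mevalB !mevalM => /eqP; rewrite subr_eq0 => /eqP.
have ohh := open_nonzero hhd.
apply: (form_dense (U := U `&` [set y | ev (h * h') y != 0]) irrX qd) => //.
- exact: openI.
- have [y' [Zy' hy']] : Z `&` (U `&` [set y | ev (h * h') y != 0]) !=set0.
    apply: irreducible_meet => //; first exact: center_irr.
      by exists z.
    by case: hhz => z' Zz' hz'; exists z'.
  by exists y'; split=> //; exact: (center_sub Zy').
move=> x Xx [Ux]; rewrite /= /ev mevalM mulf_eq0 negb_or => /andP[hy hy'].
have := H x Xx Ux; rewrite /= /frac => /eqP; rewrite eqr_div // => /eqP e.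
by rewrite mevalB !mevalM; apply/eqP; rewrite subr_eq0; apply/eqP.
Qed.

Lemma frB g h g' h' : frac_on Z g h -> frac_on Z g' h' ->
  fr g h - fr g' h' = fr (g * h' - g' * h) (h * h').
Proof.
move=> gh gh'; have [p ->] := fr_germ gh; have [p' ->] := fr_germ gh'.
have [d [_ hhd [z Zz hz]]] := frac_onM gh gh'.
have -> : germ (LocalFun p) - germ (LocalFun p') = germ (LocalFun p - LocalFun p').
  by rewrite /germ rmorphB.
apply: (germ_frE (frac_onX gh gh') (U := [set y | ev (h * h') y != 0])).
- exact: open_nonzero hhd.
- by exists z.
move=> y Xy; rewrite /= /ev mevalM mulf_eq0 negb_or => /andP[hy hy'].
change (ev g y / ev h y - ev g' y / ev h' y = (g * h' - g' * h).@[coord y] / ((h.@[coord y]) * (h'.@[coord y]))).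
by rewrite mevalB !mevalM -mulNr addf_div // mulNr.
Qed.

Lemma frM g h g' h' : frac_on Z g h -> frac_on Z g' h' ->
  fr g h * fr g' h' = fr (g * g') (h * h').
Proof.
move=> gh gh'; have [p ->] := fr_germ gh; have [p' ->] := fr_germ gh'.
have -> : germ (LocalFun p) * germ (LocalFun p') = germ (LocalFun p * LocalFun p').
  by rewrite /germ rmorphM.
apply: (germ_frE (frac_onM gh gh') (U := setT)); first exact: openT.
- by have [[z Zz] _] := center_irr Z; exists z.
move=> y Xy _; rewrite /= /ev !mevalM.
change (ev g y / ev h y * (ev g' y / ev h' y) = (ev g y * ev g' y) / (ev h y * ev h' y)).
by rewrite mulf_div.
Qed.

Lemma cst_regular (c : k) : (fun=> c) \in regular_near Z.
Proof.
apply/asboolP; exists setT; split; first exact: openT.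
  by have [[x Zx] _] := center_irr Z; exists x.
by move=> x _; exact: regular_at_cst.
Qed.

Definition cst (c : k) : stalk Z := germ (LocalFun (cst_regular c)).

Lemma cst_zmod : zmod_morphism cst.
Proof.
move=> c c'; rewrite /cst -[RHS](_ : germ (LocalFun (cst_regular c) - LocalFun (cst_regular c')) = _).
  by congr germ; apply/val_inj.
by rewrite /germ rmorphB.
Qed.

Lemma cst_monoid : monoid_morphism cst.
Proof.
split.
  rewrite -[RHS](rmorph1 \pi_(stalk Z)) /cst /germ; congr (\pi_(stalk Z)); exact/val_inj.
move=> c c'; rewrite /cst -[RHS](_ : germ (LocalFun (cst_regular c) * LocalFun (cst_regular c')) = _).
  by congr germ; apply/val_inj.
by rewrite /germ rmorphM.
Qed.

HB.instance Definition _ := GRing.isZmodMorphism.Build k (stalk Z) cst cst_zmod.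
HB.instance Definition _ := GRing.isMonoidMorphism.Build k (stalk Z) cst cst_monoid.

Lemma frac_on1 (c : k) : frac_on Z c%:MP 1.
Proof.
exists 0; split; [exact: Defs.formC|exact: Defs.formC|].
by have [[x Zx] _] := center_irr Z; exists x => //; rewrite /ev meval1 oner_neq0.
Qed.

Lemma cstE c : cst c = fr c%:MP 1.
Proof.
apply: (germ_frE (frac_on1 c) (U := setT)); first exact: openT.
- by have [[z Zz] _] := center_irr Z; exists z.
by move=> y _ _; rewrite /ev mevalC meval1 divr1.
Qed.

Section Lift.
Variables (B : comNzRingType) (Phi : mpol -> mpol -> B).
Hypothesis Phi_eq : forall g h g' h', frac_on Z g h -> frac_on Z g' h' ->
  fr g h = fr g' h' -> Phi g h = Phi g' h'.
Hypothesis PhiB : forall g h g' h', frac_on Z g h -> frac_on Z g' h' ->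
  Phi (g * h' - g' * h) (h * h') = Phi g h - Phi g' h'.
Hypothesis PhiM : forall g h g' h', frac_on Z g h -> frac_on Z g' h' ->
  Phi (g * g') (h * h') = Phi g h * Phi g' h'.
Hypothesis Phi1 : Phi 1 1 = 1.

Lemma numden_ex z : exists gh : mpol * mpol, frac_on Z gh.1 gh.2 /\ z = fr gh.1 gh.2.
Proof. by have [g [h [gh E]]] := stalkP z; exists (g, h). Qed.

Definition lift z : B := let gh := sval (cid (numden_ex z)) in Phi gh.1 gh.2.

Lemma lift_fr g h : frac_on Z g h -> lift (fr g h) = Phi g h.
Proof.
move=> gh; rewrite /lift; case: cid => -[g' h'] /= [gh' E].
exact: Phi_eq.
Qed.

Lemma lift_zmod : zmod_morphism lift.
Proof.
move=> z z'; have [g [h [gh ->]]] := stalkP z; have [g' [h' [gh' ->]]] := stalkP z'.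
by rewrite frB // !lift_fr //; [exact: PhiB|exact: frac_onX].
Qed.

Lemma lift_monoid : monoid_morphism lift.
Proof.
split.
  have -> : 1 = fr 1%:MP 1 by rewrite -cstE rmorph1.
  by rewrite lift_fr; [rewrite mpolyC1|exact: frac_on1].
move=> z z'; have [g [h [gh ->]]] := stalkP z; have [g' [h' [gh' ->]]] := stalkP z'.
by rewrite frM // !lift_fr //; [exact: PhiM|exact: frac_onM].
Qed.

(** All germs are fractions of forms, so a map on fractions that respects equality,
  differences and products defines a ring morphism out of the stalk. *)
Lemma lift_exists : exists f : {rmorphism stalk Z -> B}, forall g h, frac_on Z g h -> f (fr g h) = Phi g h.
Proof.
pose za := GRing.isZmodMorphism.Build (stalk Z) B lift lift_zmod.
pose ma := GRing.isMonoidMorphism.Build (stalk Z) B lift lift_monoid.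
pose f : {rmorphism stalk Z -> B} := HB.pack lift za ma.
by exists f; exact: lift_fr.
Qed.

End Lift.

End Fractions.
Arguments fr {A k X} Z g h.
Arguments cst {A k X} Z c.

Section Restriction.
Variables (A : ambient) (k : fieldType) (X : set (pts A k)) (Z W : center X).
Hypothesis irrX : irreducible X.
Hypothesis ZW : Z `<=` W.

Lemma res_ex : exists f : {rmorphism stalk Z -> stalk W},
  forall g h, frac_on Z g h -> f (fr Z g h) = fr W g h.
Proof.
have s := frac_on_sub ZW.
apply: (@lift_exists _ _ _ _ _ (fr W)).
- move=> g h g' h' gh gh' /(fr_eqP irrX gh gh') H.
  by apply/(fr_eqP irrX (s _ _ gh) (s _ _ gh')).
- by move=> g h g' h' /s gh /s gh'; rewrite frB.
- by move=> g h g' h' /s gh /s gh'; rewrite frM.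
by rewrite -mpolyC1 -cstE rmorph1.
Qed.

(** Localisation; for W the whole of X it embeds local rings in the function field. *)
Definition res : {rmorphism stalk Z -> stalk W} := sval (cid res_ex).

Lemma res_fr g h : frac_on Z g h -> res (fr Z g h) = fr W g h.
Proof. exact: (svalP (cid res_ex)). Qed.

Lemma res_inj : injective res.
Proof.
move=> z z'; have [g [h [gh ->]]] := stalkP z; have [g' [h' [gh' ->]]] := stalkP z'.
rewrite !res_fr // => /(fr_eqP irrX (frac_on_sub ZW gh) (frac_on_sub ZW gh')) H.
exact/(fr_eqP irrX gh gh').
Qed.

Lemma res_cst c : res (cst Z c) = cst W c.
Proof. by rewrite !cstE res_fr //; exact: frac_on1. Qed.

End Restriction.

Section Evaluation.
Variables (A : ambient) (k K : fieldType) (iota : {rmorphism k -> K}) (X : set (pts A k)).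
Variables (Z : center X) (x' : pts A K).
Hypothesis irrX : irreducible X.
Hypothesis Xx' : Kpoints iota X x'.
Hypothesis genx' : forall d h, is_form d h -> nzero Z h -> hev iota (coord x') h != 0.

Lemma Kpoints_hev d q : is_form d q -> (forall y, X y -> ev q y = 0) -> hev iota (coord x') q = 0.
Proof. by move=> qd /(Xx' qd); rewrite /ev map_mpoly_hev. Qed.

Lemma evalZ_ex : exists f : {rmorphism stalk Z -> K},
  forall g h, frac_on Z g h -> f (fr Z g h) = hev iota (coord x') g / hev iota (coord x') h.
Proof.
apply: (@lift_exists _ _ _ _ _ (fun g h => hev iota (coord x') g / hev iota (coord x') h)).
- move=> g h g' h' gh gh' E.
  have [d [gd hd hz]] := gh; have [d' [gd' hd' hz']] := gh'.
  have [d2 [qd _ _]] := frac_onX gh gh'.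
  apply/eqP; rewrite eqr_div; try by [exact: (genx' hd)|exact: (genx' hd')].
  rewrite -subr_eq0 -!rmorphM -rmorphB; apply/eqP/(Kpoints_hev qd) => y Xy.
  by rewrite /ev mevalB !mevalM; apply/eqP; rewrite subr_eq0; apply/eqP; exact: (iffLR (fr_eqP irrX gh gh') E).
- move=> g h g' h' [d [gd hd hz]] [d' [gd' hd' hz']].
  rewrite rmorphB !rmorphM /= -[in RHS]mulNr addf_div ?mulNr //; [exact: (genx' hd)|exact: (genx' hd')].
- move=> g h g' h' _ _; by rewrite !rmorphM mulf_div.
by rewrite !rmorph1 divr1.
Qed.

(** For Z a point to which x' specialises it is a homomorphism of local rings, and for Z
  the whole of X and x' generic it embeds the function field in K. *)
Definition evalZ : {rmorphism stalk Z -> K} := sval (cid evalZ_ex).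

Lemma evalZ_fr g h : frac_on Z g h -> evalZ (fr Z g h) = hev iota (coord x') g / hev iota (coord x') h.
Proof. exact: (svalP (cid evalZ_ex)). Qed.

Lemma evalZ_cst c : evalZ (cst Z c) = iota c.
Proof. by rewrite cstE evalZ_fr; [rewrite hevC rmorph1 divr1|exact: frac_on1]. Qed.

End Evaluation.

(** * Affine coordinates as germs *)

Section Coordinates.
Variables (A : ambient) (k : fieldType) (X : set (pts A k)) (Z : center X) (c : chart A).
Hypothesis chZ : exists2 z, center_set Z z & in_chart c (coord z).

Definition zeta (i : 'I_(nvars A)) : stalk Z := fr Z 'X_i 'X_(den c i).

Lemma zeta_frac i : frac_on Z 'X_i 'X_(den c i).
Proof.
exists (weight i); split; first exact: Defs.formX.
  by rewrite -(den_weight c i); exact: Defs.formX.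
by have [z Zz zc] := chZ; exists z => //; rewrite /ev mevalXU; exact: zc.
Qed.

Lemma chart_open : open [set y : pts A k | in_chart c (coord y)].
Proof.
have qd : is_form (\sum_i weight (den c i)) (\prod_i 'X_(den c i) : {mpoly k[nvars A]}).
  by apply: Defs.form_prod => i; exact: Defs.formX.
rewrite (_ : [set y | _] = [set y | ev (\prod_i 'X_(den c i)) y != 0]); first exact: (open_nonzero qd).
apply/seteqP; split=> y /=; rewrite /ev (big_morph _ (mevalM (coord y)) (meval1 (coord y))).
  by move=> h; apply/prodf_neq0 => i _; rewrite mevalXU; exact: h.
by move=> /prodf_neq0 h i; have := h i isT; rewrite mevalXU.
Qed.

(** Being the germ of a given function is stable under the ring operations. *)
Lemma hev_zeta q : exists p : (fun y : pts A k => q.@[aff c (coord y)]) \in regular_near Z,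
  hev (cst Z) zeta q = germ (LocalFun p).
Proof.
pose T (z : stalk Z) (f : pts A k -> k) := exists p : f \in regular_near Z, z = germ (LocalFun p).
have TM z z' f f' : T z f -> T z' f' -> T (z * z') (fun y => f y * f' y).
  move=> [p ->] [p' ->].
  have p2 : f * f' \in regular_near Z by exact: rpredM.
  exists p2; have -> : germ (LocalFun p) * germ (LocalFun p') = germ (LocalFun p * LocalFun p').
    by rewrite /germ rmorphM.
  by congr germ; apply/val_inj.
have TD z z' f f' : T z f -> T z' f' -> T (z + z') (fun y => f y + f' y).
  move=> [p ->] [p' ->].
  have p2 : f + f' \in regular_near Z by exact: rpredD.
  exists p2; have -> : germ (LocalFun p) + germ (LocalFun p') = germ (LocalFun p + LocalFun p').
    by rewrite /germ rmorphD.
  by congr germ; apply/val_inj.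
have Tc e : T (cst Z e) (fun=> e) by exists (cst_regular Z e).
have T0 : T 0 (fun=> 0) by rewrite -(rmorph0 (cst Z)); exact: Tc.
have T1 : T 1 (fun=> 1) by rewrite -(rmorph1 (cst Z)); exact: Tc.
have Tz i : T (zeta i) (fun y : pts A k => aff c (coord y) i).
  have [p E] := fr_germ (zeta_frac i).
  have fE : (fun y : pts A k => aff c (coord y) i) = frac 'X_i 'X_(den c i).
    by apply: funext => y; rewrite /frac /ev !mevalXU.
  by rewrite fE; exists p.
have Text z f f' : f =1 f' -> T z f -> T z f' by move=> /funext ->.
rewrite -/(T _ _) /hev /meval /mmap.
have sumT I (s : seq I) (F : I -> stalk Z) (G : I -> pts A k -> k) :
    (forall i, T (F i) (G i)) -> T (\sum_(i <- s) F i) (fun y => \sum_(i <- s) G i y).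
  move=> h; elim: s => [|i s IH].
    by rewrite big_nil; apply: Text T0 => y; rewrite big_nil.
  by rewrite big_cons; apply: Text (TD _ _ _ _ (h i) IH) => y; rewrite big_cons.
have prodT I (s : seq I) (F : I -> stalk Z) (G : I -> pts A k -> k) :
    (forall i, T (F i) (G i)) -> T (\prod_(i <- s) F i) (fun y => \prod_(i <- s) G i y).
  move=> h; elim: s => [|i s IH].
    by rewrite big_nil; apply: Text T1 => y; rewrite big_nil.
  by rewrite big_cons; apply: Text (TM _ _ _ _ (h i) IH) => y; rewrite big_cons.
apply: sumT => m; apply: (TM _ _ (fun=> _) _ (Tc _)); apply: prodT => i.
elim: (m i) => [|e IH]; first by rewrite expr0; apply: Text T1 => y; rewrite expr0.
by rewrite exprS; apply: Text (TM _ _ _ _ (Tz i) IH) => y; rewrite exprS.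
Qed.

(** On the chart a form and its dehomogenisation differ by a factor that depends only
  on the degree, hence is the same for g and for h. *)
Lemma fr_zeta g h : frac_on Z g h -> fr Z g h * hev (cst Z) zeta h = hev (cst Z) zeta g.
Proof.
move=> gh; have [d [gd hd [z Zz hz]]] := gh; have [p ->] := fr_germ gh.
have [pg ->] := hev_zeta g; have [ph ->] := hev_zeta h.
have -> : germ (LocalFun p) * germ (LocalFun ph) = germ (LocalFun p * LocalFun ph).
  by rewrite /germ rmorphM.
apply/germE; exists ([set y | in_chart c (coord y)] `&` [set y | ev h y != 0]); split.
- by apply: openI; [exact: chart_open|exact: (open_nonzero hd)].
- have [y Zy yc] := chZ; apply: irreducible_meet; first exact: center_irr.
  + exact: chart_open.
  + exact: (open_nonzero hd).
  + by exists y.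
  + by exists z.
move=> y Xy [yc hy]; change (ev g y / ev h y * h.@[aff c (coord y)] = g.@[aff c (coord y)]).
have [chi chn chiE] := sim_form idfun (den_sim yc).
have gE := chiE d g gd; have hE := chiE d h hd; rewrite !hev_meval in gE hE.
by rewrite /aff gE hE mulrCA divfK.
Qed.

End Coordinates.
Arguments zeta {A k X} Z c i.

Section ZetaMaps.
Variables (A : ambient) (k : fieldType) (X : set (pts A k)) (c : chart A).
Hypothesis irrX : irreducible X.

Lemma res_zeta (Z W : center X) (ZW : Z `<=` W) i : (exists2 z, center_set Z z & in_chart c (coord z)) ->
  res irrX ZW (zeta Z c i) = zeta W c i.
Proof. by move=> chZ; rewrite res_fr //; exact: zeta_frac. Qed.

Lemma evalZ_zeta (K : fieldType) (iota : {rmorphism k -> K}) (Z : center X) x'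
  (Xx' : Kpoints iota X x') gen i : (exists2 z, center_set Z z & in_chart c (coord z)) ->
  evalZ (iota := iota) irrX Xx' gen (zeta Z c i) = aff c (coord x') i.
Proof. by move=> chZ; rewrite evalZ_fr; [rewrite !hevX|exact: zeta_frac]. Qed.

End ZetaMaps.

(** * Values of germs at a point *)

Section LocalRings.
Variables (A : ambient) (k : fieldType) (X : set (pts A k)).
Hypothesis irrX : irreducible X.
Variables (x : pts A k) (Xx : X x).
Local Notation O := (local_ring Xx).
Local Notation Z := (center_point Xx).

Lemma point_Kpoints : Kpoints (idfun : {rmorphism k -> k}) X x.
Proof. by move=> d q qd H; rewrite /ev map_mpoly_hev hev_meval; exact: H. Qed.

Lemma point_gen d h : is_form d h -> nzero Z h -> hev idfun (coord x) h != 0.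
Proof. by move=> _ [_ -> hz]; rewrite hev_meval. Qed.

Definition evx : {rmorphism stalk Z -> k} := evalZ irrX point_Kpoints point_gen.

Lemma evx_fr g h : frac_on Z g h -> evx (fr Z g h) = ev g x / ev h x.
Proof. by move=> gh; rewrite /evx evalZ_fr. Qed.

Lemma evx_cst e : evx (cst Z e) = e.
Proof. by rewrite /evx evalZ_cst. Qed.

(** A fraction whose numerator does not vanish at x can be inverted. *)
Lemma nonunitP (z : O) : nonunits z <-> evx z = 0.
Proof.
split=> [nu|z0 [y yz]]; last first.
  have /eqP := congr1 evx (yz : (y : stalk Z) * (z : stalk Z) = 1).
  by rewrite rmorphM z0 mulr0 rmorph1 eq_sym oner_eq0.
have [g [h [gh E]]] := stalkP (z : stalk Z); rewrite E evx_fr //.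
apply: contrapT => /eqP n; case: nu.
have [d [gd hd [_ -> hx]]] := gh.
have gx : ev g x != 0 by apply: contra_neq n => ->; rewrite mul0r.
have hg : frac_on Z h g by exists d; split=> //; exists x.
exists (fr Z h g); rewrite E; transitivity (fr Z h g * fr Z g h) => //.
have -> : (1 : O) = fr Z 1%:MP 1 by rewrite -cstE rmorph1.
rewrite frM //; apply/(fr_eqP irrX) => //.
- exact: frac_onM.
- exact: frac_on1.
by move=> y _; rewrite mpolyC1 /ev !meval1 !mevalM mulr1 mul1r mulrC.
Qed.

Lemma unitP (z : stalk Z) : evx z != 0 -> exists y, y * z = 1.
Proof.
by move=> n; apply: contrapT => h; move/eqP: n; apply; exact/(nonunitP z).
Qed.

Variable c : chart A.
Hypothesis xc : in_chart c (coord x).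

Lemma point_chart : exists2 z, center_set Z z & in_chart c (coord z).
Proof. by exists x. Qed.

Lemma evx_zeta i : evx (zeta Z c i) = aff c (coord x) i.
Proof. by rewrite /evx evalZ_zeta //; exact: point_chart. Qed.

(** The dehomogenisation of a form is congruent to its value at x modulo the differences
  of coordinates, and the denominator of a fraction is a unit. *)
Lemma max_gen (J : stalk Z -> Prop) : J 0 -> (forall y z, J y -> J z -> J (y + z)) ->
  (forall y z, J z -> J (y * z)) -> (forall i, J (zeta Z c i - cst Z (aff c (coord x) i))) ->
  forall z, evx z = 0 -> J z.
Proof.
move=> J0 JD JM Jz z; have [g [h [gh ->]]] := stalkP z.
have [d [gd hd [_ -> hx]]] := gh; rewrite evx_fr // => /eqP.
rewrite mulf_eq0 invr_eq0 (negbTE hx) orbF => /eqP gx.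
have [chi chn chiE] := sim_form idfun (den_sim xc).
have gE := chiE d g gd; have hE := chiE d h hd; rewrite !hev_meval in gE hE.
have evE q : evx (hev (cst Z) (zeta Z c) q) = q.@[aff c (coord x)].
  by rewrite (hev_comp (f' := idfun) (u' := aff c (coord x))) ?hev_meval //;
     [exact: evx_cst|exact: evx_zeta].
have [y yE] : exists y, y * hev (cst Z) (zeta Z c) h = 1.
  by apply: unitP; rewrite evE /aff hE mulf_neq0.
have -> : fr Z g h = y * hev (cst Z) (zeta Z c) g.
  by rewrite -(fr_zeta point_chart gh) mulrCA yE mulr1.
apply: (JM).
have [_ _] := hev_cong (V := fun=> True) (f := cst Z) (u' := cst Z \o aff c (coord x)) I I
  (fun _ _ _ _ => I) (fun _ _ _ _ => I) J0 JD (fun y z _ => @JM y z) (fun=> I) (fun=> I) (fun=> I) Jz g.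
have <- : cst Z (g.@[aff c (coord x)]) = hev (cst Z) (cst Z \o aff c (coord x)) g.
  by rewrite -hev_meval; exact: hev_comp.
by rewrite /aff gE -/(ev g x) gx mulr0 rmorph0 subr0.
Qed.

Lemma residue (z : stalk Z) : evx (z - cst Z (evx z)) = 0.
Proof. by rewrite rmorphB /= evx_cst subrr. Qed.

End LocalRings.

(** * Specialisation of points over a valued field *)

Section Specialisation.
Variables (A : ambient) (k K : fieldType) (iota : {rmorphism k -> K}) (v : valuation K).
Hypothesis K_model : nonstandard_model iota v.
Local Notation V := (valuation_ring v).
Local Notation m := (valuation_ideal v).

Lemma iota_vring e : V (iota e).
Proof.
have [_ triv _] := K_model; have [->|n] := eqVneq e 0; first by rewrite rmorph0; left.
by right; rewrite triv.
Qed.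

Lemma iota_videal e : m (iota e) -> e = 0.
Proof.
have [_ triv _] := K_model; move=> h; apply: contrapT => /eqP n.
by move: h; rewrite videalP ?fmorph_eq0 // triv // ltxx.
Qed.

Lemma residue_unit z e : e != 0 -> m (z - iota e) -> z != 0 /\ ~ m z.
Proof.
move=> e0 h; have nm : ~ m z.
  move=> mz; move/eqP: e0; apply; apply: iota_videal.
  by rewrite -[iota e](subKr z); apply: videalB.
by split=> //; apply/eqP => z0; apply: nm; left.
Qed.

(** The relation of the infinitesimal neighbourhoods, with rescaling by the grading so
  that it makes sense for biprojective points as well. *)
Definition spec (x : pts A k) (x' : pts A K) :=
  exists2 w, sim w (coord x') & forall i, m (w i - iota (coord x i)).

Lemma spec_cong w (u : 'I_(nvars A) -> k) (q : {mpoly k[nvars A]}) : (forall i, m (w i - iota (u i))) ->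
  V (hev iota w q) /\ m (hev iota w q - iota (q.@[u])).
Proof.
move=> wu.
have Vu i : V (iota (u i)) by exact: iota_vring.
have Vw i : V (w i) by rewrite -[w i](subrK (iota (u i))); apply: vringD => //; exact: videalW.
have [h1 _ h2] := hev_cong (f := iota) (u := w) (u' := iota \o u) (vring0 v) (vring1 v) (@vringD _ v)
  (@vringM _ v) (videal0 v) (@videalD _ v) (@videalMl _ v) iota_vring Vw Vu wu q.
split=> //; rewrite (_ : iota _ = hev iota (iota \o u) q) //.
by rewrite -hev_meval; exact: hev_comp.
Qed.

Variables (X : set (pts A k)) (x : pts A k) (Xx : X x) (x' : pts A K).
Hypothesis irrX : irreducible X.
Hypothesis xx' : spec x x'.
Hypothesis Xx' : Kpoints iota X x'.
Local Notation Z := (center_point Xx).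

(** The value of h at suitably scaled coordinates of x' reduces to its nonzero value
  at x. *)
Lemma spec_gen d h : is_form d h -> nzero Z h -> hev iota (coord x') h != 0.
Proof.
move=> hd [_ -> hx]; have [w ws wx] := xx'.
have [_ /(residue_unit hx) [n _]] := spec_cong h wx.
have [chi chn /(_ d h hd) E] := sim_form iota ws.
by apply: contra_neq n; rewrite E => ->; rewrite mulr0.
Qed.

Definition evs : {rmorphism stalk Z -> K} := evalZ irrX Xx' spec_gen.

Lemma evs_cst e : evs (cst Z e) = iota e.
Proof. by rewrite /evs evalZ_cst. Qed.

(** Numerator and denominator reduce to their values at x, and the denominator is a
  unit of the valuation ring. *)
Lemma evs_spec z : V (evs z) /\ m (evs z - iota (evx irrX Xx z)).
Proof.
have [g [h [gh ->]]] := stalkP z; have [d [gd hd hz]] := gh.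
have n := spec_gen hd hz; case: hz => _ -> hx.
rewrite /evs evalZ_fr // evx_fr //; have [w ws wx] := xx'.
have [chi chn chiE] := sim_form iota ws.
have [Vg mg] := spec_cong g wx; have [Vh mh] := spec_cong h wx.
have [hw nh] := residue_unit hx mh.
have -> : hev iota (coord x') g / hev iota (coord x') h = hev iota w g / hev iota w h.
  by rewrite (chiE d g gd) (chiE d h hd) -mulf_div divff // mul1r.
have VV := vringV nh.
have VG : V (iota (ev g x)) by exact: iota_vring.
split; first exact: vringM.
rewrite fmorph_div /=.
have hx' : iota (ev h x) != 0 by rewrite fmorph_eq0.
have -> : hev iota w g / hev iota w h - iota (ev g x) / iota (ev h x) =
  ((hev iota w g - iota (ev g x)) * iota (ev h x) - iota (ev g x) * (hev iota w h - iota (ev h x)))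
    * ((hev iota w h)^-1 * iota (ev h x)^-1).
  by rewrite fmorphV; field; rewrite hw hx'.
apply: videalM; last by apply: vringM => //; exact: iota_vring.
apply: videalB; first by apply: videalM => //; exact: iota_vring.
exact: videalMl.
Qed.

End Specialisation.

Definition dim_le1 (T : topologicalType) (X : set T) := forall n Z,
  chain [set Z : set T | [/\ closed Z, irreducible Z & Z `<=` X]] n Z -> (n <= 1)%N.

(** * Algebraic dependence of functions on a curve *)

Section Transcendental.
Variables (L : closedFieldType) (K : fieldType) (iota : {rmorphism L -> K}).

Lemma algebraic_in (y : K) (p : {poly L}) : p != 0 -> (map_poly iota p).[y] = 0 -> exists c, y = iota c.
Proof.
move=> p0; have [rs ->] := closed_field_poly_normal p.
rewrite map_polyZ hornerZ => /eqP; rewrite mulf_eq0 fmorph_eq0 lead_coef_eq0 (negbTE p0) /=.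
rewrite rmorph_prod horner_prod prodf_seq_eq0 => /hasP[c _ /=].
rewrite rmorphB /= map_polyX map_polyC !hornerE subr_eq0 => /eqP ->.
by exists c.
Qed.

End Transcendental.

Section ZetaForms.
Variables (A : ambient) (k : fieldType) (X : set (pts A k)) (Z : center X) (c : chart A).
Hypothesis irrX : irreducible X.
Hypothesis chZ : exists2 z, center_set Z z & in_chart c (coord z).

Lemma hev_zeta_eq0 d q : is_form d q -> (forall y, X y -> ev q y = 0) -> hev (cst Z) (zeta Z c) q = 0.
Proof.
move=> qd q0; have [p ->] := hev_zeta chZ q; rewrite -[RHS](rmorph0 (cst Z)).
apply/germE; exists [set y | in_chart c (coord y)]; split.
- exact: chart_open.
- by have [z Zz zc] := chZ; exists z.
move=> y Xy yc /=; have [chi chn chiE] := sim_form idfun (den_sim yc).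
by have := chiE d q qd; rewrite !hev_meval /aff => ->; rewrite -/(ev q y) q0 // mulr0.
Qed.

End ZetaForms.

(** Tested at a point of the chart where h does not vanish. *)
Lemma hev_zeta_neq0 (A : ambient) (k : fieldType) (X : set (pts A k)) (irrX : irreducible X) (c : chart A)
  d h : (exists2 z, X z & in_chart c (coord z)) -> is_form d h -> nzero X h ->
  hev (cst (center_self irrX)) (zeta (center_self irrX) c) h != 0.
Proof.
move=> [z Xz zc] hd [y Xy hy].
have [x [Xx [xc hx]]] : X `&` ([set y | in_chart c (coord y)] `&` [set y | ev h y != 0]) !=set0.
  apply: irreducible_meet => //; [exact: chart_open|exact: (open_nonzero hd)|by exists z|by exists y].
have sub : center_point Xx `<=` center_self irrX by move=> _ ->.
have -> : hev (cst (center_self irrX)) (zeta (center_self irrX) c) h =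
    res irrX sub (hev (cst (center_point Xx)) (zeta (center_point Xx) c) h).
  by rewrite (hev_comp (f' := cst _) (u' := zeta (center_self irrX) c)) // => i;
    [exact: res_cst|apply: res_zeta; exists x].
apply/eqP; rewrite -[RHS](rmorph0 (res irrX sub)) => /res_inj E.
have := congr1 (evx irrX Xx) E; rewrite rmorph0.
rewrite (hev_comp (f' := idfun) (u' := aff c (coord x))); first last.
- by move=> i; exact: evx_zeta.
- by move=> e; exact: evx_cst.
have [chi chn chiE] := sim_form idfun (den_sim xc).
by rewrite hev_meval; have := chiE d h hd; rewrite !hev_meval /aff => -> /eqP; rewrite (negbTE (mulf_neq0 _ _)).
Qed.

Section Locus.
Variables (A : ambient) (L : closedFieldType).
Hypothesis chA : charted A.

Section OnePoint.
Variables (K : fieldType) (iota : {rmorphism L -> K}) (x' : pts A K).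

(** The Zariski closure over L of the K-point x'. *)
Definition locus : set (pts A L) :=
  [set x | forall d p, is_form d p -> hev iota (coord x') p = 0 -> ev p x = 0].

(** A Nullstellensatz: by [ext_ring], the ring generated over L by the affine
  coordinates of x' has a homomorphism to L that does not kill q, and this is a point of the
  locus. *)
Lemma locus_nonzero d q : is_form d q -> hev iota (coord x') q != 0 ->
  exists2 x, locus x & ev q x != 0.
Proof.
move=> qd q0; have [c xc] := chA.1 _ x'.
pose z := aff c (coord x').
have [chi chn chiE] := sim_form iota (den_sim xc).
have [B [i [jB [ji surj ext]]]] := ext_ring L [seq z l | l <- enum 'I_(nvars A)] iota.
have /choice[b bE] : forall l, exists b, jB b = z l.
  by move=> l; apply: surj; apply: map_f; rewrite mem_enum.
have hB p : jB (hev i b p) = hev iota z p by exact: hev_comp.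
have [a [na H]] : exists a, iota a != 0 /\ forall phi : {rmorphism L -> L}, compat iota phi -> phi a != 0 ->
    exists phiB : {rmorphism B -> L}, [/\ forall x, phiB (i x) = phi x, compat jB phiB & phiB (hev i b q) != 0].
  by apply: ext; rewrite hB (chiE d q qd) mulf_neq0.
have [||phiB [phiBi phiBc nq]] := H idfun.
- by move=> e /eqP; rewrite fmorph_eq0 => /eqP.
- by rewrite -(fmorph_eq0 iota).
pose g l := phiB (b l).
have gE p : phiB (hev i b p) = p.@[g].
  by rewrite -hev_meval; exact: hev_comp.
have gc : in_chart c g.
  move=> l; have /phiBc : jB (b (den c l) - 1) = 0.
    by rewrite rmorphB rmorph1 /= bE /z aff_den // subrr.
  rewrite rmorphB rmorph1 => /eqP; rewrite subr_eq0 => /eqP E.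
  by rewrite /g E oner_neq0.
have [x gx] := den_pt gc.
have [psi psin psiE] := sim_form idfun gx.
exists x.
  move=> e p pe p0; have := psiE e p pe; rewrite !hev_meval -gE phiBc; last first.
    by rewrite hB (chiE e p pe) p0 mulr0.
  by move/esym/eqP; rewrite mulf_eq0 (negbTE (psin e)) => /eqP.
move: nq; rewrite gE; have := psiE d q qd; rewrite !hev_meval => ->.
by rewrite mulf_eq0 negb_or => /andP[].
Qed.

Lemma locus_closed : closed locus.
Proof.
rewrite -[locus]setCK; apply: open_closedC.
exists [set p | exists2 d, is_form d p & hev iota (coord x') p = 0] => [p [d pd _]|]; first by exists d.
apply/seteqP; split=> x /=.
  move=> nl; apply: contrapT => h; apply: nl => d p pd p0.
  by apply: contrapT => /eqP n; apply: h; exists p => //; exists d.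
by move=> [p [d pd p0] n] l; move/eqP: n; apply; exact: l pd p0.
Qed.

(** A product of forms vanishes at x' only if a factor does; by [locus_nonzero] this
  transfers to the locus. *)
Lemma locus_irr : irreducible locus.
Proof.
split.
  have [||x lx _] := @locus_nonzero 0 1; [exact: Defs.formC|by rewrite rmorph1 oner_neq0|].
  by exists x.
move=> F G cF cG sub; apply: contrapT => /not_orP[nF nG].
have [x1 [lx1 nx1]] : exists x, locus x /\ ~ F x.
  by apply: contrapT => h; apply: nF => x lx; apply: contrapT => n; apply: h; exists x.
have [x2 [lx2 nx2]] : exists x, locus x /\ ~ G x.
  by apply: contrapT => h; apply: nG => x lx; apply: contrapT => n; apply: h; exists x.
have [d1 [q1 [q1d q1x q1F]]] := closed_form cF nx1.
have [d2 [q2 [q2d q2x q2G]]] := closed_form cG nx2.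
have n1 : hev iota (coord x') q1 != 0 by apply: contra_neq q1x => h; exact: lx1 q1d h.
have n2 : hev iota (coord x') q2 != 0 by apply: contra_neq q2x => h; exact: lx2 q2d h.
have [|x lx] := locus_nonzero (Defs.formM q1d q2d); first by rewrite rmorphM mulf_neq0.
rewrite /ev mevalM mulf_eq0 negb_or => /andP[h1 h2].
by case: (sub x lx) => [/q1F|/q2G] h; [rewrite /ev in h; rewrite h eqxx in h1|rewrite /ev in h; rewrite h eqxx in h2].
Qed.

End OnePoint.

Variables (X : set (pts A L)).
Hypothesis irrX : irreducible X.
Hypothesis cX : closed X.
Hypothesis dimX : dim_le1 X.
Variables (K : closedFieldType) (iota : {rmorphism L -> K}) (y : K).
Hypothesis y_transc : forall c, y <> iota c.

Lemma locus_sub x' : Kpoints iota X x' -> locus iota x' `<=` X.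
Proof.
move=> Xx' x lx; apply: contrapT => nx; have [d [q [qd qx qX]]] := closed_form cX nx.
by move/eqP: qx; apply; exact: (lx _ _ qd (Kpoints_hev Xx' qd qX)).
Qed.

Local Notation M := (stalk (center_self irrX)).
Local Notation cM := (cst (center_self irrX)).
Local Notation bieval f1 f2 := (pev (pev cM f1) f2).

(** If f1 and f2 were independent, a homomorphism sending f1 to an element
  c1 of L and f2 to y could be extended to the affine coordinates by [ext_ring], giving a
  K-point x' of X. The closure of x' is not X, since f1 is constant on it, and it is not the
  closure of an L-point, since f2 is not constant: this makes a chain of length two. *)
Lemma algebraically_dependent (f1 f2 : M) : exists2 P : {poly {poly L}}, P != 0 & bieval f1 f2 P = 0.
Proof.
apply: contrapT => indep.
pose j : {rmorphism {poly {poly L}} -> function_field irrX} := bieval f1 f2.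
have jinj a : j a = 0 -> a = 0.
  by move=> ja; apply: contrapT => /eqP na; apply: indep; exists a.
have [[x0 Xx0] _] := irrX; have [c xc] := chA.1 _ x0.
have chX : exists2 z, center_set (center_self irrX) z & in_chart c (coord z) by exists x0.
have [g1 [h1 [gh1 E1]]] := stalkP f1; have [g2 [h2 [gh2 E2]]] := stalkP f2.
have [d1 [g1d h1d h1z]] := gh1; have [d2 [g2d h2d h2z]] := gh2.
pose z := zeta (center_self irrX) c.
have [B [i [jB [ji surj ext]]]] := ext_ring K [seq (z l : function_field irrX) | l <- enum 'I_(nvars A)] j.
have /choice[b bE] : forall l, exists b, jB b = z l.
  by move=> l; apply: surj; apply: (map_f (fun l => z l : function_field irrX)); rewrite mem_enum.
pose cB : {rmorphism L -> B} := i \o (polyC \o polyC).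
have jcB e : jB (cB e) = cM e by rewrite /cB /= ji /j /= pevC; exact: pevC.
have hB p : jB (hev cB b p) = hev cM z p by exact: hev_comp.
have [a [na H]] : exists a, j a != 0 /\ forall phi : {rmorphism {poly {poly L}} -> K}, compat j phi -> phi a != 0 ->
    exists phiB : {rmorphism B -> K}, [/\ forall x, phiB (i x) = phi x, compat jB phiB &
      phiB (hev cB b h1 * hev cB b h2) != 0].
  by apply: ext; rewrite rmorphM /= !hB mulf_neq0 //; [apply: hev_zeta_neq0 h1d _|apply: hev_zeta_neq0 h2d _].
have a0 : a != 0 by apply: contra_neq na => ->; rewrite rmorph0.
have [l al] : exists l, a`_l != 0.
  by exists (size a).-1; rewrite -lead_coefE lead_coef_eq0.
have [c1 c1n] := nonroot_exists al.
(* c1 keeps a coefficient of a alive, and then a does not vanish at y, which is not algebraic over L. *)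
pose phi : {rmorphism {poly {poly L}} -> K} := pev (pev iota (iota c1)) y.
have phiE p : pev iota (iota c1) p = iota p.[c1] by rewrite pevE horner_map.
have [||phiB [phiBi phiBc nb]] := H phi.
- by move=> e /jinj ->; rewrite rmorph0.
- have n0 : \poly_(l < size a) (a`_l).[c1] != 0.
    apply: contra_neq c1n => h; have := congr1 (fun p : {poly L} => p`_l) h.
    rewrite coef_poly coef0; case: ltnP => // lel _.
    by rewrite nth_default // horner0.
  apply/eqP => h; have [] := @algebraic_in _ _ iota y _ n0; last by move=> e; exact: y_transc.
  rewrite -[RHS]h /phi /= pevE; congr (_.[_]); apply/polyP => r.
  rewrite !coef_map coef_poly /= phiE; case: ltnP => // ler.
  by rewrite [a`_r]nth_default // horner0.
pose g l := phiB (b l).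
have cBi e : phiB (cB e) = iota e by rewrite /cB /= phiBi /phi /= pevC; exact: pevC.
have gE p : phiB (hev cB b p) = hev iota g p by exact: hev_comp.
have z1 r : z (den c r) = 1 :> M.
  have -> : (1 : M) = fr (center_self irrX) 1%:MP 1 by rewrite -cstE rmorph1.
  apply/(fr_eqP irrX); [exact: zeta_frac|exact: frac_on1|].
  by move=> u _; rewrite den_idem mpolyC1 /ev meval1 mulr1 mul1r.
have gc : in_chart c g.
  move=> r; have /phiBc : jB (b (den c r) - 1) = 0.
    by rewrite rmorphB rmorph1 /= bE z1 subrr.
  rewrite rmorphB rmorph1 => /eqP; rewrite subr_eq0 => /eqP E.
  by rewrite /g E oner_neq0.
have [x' gx] := den_pt gc.
have [psi psin psiE] := sim_form iota gx.
have Xx' : Kpoints iota X x'.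
  move=> d q qd q0; rewrite /ev map_mpoly_hev; have := psiE d q qd.
  rewrite -gE phiBc; last by rewrite hB (hev_zeta_eq0 _ qd).
  by move/esym/eqP; rewrite mulf_eq0 (negbTE (psin d)) => /eqP.
move: nb; rewrite rmorphM !gE (psiE _ _ h1d) (psiE _ _ h2d) !mulf_eq0 !negb_or => /andP[/andP[_ n1] /andP[_ n2]].
have jT1 : j ('X%:P) = f1 by rewrite /j /= pevC; exact: pevX.
have jT2 : j 'X = f2 by exact: pevX.
have pT1 : phi ('X%:P) = iota c1 by rewrite /phi /= pevC; exact: pevX.
have pT2 : phi 'X = y by exact: pevX.
have R1 : iota c1 * hev iota (coord x') h1 = hev iota (coord x') g1.
  have /phiBc : jB (i ('X%:P) * hev cB b h1 - hev cB b g1) = 0.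
    rewrite rmorphB rmorphM /= !hB ji jT1.
    by rewrite [X in X * _]E1 (fr_zeta chX gh1) subrr.
  rewrite rmorphB rmorphM /= !gE phiBi pT1 (psiE _ _ h1d) (psiE _ _ g1d).
  rewrite mulrCA -mulrBr => /eqP; rewrite mulf_eq0 (negbTE (psin d1)) subr_eq0 => /eqP //.
have R2 : y * hev iota (coord x') h2 = hev iota (coord x') g2.
  have /phiBc : jB (i 'X * hev cB b h2 - hev cB b g2) = 0.
    rewrite rmorphB rmorphM /= !hB ji jT2.
    by rewrite [X in X * _]E2 (fr_zeta chX gh2) subrr.
  rewrite rmorphB rmorphM /= !gE phiBi pT2 (psiE _ _ h2d) (psiE _ _ g2d).
  rewrite mulrCA -mulrBr => /eqP; rewrite mulf_eq0 (negbTE (psin d2)) subr_eq0 => /eqP //.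
have subform d (p q : {mpoly L[nvars A]}) e : is_form d p -> is_form d q -> is_form d (p - e%:MP * q).
  move=> pd qd; apply: Defs.formD => //; apply: Defs.formN; rewrite -[d]add0r.
  by apply: Defs.formM => //; exact: Defs.formC.
(* x1 and x2 are points of the locus where f2 takes different values. *)
have [x1 lx1 h2x1] := locus_nonzero h2d n2.
pose e := ev g2 x1 / ev h2 x1.
have [|x2 lx2 x2n] := @locus_nonzero _ iota x' _ _ (subform d2 g2 h2 e g2d h2d).
  rewrite rmorphB rmorphM /= hevC -R2 -mulrBl mulf_neq0 // subr_eq0; apply/eqP; exact: y_transc.
pose Zs n := if n is n'.+1 then (if n' is 0%N then locus iota x' else X) else locus (idfun : {rmorphism L -> L}) x1.
have lx1x' : locus (idfun : {rmorphism L -> L}) x1 `<=` locus iota x'.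
  move=> u lu d p pd p0; apply: lu (pd) _; rewrite hev_meval; exact: lx1 pd p0.
suff : chain [set Z : set (pts A L) | [/\ closed Z, irreducible Z & Z `<=` X]] 2 Zs by move=> h; have := dimX h.
have lX := locus_sub Xx'.
split.
  move=> [|[|[|//]]] _ /=; split=> //; try exact: locus_closed; try exact: locus_irr.
  exact: subset_trans lx1x' lX.
move=> [|[|//]] _ /=; split=> //.
  move=> /(_ x2 lx2) /(_ _ _ (subform d2 g2 h2 e g2d h2d)) h.
  move/eqP: x2n; apply; apply: h; rewrite hev_meval mevalB mevalM mevalC /e.
  by rewrite -/(ev h2 x1) -/(ev g2 x1) mulfVK // subrr.
move=> Xl; apply: indep; exists (('X - c1%:P)%:P).
  by rewrite polyC_eq0 polyXsubC_eq0.
have e0 : f1 = cM c1.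
  rewrite E1 cstE; apply/(fr_eqP irrX) => //; first exact: frac_on1.
  move=> u /Xl lu; have /= := lu _ _ (subform d1 g1 h1 c1 g1d h1d).
  rewrite rmorphB rmorphM /= hevC R1 subrr => /(_ erefl).
  rewrite /ev mevalB mevalM mevalC meval1 mulr1 => /eqP; rewrite subr_eq0 => /eqP //.
transitivity (f1 - cM c1); last by rewrite e0 subrr.
by rewrite pevC rmorphB /=; congr (_ - _); [exact: pevX|exact: pevC].
Qed.

End Locus.

(** * Local rings of curves at nonsingular points *)

Lemma pev_comp (A B C : comNzRingType) (j : {rmorphism A -> B}) (g : {rmorphism B -> C})
  (j' : {rmorphism A -> C}) z z' p : (forall c, g (j c) = j' c) -> g z = z' -> g (pev j z p) = pev j' z' p.
Proof.
move=> E <-; rewrite !pevE -horner_map -map_poly_comp; congr (_.[_]).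
by apply: eq_map_poly => c; rewrite /= E.
Qed.

Section LocalCurve.
Variables (A : ambient) (L : closedFieldType).
Hypothesis chA : charted A.
Variables (X : set (pts A L)).
Hypothesis irrX : irreducible X.
Hypothesis cX : closed X.
Hypothesis dimX : dim_le1 X.
Variables (K : closedFieldType) (iota : {rmorphism L -> K}) (y : K).
Hypothesis y_transc : forall c, y <> iota c.
Variables (x : pts A L) (Xx : X x).
Local Notation Z := (center_point Xx).
Local Notation O := (stalk (center_point Xx)).

Lemma point_sub_self : Z `<=` center_self irrX.
Proof. by move=> _ ->. Qed.

Definition rho : {rmorphism O -> stalk (center_self irrX)} := res irrX point_sub_self.

Lemma rho_inj : injective rho. Proof. exact: res_inj. Qed.

Lemma rho_cst c : rho (cst Z c) = cst (center_self irrX) c. Proof. exact: res_cst. Qed.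

Lemma stalk_domain : domain_like O.
Proof.
move=> z w zw; have : (rho z : function_field irrX) * (rho w : function_field irrX) == 0.
  by apply/eqP; transitivity (rho (z * w)); [rewrite rmorphM|rewrite zw rmorph0].
rewrite mulf_eq0 => /orP[] /eqP E; [left|right]; apply: rho_inj; rewrite rmorph0; exact: E.
Qed.

(** A relation P(f1, f2) = 0 not divisible by f2 has a nonzero constant
  term P(f1, 0), and this is a multiple of f2. *)
Lemma some_polynomial_divisible (f1 f2 : O) : f2 != 0 ->
  exists2 p : {poly L}, p != 0 & exists w, pev (cst Z) f1 p = f2 * w.
Proof.
move=> n2; have [P P0 EP] := algebraically_dependent chA cX dimX y_transc (rho f1) (rho f2).
have {EP} : pev (pev (cst Z) f1) f2 P = 0.
  apply: rho_inj; rewrite rmorph0 -EP; apply: pev_comp => // c.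
  by apply: pev_comp => // e; exact: rho_cst.
elim/poly_ind: P P0 => [|P c IH]; first by rewrite eqxx.
have [->|c0] := eqVneq c 0.
  rewrite addr0 => n; rewrite rmorphM /= pevX => /stalk_domain [E|E].
    by apply: IH => //; apply: contra_neq n => ->; rewrite mul0r.
  by rewrite E eqxx in n2.
move=> _ E; exists c => //; exists (- pev (pev (cst Z) f1) f2 P).
move/eqP: E; rewrite rmorphD rmorphM /= pevX pevC addrC addr_eq0 => /eqP ->.
by rewrite mulrN mulrC.
Qed.

(** p is a power of the variable times a polynomial with nonzero constant term, whose
  value at a nonunit is a unit. *)
Lemma poly_at_nonunit (f : O) (p : {poly L}) : evx irrX Xx f = 0 -> p != 0 ->
  exists k u w, w * u = 1 /\ pev (cst Z) f p = f ^+ k * u.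
Proof.
move=> f0; elim/poly_ind: p => [|p c IH]; first by rewrite eqxx.
have [->|c0] := eqVneq c 0.
  rewrite addr0 => n; have [|k [u [w [wu E]]]] := IH.
    by apply: contra_neq n => ->; rewrite mul0r.
  by exists k.+1, u, w; split=> //; rewrite rmorphM /= pevX E exprS; ring.
move=> _; have [w ww] : exists w, w * pev (cst Z) f (p * 'X + c%:P) = 1.
  apply: (unitP (irrX := irrX)); rewrite rmorphD rmorphM /= pevX pevC rmorphD rmorphM /= f0 mulr0 add0r.
  by rewrite evx_cst.
by exists 0%N, (pev (cst Z) f (p * 'X + c%:P)), w; rewrite expr0 mul1r.
Qed.

(** By [some_polynomial_divisible] and [poly_at_nonunit], every nonzero g divides a
  power of every nonzero nonunit. So chains of primes have length at most one, the maximal ideal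
  has one generator t, and there is a highest power of t dividing g, with a unit as
  cofactor. *)
Lemma regular_unif : regular_local (local_ring Xx) -> exists t : local_ring Xx, uniformizing t.
Proof.
move=> [n [[P [PC Plt]] _] [s sE]].
(* In a chain P0 < P1 < P2, an element h of P2 outside P1 has a power in P1. *)
have n1 : (n <= 1)%N.
  rewrite leqNgt; apply/negP => n2.
  have [/= [p00 _ _] _] := PC 0%N (leq0n _).
  have [/= [p10 p11 p1l] p1p] := PC 1%N (ltnW n2).
  have [/= [p20 p21 p2l] p2p] := PC 2%N n2.
  have mulP i c z : (i <= n)%N -> P i z -> P i (c * z).
    move=> il Pz; have [/= [h0 _ hl] _] := PC i il.
    have := hl c z 0; rewrite !inE addr0; apply=> //; by rewrite inE in h0.
  have [_ /existsNP[g /not_implyP[g1 g0]]] := Plt 0%N (ltnW n2).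
  have [_ /existsNP[h /not_implyP[h2 h1]]] := Plt 1%N n2.
  have gn : (g : O) != 0 by apply/eqP => E; apply: g0; rewrite E; rewrite inE in p00.
  have h0 : evx irrX Xx h = 0.
    apply: contrapT => /eqP nh; have [u uh] := unitP nh; move/negP: p21; apply; rewrite inE -uh.
    exact: mulP.
  have [p pn [w pw]] := some_polynomial_divisible h gn.
  have [k [u [u' [uu E]]]] := poly_at_nonunit h0 pn.
  have : P 1%N (h ^+ k).
    have -> : h ^+ k = (u' * w) * g.
      transitivity (u' * (h ^+ k * u)); first by rewrite mulrCA uu mulr1.
      by rewrite -E pw; rewrite (mulrC (g : O)) mulrA.
    by apply: mulP => //; exact: ltnW.
  elim: k {E} => [|k IH]; first by rewrite expr0 => h'; move/negP: p11; apply; rewrite inE.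
  rewrite exprS => /mem_set /p1p /orP[]; rewrite inE //.
have [t tE] : exists t : local_ring Xx, forall z, nonunits z <-> exists y, z = y * t.
  case: n n1 s sE {P PC Plt} => [|[|//]] _ s sE.
    exists 0 => z; rewrite sE; split=> [[l lP ->]|[u ->]].
      exists 0; rewrite mulr0 big1_seq // => u /andP[_ /lP]; by rewrite /= (tuple0 s).
    by exists [::] => //; rewrite big_nil mulr0.
  have bs : behead s = [::] by apply: size0nil; rewrite size_behead size_tuple.
  exists (thead s) => z; rewrite sE; split=> [[l lP ->]|[u ->]].
    exists (\sum_(u <- l) u.1); rewrite mulr_suml; apply: eq_big_seq => u /lP /=.
    by rewrite (tuple_eta s) /= theadE bs inE => /eqP ->.
  exists [:: (u, thead s)]; last by rewrite big_seq1.
  by move=> _ /[!inE] /eqP -> /=; rewrite (tuple_eta s) /= theadE bs inE.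
exists t; split=> // [|g gn]; first exact: stalk_domain.
have t0 : evx irrX Xx t = 0 by apply/nonunitP/tE; exists 1; rewrite mul1r.
have [tz|tn] := eqVneq (t : O) 0.
  have [u ug] : exists u, u * g = 1.
    apply: (unitP (irrX := irrX)); apply: contra_neq gn => /nonunitP /tE [z ->].
    by rewrite tz mulr0.
  by exists 0%N, g, u; rewrite expr0 mulr1.
have [p pn [w pw]] := some_polynomial_divisible t gn.
have [k [u [u' [uu E]]]] := poly_at_nonunit t0 pn.
(* g divides t^k, so no power of t above k divides g. *)
have tk : t ^+ k = g * (w * u').
  by rewrite mulrA -pw E -mulrA [u * u']mulrC uu mulr1.
have tkn i : t ^+ i != 0.
  elim: i => [|i IH]; first by rewrite expr0 oner_neq0.
  rewrite exprS; apply/eqP => /stalk_domain [h|h]; first by rewrite h eqxx in tn.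
  by rewrite h eqxx in IH.
have bnd j : `[< exists g1, g = g1 * t ^+ j >] -> (j <= k)%N.
  move=> /asboolP [g1 gE]; rewrite leqNgt; apply/negP => kj.
  have : t ^+ k * (1 - t * (g1 * t ^+ (j - k.+1) * (w * u'))) = 0.
    rewrite mulrBr mulr1 {1}tk gE -{1}(subnKC kj) exprD exprS; ring.
  move=> /stalk_domain [h|h]; first by have := tkn k; rewrite h eqxx.
  have /eqP := congr1 (evx irrX Xx) h; rewrite rmorphB rmorphM /= t0 mul0r subr0 rmorph1 rmorph0.
  by rewrite oner_eq0.
have ex : exists j, `[< exists g1, g = g1 * t ^+ j >].
  by exists 0%N; apply/asboolP; exists g; rewrite expr0 mulr1.
have [j /asboolP[g1 gE] jmax] := ex_maxnP ex bnd.
have [u1 ug] : exists u1, u1 * g1 = 1.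
  apply: (unitP (irrX := irrX)); apply/eqP => /nonunitP /tE [z zE].
  have /asboolT/jmax : exists g1, g = g1 * t ^+ j.+1 by exists z; rewrite gE zE exprS mulrA.
  by rewrite ltnn.
by exists j, g1, u1.
Qed.

End LocalCurve.

(** * Extensions of a discrete valuation ring inside a valued field *)

Section ValuedDVR.
Variables (R : comNzRingType) (E K : fieldType) (v : valuation K).
Variables (rho : {rmorphism R -> E}) (alE : {rmorphism E -> K}) (t : R).
Hypothesis rho_inj : injective rho.
Hypothesis rho_frac : forall e : E, exists r1 r2, rho r2 != 0 /\ e * rho r2 = rho r1.
Hypothesis tU : uniformizing t.
Local Notation V := (valuation_ring v).
Local Notation m := (valuation_ideal v).
Definition alR : {rmorphism R -> K} := alE \o rho.
Hypothesis alV : forall r, V (alR r).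
Hypothesis alt : m (alR t).
Local Notation tau := (alR t).

Lemma alR_eq0 r : alR r = 0 -> r = 0.
Proof.
move=> /eqP; rewrite /alR /= fmorph_eq0 => /eqP h; apply: rho_inj; by rewrite h rmorph0.
Qed.

Lemma tau_neq0 : t != 0 -> tau != 0.
Proof. by apply: contra_neq => /alR_eq0. Qed.

Lemma common_denominator (p : {poly E}) : exists r (q : {poly R}), r != 0 /\ rho r *: p = map_poly rho q.
Proof.
elim/poly_ind: p => [|p c [r [q [r0 IH]]]].
  by exists 1, 0; rewrite oner_neq0 scaler0 rmorph0.
have [r1 [r2 [n2 cE]]] := rho_frac c.
have r20 : r2 != 0 by apply: contra_neq n2 => ->; rewrite rmorph0.
exists (r * r2), (r2 *: q * 'X + (r * r1)%:P); split.
  by apply/eqP => /(unif_dom tU) [h|h]; [rewrite h eqxx in r0|rewrite h eqxx in r20].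
rewrite [RHS]rmorphD [X in _ = X + _]rmorphM /= map_polyX map_polyC map_polyZ -IH !(rmorphM rho).
rewrite scalerDr -!scalerAl scalerA [rho r2 * _]mulrC; congr (_ + _).
rewrite -mul_polyC -polyCM; congr (_%:P); rewrite -mulrA [rho r2 * c]mulrC cE; symmetry; exact: (rmorphM rho).
Qed.

(** Clear the denominators, then divide by a coefficient of least
  valuation. *)
Lemma primitive_multiple (p : {poly E}) : p != 0 ->
  exists e (q : {poly R}), [/\ e != 0, p = e *: map_poly rho q & exists i, q`_i = 1].
Proof.
move=> p0; have [r [q [r0 qE]]] := common_denominator p.
have rr : rho r != 0 by apply: contra_neq r0 => h; apply: rho_inj; rewrite h rmorph0.
have q0 : q != 0.
  apply: contra_neq p0 => h; move: qE; rewrite h rmorph0 => /eqP.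
  by rewrite scaler_eq0 (negbTE rr) => /eqP.
have [|i0 [d [i0n n0 dE]]] := @min_coef R (unif_total tU) (size q) (fun i => q`_i).
  by exists (size q).-1; rewrite -?lead_coefE ?lead_coef_eq0 // prednK // lt0n size_poly_eq0.
have d1 : d i0 = 1.
  apply: (unif_cancel tU n0); rewrite mulr1 mulrC -dE //.
have qq : q = q`_i0 *: \poly_(i < size q) d i.
  apply/polyP => i; rewrite coefZ coef_poly; case: ltnP => lei; first by rewrite dE // mulrC.
  by rewrite nth_default // mulr0.
exists ((rho r)^-1 * rho q`_i0), (\poly_(i < size q) d i); split.
- rewrite mulf_neq0 ?invr_eq0 //; apply: contra_neq n0 => h.
  by apply: rho_inj; rewrite h rmorph0.
- by rewrite -scalerA -map_polyZ -qq -qE scalerA mulVf // scale1r.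
by exists i0; rewrite coef_poly i0n.
Qed.

(** z divides the constant term of an equation over R in which that term is not
  zero, and this is a unit times a power of t. Elements of V that are not algebraic may well
  be divisible by all the powers of tau, since the value group is arbitrary. *)
Lemma archimedean (z : K) : z != 0 -> V z -> algebraicOver alE z -> exists k, vdvd v z (tau ^+ k).
Proof.
move=> z0 Vz [p0 pn0 rp0].
have [e [p [e0 pE [i pi]]]] := primitive_multiple pn0.
have pn : p != 0 by apply/eqP => h; move: pi; rewrite h coef0 => /esym/eqP; rewrite oner_eq0.
have {p0 pn0 rp0 pE pi} rp : pev alR z p = 0.
  move: rp0; rewrite pE map_polyZ rootE hornerZ mulf_eq0 fmorph_eq0 (negbTE e0) /= => /eqP.
  by rewrite -map_poly_comp.
elim/poly_ind: p pn rp => [|p c IH]; first by rewrite eqxx.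
have [->|c0] := eqVneq c 0.
  rewrite addr0 => n; rewrite rmorphM /= pevX => /eqP; rewrite mulf_eq0 (negbTE z0) orbF => /eqP.
  by apply: IH; apply: contra_neq n => ->; rewrite mul0r.
move=> _; rewrite rmorphD rmorphM /= pevX pevC addrC => /eqP; rewrite addr_eq0 => /eqP cE.
have [k [u [w [wu cE']]]] := unif_dec tU c0.
exists k, (alR w * - pev alR z p).
  apply: vringM => //; apply: vringN; rewrite pevE horner_coef.
  by apply: vring_sum => l _; apply: vringM; [rewrite coef_map; exact: alV|exact: vringX].
have -> : tau ^+ k = alR w * alR c by rewrite cE' -rmorphM mulrA wu mul1r rmorphXn.
by rewrite cE; ring.
Qed.

Lemma archimedean_prod (I : eqType) (l : seq I) (F : I -> K) :
  (forall i, i \in l -> exists k, vdvd v (F i) (tau ^+ k)) -> exists k, vdvd v (\prod_(i <- l) F i) (tau ^+ k).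
Proof.
elim: l => [|i l IH] H; first by exists 0%N, 1; [exact: vring1|rewrite big_nil mulr1 expr0].
have [k [w Vw wE]] := H i (mem_head _ _).
have [|k' [w' Vw' wE']] := IH; first by move=> x xl; apply: H; rewrite inE xl orbT.
exists (k + k')%N, (w * w'); first exact: vringM.
by rewrite big_cons exprD wE wE'; ring.
Qed.

Lemma not_divisible (z : K) : t != 0 -> (exists k, vdvd v z (tau ^+ k)) -> ~ (forall N, vdvd v (tau ^+ N) z).
Proof.
move=> t0 [k [w Vw kE]] H; have [w' Vw' zE] := H k.+1.
have n := tau_neq0 t0.
have nk : tau ^+ k != 0 by rewrite expf_neq0.
apply: (@videal1 _ v); have -> : 1 = tau * (w' * w).
  by apply: (mulfI nk); rewrite mulr1 {1}kE zE exprS; ring.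
by apply: videalM => //; exact: vringM.
Qed.

Section Over.
Variables (O : comNzRingType) (f : {rmorphism R -> O}) (s : O) (n : nat) (u : O).
Hypothesis sU : uniformizing s.
Hypothesis t0 : t != 0.
Hypothesis resid : forall w : O, exists c y, w = f c + y * s.
Hypothesis uu : exists u', u' * u = 1.
Hypothesis ft : f t = u * s ^+ n.

Lemma sn_dvd : exists u', s ^+ n = u' * f t.
Proof. by have [u' uu'] := uu; exists u'; rewrite ft mulrA uu' mul1r. Qed.

Lemma expand1 w k : exists2 P : {poly R}, (size P <= k)%N & exists w', w = pev f s P + s ^+ k * w'.
Proof.
elim: k => [|k [P sP [w' E']]].
  by exists 0; rewrite ?size_poly0 //; exists w; rewrite rmorph0 add0r expr0 mul1r.
have [c [y yE]] := resid w'; exists (P + c *: 'X^k).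
  apply: leq_trans (size_polyD _ _) _; rewrite geq_max (leq_trans sP) //=.
  by apply: leq_trans (size_scale_leq _ _) _; rewrite size_polyXn.
exists y; rewrite rmorphD /= pevZ rmorphXn /= pevX E' yE exprS; ring.
Qed.

(** The expansion of w in powers of s has coefficients in R because the residue fields
  agree; each time s^n appears it is replaced by a unit times t. *)
Lemma expand w N : exists2 P : {poly R}, (size P <= n)%N & exists w', w = pev f s P + f t ^+ N * w'.
Proof.
elim: N => [|N [P sP [w' E']]].
  by exists 0; rewrite ?size_poly0 //; exists w; rewrite rmorph0 add0r expr0 mul1r.
have [Q sQ [w2 E2]] := expand1 w' n; have [u' sn] := sn_dvd.
exists (P + t ^+ N *: Q).
  by apply: leq_trans (size_polyD _ _) _; rewrite geq_max sP (leq_trans (size_scale_leq _ _)).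
by exists (u' * w2); rewrite rmorphD /= pevZ rmorphXn E' E2 sn exprS; ring.
Qed.

(** The V-points of O over the given V-point of R. *)
Definition point_over (psi : {rmorphism O -> K}) :=
  (forall r, psi (f r) = alR r) /\ (forall w, V (psi w)).

(** By [expand], z is a polynomial in s over R modulo each power of t, so the two
  values of z differ by a multiple of every power of tau; [archimedean] excludes this when they
  differ. *)
Lemma point_over_sep (psi psi' : {rmorphism O -> K}) z : point_over psi -> point_over psi' ->
  psi s = psi' s -> algebraicOver alE (psi z - psi' z) -> psi z = psi' z.
Proof.
move=> [pf pV] [pf' pV'] ss al; apply/eqP; rewrite -subr_eq0; apply: contrapT => /negP nz.
apply: (not_divisible t0 (archimedean nz (vringB (pV z) (pV' z)) al)) => N.
have [P _ [w ->]] := expand z N; exists (psi w - psi' w); first exact: vringB.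
rewrite !rmorphD !rmorphM !rmorphXn /= pf pf'.
rewrite (pev_comp (j' := alR) (z' := psi s)) // (pev_comp (j' := alR) (z' := psi s) (g := psi')) //.
by ring.
Qed.

(** By [expand], s^n = P(s) + t^N w with P of degree below n, so X^n - P takes
  values divisible by tau^N at the values of s. With n+1 of these, [divided_difference] shows
  that a nonzero algebraic element is divisible by tau^N for all N, against
  [archimedean]. *)
Lemma points_at_most (es : seq K) : uniq es ->
  (forall e, e \in es -> algebraicOver alE e /\ exists2 psi, point_over psi & psi s = e) ->
  (size es <= n)%N.
Proof.
move=> ues esP; rewrite leqNgt; apply/negP => nes.
pose es' := take n.+1 es.
have ses' : size es' = n.+1 by rewrite size_takel.
have es'P e : e \in es' -> algebraicOver alE e /\ exists2 psi, point_over psi & psi s = e.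
  by move=> /mem_take; exact: esP.
have es'V e : e \in es' -> V e by move=> /es'P [_ [psi [_ pV] <-]].
have [ds [dsP H]] := divided_difference (take_uniq n.+1 ues) es'V.
apply: (not_divisible t0 (z := \prod_(x <- ds) (x.1 - x.2))).
  apply: archimedean_prod => x /dsP /and3P[x1 x2 nx].
  apply: archimedean; first by rewrite subr_eq0.
    by apply: vringB; exact: es'V.
  by apply: algebraic_sub; [case: (es'P _ x1)|case: (es'P _ x2)].
move=> N; have [P sP [w E']] := expand (s ^+ n) N.
have sP' : (size (map_poly alR P) <= n)%N by exact: leq_trans (size_poly _ _) sP.
rewrite -[\prod_(_ <- _) _]mulr1; apply: (H _ _ ('X^n - map_poly alR P)); rewrite ?ses' //=.
- by rewrite (leq_trans (size_polyD _ _)) // geq_max size_polyXn size_polyN leqnn (leq_trans sP').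
- by rewrite coefB coefXn eqxx (nth_default 0 sP') subr0.
move=> e /es'P [_ [psi [pf pV] <-]]; exists (psi w) => //.
rewrite hornerD hornerN hornerXn -[(map_poly alR P).[_]]/(pev alR (psi s) P).
rewrite -(pev_comp (g := psi) (j := f) (z := s)) // -(rmorphXn psi) E' rmorphD rmorphM /= rmorphXn /= pf.
by ring.
Qed.

(** At the first index i where the claim fails, G`_i is a unit, while the lower
  terms are divisible by t, hence by s^n. So G`_i s^i is the only term of order i in s, and
  the terms cannot add up to zero. *)
Lemma equation_coef (G : {poly R}) : s != 0 -> pev f s G = 0 ->
  forall i, (i < n)%N -> exists y, G`_i = y * t.
Proof.
move=> s0 Gs i; elim/ltn_ind: i => i IH ilt.
apply: contrapT => h.
have [w wG] : exists w, w * G`_i = 1.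
  by apply: contrapT => h'; apply: h; exact/(unif_nonunit tU).
have [y yE] : exists y, take_poly i G = t *: y.
  suff /choice[d dE] : forall l, exists y, (l < i)%N -> G`_l = y * t.
    exists (\poly_(l < i) d l); apply/polyP => l; rewrite coef_take_poly coefZ coef_poly.
    by case: ltnP => // li; rewrite ?mulr0 // dE // mulrC.
  move=> l; case: (ltnP l i) => li; last by exists 0.
  by have [y yE] := IH l li (ltn_trans li ilt); exists y.
have [p pE] : exists p, drop_poly i G = p * 'X + (G`_i)%:P.
  exists (drop_poly 1 (drop_poly i G)); rewrite -{1}(poly_take_drop 1 (drop_poly i G)) addrC expr1.
  congr (_ + _); apply/polyP => l; rewrite coef_take_poly coefC; case: l => // ; by rewrite coef_drop_poly.
set gi := G`_i in h wG pE.
have E0 : s ^+ i * (f gi + s * (pev f s p + s ^+ (n - i.+1) * (u * pev f s y))) = 0.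
  rewrite -[RHS]Gs -(poly_take_drop i G) yE pE rmorphD rmorphM /= rmorphXn /= pevX pevZ.
  rewrite rmorphD rmorphM /= pevX pevC ft -[in RHS](subnKC ilt) exprD exprS; ring.
have [E1|E1] := unif_dom sU E0; first by have := unif_expf sU i s0; rewrite E1 eqxx.
apply: (unif_t_nonunit sU (w := - f w * (pev f s p + s ^+ (n - i.+1) * (u * pev f s y)))).
have /eqP := congr1 (fun x => f w * x) E1; rewrite mulr0 mulrDr -rmorphM wG rmorph1 addr_eq0 => /eqP ->; ring.
Qed.

End Over.
End ValuedDVR.

(** * Generic points of a curve *)

Section Generic.
Variables (A : ambient) (L : closedFieldType).
Hypothesis chA : charted A.
Variables (X : set (pts A L)).
Hypothesis irrX : irreducible X.
Hypothesis cX : closed X.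
Hypothesis dimX : dim_le1 X.
Variables (K : closedFieldType) (iota : {rmorphism L -> K}) (v : valuation K).
Hypothesis K_model : nonstandard_model iota v.

(** The elements of L have value 0. *)
Lemma model_transc : exists y : K, forall c, y <> iota c.
Proof.
have [[y y0 vy] triv _] := K_model; exists y => c yc.
have c0 : c != 0 by rewrite -(fmorph_eq0 iota) -yc.
by move/eqP: vy; apply; rewrite yc triv.
Qed.

Variables (x : pts A L) (Xx : X x) (x' : pts A K).
Hypothesis xx' : spec iota v x x'.
Hypothesis Xx' : Kpoints iota X x'.

Lemma spec_chart c : in_chart c (coord x) -> in_chart c (coord x').
Proof.
move=> xc i; have := spec_gen K_model (Xx := Xx) xx' (@Defs.formX A L (den c i)).
rewrite hevX; apply; exists x => //; by rewrite /ev mevalXU; exact: xc.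
Qed.

Lemma evs_zeta c i : in_chart c (coord x) ->
  evs K_model Xx irrX xx' Xx' (zeta (center_point Xx) c i) = aff c (coord x') i.
Proof. by move=> xc; rewrite /evs evalZ_zeta //; exists x. Qed.

(** The germ g of the form at x is nonzero and is killed by evaluation at x'.
  By [some_polynomial_divisible] each affine coordinate satisfies a nonzero polynomial over L
  modulo g, so at x' it is algebraic over L, hence in L. *)
Lemma vanishing_standard d q : is_form d q -> nzero X q -> hev iota (coord x') q = 0 ->
  exists2 y, X y & sim (coord x') (iota \o coord y).
Proof.
move=> qd qz q0; have [y y_transc] := model_transc.
have [c xc] := chA.1 _ x; have xc' := spec_chart xc.
pose Z := center_point Xx.
have chX : exists2 z, X z & in_chart c (coord z) by exists x.
have chZ : exists2 z, center_set Z z & in_chart c (coord z) by exists x.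
pose g := hev (cst Z) (zeta Z c) q.
have g0 : g != 0.
  apply/eqP => E; have := hev_zeta_neq0 irrX chX qd qz.
  move/eqP; apply; rewrite -[RHS](rmorph0 (rho irrX Xx)) -E /g.
  symmetry; apply: hev_comp => [e|i]; [exact: rho_cst|exact: res_zeta].
have gx : evs K_model Xx irrX xx' Xx' g = 0.
  rewrite /g (hev_comp (f' := iota) (u' := aff c (coord x'))); first last.
  - by move=> i; exact: evs_zeta.
  - by move=> e; exact: evs_cst.
  by have [chi _ chiE] := sim_form iota (den_sim xc'); rewrite [LHS](chiE d q qd) q0 mulr0.
have /choice[e eE] : forall i, exists e, aff c (coord x') i = iota e.
  move=> i; have [p p0 [w pw]] := some_polynomial_divisible chA irrX cX dimX y_transc (zeta Z c i) g0.
  apply: (algebraic_in p0); have := congr1 (evs K_model Xx irrX xx' Xx') pw.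
  rewrite rmorphM gx mul0r => <-; symmetry; apply: pev_comp; last exact: evs_zeta.
  by move=> u; exact: evs_cst.
have ec : in_chart c e.
  move=> i; rewrite -(fmorph_eq0 iota) -eE aff_den // oner_neq0 //.
have [u eu] := den_pt ec; exists u.
  apply: contrapT => nu; have [d0 [p [pd pu pX]]] := closed_form cX nu.
  move/eqP: pu; apply; have [chi chin /(_ _ _ pd)] := sim_form idfun eu.
  rewrite !hev_meval -/(ev p u) => E.
  have : chi d0 * ev p u = 0.
    rewrite -E; apply/eqP; rewrite -(fmorph_eq0 iota) -hev_meval.
    rewrite (hev_comp (f' := iota) (u' := aff c (coord x'))) //.
    have [psi _ psiE] := sim_form iota (den_sim xc').
    by apply/eqP; rewrite [LHS](psiE _ _ pd) (Kpoints_hev Xx' pd pX) mulr0.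
  by move/eqP; rewrite mulf_eq0 (negbTE (chin d0)) => /eqP.
apply: sim_trans (sim_sym (den_sim xc')) _.
have [chi [c0 cD cn] E] := eu; exists (iota \o chi).
  split=> [|d1 d2|d1] /=; rewrite ?c0 ?rmorph1 ?cD ?rmorphM ?fmorph_eq0 //.
by move=> i; rewrite -/(aff c (coord x') i) eE E rmorphM.
Qed.

End Generic.

Lemma sim_standard (L : closedFieldType) (r : nat) (D : set (pts (proj_space r) L)) (K : closedFieldType)
  (iota : {rmorphism L -> K}) (u : pts (proj_space r) L) (a' : pts (proj_space r) K) :
  D u -> sim (A := proj_space r) (coord a') (iota \o coord u) -> standard iota D a'.
Proof.
move=> Du E; exists u => //.
have nu : normalized (map_mx iota (val u)).
  have /existsP[i /andP[/eqP ui /forallP um]] := valP u.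
  apply/existsP; exists i; rewrite mxE ui rmorph1 eqxx /=; apply/forallP => j.
  apply/implyP => ji; have /implyP/(_ ji)/eqP uj := um j; by rewrite mxE uj rmorph0.
pose u' : pts (proj_space r) K := exist (fun x : 'rV[K]_r.+1 => normalized x) _ nu.
have uE i : pcoord u' i = iota (pcoord u i) by rewrite /pcoord /= mxE.
have [c c0 cE] := proj_simE E.
have -> : a' = u' by apply: (proj_pt_inj c0) => i; rewrite uE; exact: cE.
exact: uE.
Qed.

(** As a' is not an L-point, evaluation at a' is defined on the whole
  function field of D. *)
Lemma proj_generic (L : closedFieldType) (r : nat) (D : set (pts (proj_space r) L))
  (irrD : irreducible D) (cD : closed D)
  (dimD : dim_le1 D)
  (K : closedFieldType) (iota : {rmorphism L -> K}) (v : valuation K)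
  (K_model : nonstandard_model iota v) a (Da : D a) (a' : pts (proj_space r) K) :
  spec iota v a a' -> Kpoints iota D a' -> ~ standard iota D a' ->
  forall d h, is_form d h -> nzero (center_self irrD) h -> hev iota (coord a') h != 0.
Proof.
move=> aa' Da' ns d h hd hz; apply/eqP => h0; apply: ns.
have [u Du E] := vanishing_standard (proj_charted r) irrD cD dimD K_model Da aa' Da' hd hz h0.
exact: sim_standard E.
Qed.

(** * Pullback along the projection *)

Section EvalRes.
Variables (A : ambient) (k K : fieldType) (iota : {rmorphism k -> K}) (X : set (pts A k)).
Variables (Z W : center X) (x' : pts A K).
Hypothesis irrX : irreducible X.
Hypothesis ZW : Z `<=` W.
Hypothesis Xx' : Kpoints iota X x'.

Lemma evalZ_res gZ gW z : evalZ (iota := iota) (Z := W) irrX Xx' gW (res irrX ZW z) =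
  evalZ (Z := Z) irrX Xx' gZ z.
Proof.
have [g [h [gh ->]]] := stalkP z.
by rewrite res_fr // !evalZ_fr //; exact: frac_on_sub ZW gh.
Qed.

End EvalRes.

Section PullbackFractions.
Variables (r m : nat) (k : fieldType).
Variables (F : set (pts (biproj_space r m) k)) (D : set (pts (proj_space r) k)).
Variables (Z : center F) (W : center D).
Hypothesis dom : dominates Z W.

Lemma frac_on_pr g h : frac_on W g h ->
  frac_on Z (pr_form m g) (pr_form m h).
Proof.
move=> [d [gd hd [w Ww hw]]]; exists (d, 0%N); split; try exact: form_pr.
have [|z [Zz hz]] := dom_meet dom (open_nonzero hd); first by exists w.
by exists z => //; rewrite ev_pr_form.
Qed.

Lemma pullback_fr g h : frac_on W g h ->
  pullback dom (fr W g h) = fr Z (pr_form m g) (pr_form m h).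
Proof.
move=> gh; have [p ->] := fr_germ gh; rewrite pullback_germ.
apply: (germ_frE (frac_on_pr gh) (U := setT)); first exact: openT.
- by have [[z Zz] _] := center_irr Z; exists z.
by move=> y _ _; rewrite /= !ev_pr_form.
Qed.

Lemma pullback_cst e : pullback dom (cst W e) = cst Z e.
Proof.
rewrite !cstE pullback_fr; last exact: frac_on1.
by rewrite /pr_form comp_mpolyC rmorph1.
Qed.

Lemma pullback_zeta i0 j0 i : (exists2 w, center_set W w & pcoord w i0 != 0) ->
  pullback dom (zeta W (proj_chart i0) i) = zeta Z (biproj_chart i0 j0) (lshift _ i).
Proof.
move=> [w Ww wi]; rewrite pullback_fr; last by apply: zeta_frac; exists w.
rewrite /zeta /= bdenl /pr_form !comp_mpolyXU -!tnth_nth !tnth_map !tnth_ord_tuple //.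
Qed.

Lemma hev_pr (K : fieldType) (iota : {rmorphism k -> K}) (x : pts (biproj_space r m) K) q :
  hev iota (coord x) (pr_form m q) = hev iota (coord (pr x)) q.
Proof.
rewrite /pr_form /comp_mpoly.
rewrite -[X in _ = X](@hev_comp _ _ _ _ (hev iota (coord x)) (@mpolyC _ _ : {rmorphism _ -> _}) _
  (tnth [tuple 'X_(lshift m.+1 i) | i < r.+1])) // => [c|i]; first exact: hevC.
rewrite tnth_map tnth_ord_tuple; transitivity (coord x (lshift m.+1 i)); [exact: hevX|exact: bicoordl].
Qed.

End PullbackFractions.

Section FractionField.
Variables (A : ambient) (L : closedFieldType).
Hypothesis chA : charted A.
Variables (X : set (pts A L)) (irrX : irreducible X) (x : pts A L) (Xx : X x).

(** Dehomogenising the numerator and the denominator in a chart around x. *)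
Lemma rho_frac (e : function_field irrX) :
  exists r1 r2 : stalk (center_point Xx), rho irrX Xx r2 != 0 /\ e * rho irrX Xx r2 = rho irrX Xx r1.
Proof.
have [g [h [gh ->]]] := stalkP (e : stalk (center_self irrX)).
have [c xc] := chA.1 _ x; pose Z := center_point Xx.
have chX : exists2 z, center_set (center_self irrX) z & in_chart c (coord z) by exists x.
have chZ : exists2 z, center_set Z z & in_chart c (coord z) by exists x.
have E q : rho irrX Xx (hev (cst Z) (zeta Z c) q) = hev (cst (center_self irrX)) (zeta (center_self irrX) c) q.
  by apply: hev_comp => [u|i]; [exact: rho_cst|exact: res_zeta].
exists (hev (cst Z) (zeta Z c) g), (hev (cst Z) (zeta Z c) h); rewrite !E; split.
  by have [d [gd hd hz]] := gh; exact: (hev_zeta_neq0 irrX chX hd hz).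
exact: (fr_zeta chX gh).
Qed.

Lemma rho_fr g h : frac_on (center_point Xx) g h -> rho irrX Xx (fr _ g h) = fr _ g h.
Proof. exact: res_fr. Qed.

End FractionField.

(** * Separable covers are generically unramified *)

Lemma taylor1 (B : comNzRingType) (Q : {poly B}) (x d : B) :
  exists w, Q.[x + d] = Q.[x] + d * (Q^`().[x] + d * w).
Proof.
elim/poly_ind: Q => [|Q c [w E]]; first by exists 0; rewrite derivC !horner0; ring.
exists (w * (x + d) + Q^`().[x]); rewrite derivD derivC derivM derivX !hornerE E; ring.
Qed.

Section Cover.
Variables (r m : nat) (L : closedFieldType).
Variables (D : set (pts (proj_space r) L)) (F : set (pts (biproj_space r m) L)).
Variables (irrD : irreducible D) (irrF : irreducible F).
Variables (FD : F `<=` @pr r m L @^-1` D) (pr_surj : D `<=` @pr r m L @` F).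
Local Notation E := (function_field irrD).
Local Notation M := (function_field irrF).
Local Notation ffp := (@ff_pullback r m L F D FD pr_surj irrF irrD).

Lemma ffp_fr g h : frac_on (center_self irrD) g h ->
  ffp (fr (center_self irrD) g h) = fr (center_self irrF) (pr_form m g) (pr_form m h).
Proof. exact: pullback_fr. Qed.

Lemma ffp_cst e : ffp (cst (center_self irrD) e) = cst (center_self irrF) e.
Proof. exact: pullback_cst. Qed.

Section At.
Variables (x : pts (biproj_space r m) L) (Fx : F x) (Da : D (pr x)).
Hypothesis dom : dominates (center_point Fx) (center_point Da).
Local Notation R := (stalk (center_point Da)).
Local Notation O := (stalk (center_point Fx)).
Local Notation f := (pullback dom).
Local Notation rD := (rho irrD Da).
Local Notation rF := (rho irrF Fx).
Local Notation evD := (evx irrD Da).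
Local Notation evF := (evx irrF Fx).

Lemma rho_pullback z : rF (f z) = ffp (rD z).
Proof.
have [g [h [gh ->]]] := stalkP z.
rewrite pullback_fr // rho_fr; last exact: (frac_on_pr dom gh).
by rewrite rho_fr // ffp_fr //; apply: frac_on_sub gh => _ ->.
Qed.

Lemma pullback_inj : injective f.
Proof.
move=> z z' /(congr1 rF); rewrite !rho_pullback => /fmorph_inj; exact: rho_inj.
Qed.

Lemma evx_pullback z : evF (f z) = evD z.
Proof.
have [g [h [gh ->]]] := stalkP z.
by rewrite pullback_fr // !evx_fr ?ev_pr_form //; exact: (frac_on_pr dom gh).
Qed.

Lemma pullback_ideal : ideal_gen (f @` (@nonunits (local_ring Da))) `<=` (fun z : O => evF z = 0).
Proof.
move=> z [l lP ->]; rewrite rmorph_sum big1_seq // => u /andP[_ /lP [w /nonunitP w0 <-]].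
by rewrite rmorphM /= evx_pullback w0 mulr0.
Qed.

Lemma ideal_gen_mem (S : set O) z : S z -> ideal_gen S z.
Proof.
move=> Sz; exists [:: (1, z)]; last by rewrite big_seq1 mul1r.
by move=> u; rewrite inE => /eqP ->.
Qed.

Lemma ideal_genD (S : set O) y z : ideal_gen S y -> ideal_gen S z -> ideal_gen S (y + z).
Proof.
move=> [l lP ->] [l' lP' ->]; exists (l ++ l'); last by rewrite big_cat.
by move=> u; rewrite mem_cat => /orP[/lP|/lP'].
Qed.

Lemma ideal_genM (S : set O) y z : ideal_gen S z -> ideal_gen S (y * z).
Proof.
move=> [l lP ->]; exists [seq (y * u.1, u.2) | u <- l].
  by move=> _ /mapP[u ul ->] /=; exact: (lP u ul).
by rewrite big_map mulr_sumr; apply: eq_bigr => u _; rewrite mulrA.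
Qed.

Lemma pullback_ideal_mem (w : R) : evD w = 0 -> ideal_gen (f @` (@nonunits (local_ring Da))) (f w).
Proof. by move=> w0; apply: ideal_gen_mem; exists w => //; exact: (iffRL (nonunitP irrD (w : local_ring Da)) w0). Qed.

(** Expand G at the value e of z: 0 = G(e) + (z - e) (G'(e) + (z - e) w). The second
  factor is a unit because the root is simple, and G(e) comes from the maximal ideal of R. *)
Lemma simple_root (z : O) (G : {poly R}) : pev f z G = 0 -> evF (pev f z G^`()) != 0 ->
  ideal_gen (f @` (@nonunits (local_ring Da))) (z - cst (center_point Fx) (evF z)).
Proof.
move=> Gz G'z; pose e := cst (center_point Fx) (evF z); pose d := z - e.
pose r0 := pev (idfun : {rmorphism R -> R}) (cst (center_point Da) (evF z)) G.
have fr0 : f r0 = (map_poly f G).[e].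
  by apply: pev_comp => //; exact: pullback_cst.
have [w wE] := taylor1 (map_poly f G) e d.
have ed : e + d = z by rewrite /d addrC subrK.
rewrite ed [LHS](Gz : _ = 0) in wE.
have evd : evF d = 0 by exact: residue.
have eve : evF e = evF z by rewrite evx_cst.
have [u uE] : exists u, u * ((map_poly f G)^`().[e] + d * w) = 1.
  apply: (unitP (irrX := irrF)); rewrite rmorphD rmorphM /= evd mul0r addr0.
  suff -> : evF ((map_poly f G)^`().[e]) = evF (pev f z G^`()) by [].
  rewrite deriv_map; transitivity (evF (pev f e G^`())) => //.
  by rewrite !(pev_comp (g := evF) (j' := evF \o f) (z' := evF z)).
have r00 : evD r0 = 0.
  rewrite -evx_pullback fr0; have := congr1 evF wE.
  by rewrite rmorph0 rmorphD rmorphM /= evd mul0r addr0 => ->.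
have -> : z - e = - u * f r0.
  have /eqP := wE; rewrite -fr0 eq_sym addr_eq0 => /eqP ->.
  by rewrite mulrNN mulrCA uE mulr1.
by apply: ideal_genM; exact: pullback_ideal_mem.
Qed.

(** The maximal ideal of O is generated by differences of coordinates. Those of the
  first block come from R, the others are covered by [simple_root]. *)
Lemma unramified_crit i0 j0 : in_chart (biproj_chart i0 j0) (coord x) ->
  (forall k : 'I_m.+1, exists2 G : {poly R}, pev f (zeta (center_point Fx) (biproj_chart i0 j0) (rshift _ k)) G = 0 &
    evF (pev f (zeta (center_point Fx) (biproj_chart i0 j0) (rshift _ k)) G^`()) != 0) ->
  ideal_gen (f @` (@nonunits (local_ring Da))) = @nonunits (local_ring Fx).
Proof.
move=> xc H; apply/seteqP; split=> z; first by move=> /pullback_ideal /nonunitP.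
move=> /nonunitP z0; refine (@max_gen _ _ _ irrF _ Fx _ xc (@ideal_gen O (f @` (@nonunits (local_ring Da)))) _ _ _ _ z (z0 irrF)).
- by exists [::] => //; rewrite big_nil.
- exact: ideal_genD.
- exact: ideal_genM.
move=> i; rewrite -(evx_zeta irrF Fx xc).
case: (fintype.split_ordP i) => k ->; last by have [G G0 G1] := H k; exact: (simple_root G0 G1).
have xi : pcoord (pr x) i0 != 0.
  by have := xc (lshift _ k); rewrite /= bdenl (unsplitK (inl _ i0)).
rewrite -(pullback_zeta dom); last by exists (pr x).
rewrite evx_pullback -(pullback_cst dom) -rmorphB; apply: pullback_ideal_mem.
exact: residue.
Qed.

End At.

(** The exceptional set is given by a form, to which [isolated_zero] applies. *)
Definition generically (P : pts (biproj_space r m) L -> Prop) :=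
  exists d q, [/\ is_form d q, nzero F q & forall x, F x -> ev q x != 0 -> P x].

Lemma generically_and P Q : generically P -> generically Q -> generically (fun x => P x /\ Q x).
Proof.
move=> [d [p [pd [y Fy py] pP]]] [d' [q [qd [z Fz qz] qQ]]]; exists (d + d'), (p * q); split.
- exact: Defs.formM.
- apply: contrapT => h.
  have [y' Fy'|E|E] := form_prime irrF pd qd.
  + by apply/eqP; apply: contrapT => /negP n; apply: h; exists y' => //; rewrite /ev mevalM.
  + by rewrite E ?eqxx in py.
  + by rewrite E ?eqxx in qz.
move=> x Fx; rewrite /ev mevalM mulf_eq0 negb_or => /andP[px qx].
by split; [exact: pP|exact: qQ].
Qed.

Lemma generically_sub (P Q : pts (biproj_space r m) L -> Prop) :
  (forall x, F x -> P x -> Q x) -> generically P -> generically Q.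
Proof. by move=> PQ [d [q [qd qz qP]]]; exists d, q; split=> // x Fx /(qP x Fx); exact: PQ. Qed.

Lemma generically_all (I : eqType) (l : seq I) (P : I -> pts (biproj_space r m) L -> Prop) :
  (forall i, i \in l -> generically (P i)) -> generically (fun x => forall i, i \in l -> P i x).
Proof.
elim: l => [|i l IH] H.
  exists 0, 1; split=> //; first exact: Defs.formC.
  by have [[x Fx] _] := irrF; exists x => //; rewrite /ev meval1 oner_neq0.
have h1 := H i (mem_head _ _).
have h2 : generically (fun x => forall i, i \in l -> P i x).
  by apply: IH => j jl; apply: H; rewrite inE jl orbT.
apply: generically_sub (generically_and h1 h2) => x Fx [h3 h4] j.
by rewrite inE => /orP[/eqP ->|/h4].
Qed.

Lemma generically_regular (e : E) : generically (fun x => forall Da : D (pr x), exists z, rho irrD Da z = e).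
Proof.
have [g [h [gh ->]]] := stalkP (e : stalk (center_self irrD)).
have [d [gd hd [a Da ha]]] := gh.
exists (d, 0%N), (pr_form m h); split; first exact: form_pr.
  by have [x Fx xa] := pr_surj Da; exists x => //; rewrite ev_pr_form xa.
move=> x Fx; rewrite ev_pr_form => hx Da'.
exists (fr _ g h); rewrite rho_fr //; exists d; split=> //.
by exists (pr x).
Qed.

Lemma generically_unit (w : M) : w != 0 -> generically (fun x => forall (Fx : F x),
  exists2 z, rho irrF Fx z = w & evx irrF Fx z != 0).
Proof.
have [g [h [gh ->]]] := stalkP (w : stalk (center_self irrF)) => n.
have [d [gd hd hz]] := gh.
have gz : nzero F g.
  apply: contrapT => h0; move/eqP: n; apply.
  transitivity (cst (center_self irrF) 0); last exact: rmorph0.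
  rewrite cstE; apply/(fr_eqP irrF) => //; first exact: frac_on1.
  move=> y Fy; rewrite mpolyC0 /ev meval0 mul0r.
  have -> : g.@[coord y] = 0 by apply/eqP; apply: contrapT => /negP hy; apply: h0; exists y.
  by rewrite mul0r.
apply: (@generically_sub (fun x => ev g x != 0 /\ ev h x != 0)).
  move=> x Fx [gx hx] Fx'; have gh' : frac_on (center_point Fx') g h.
    by exists d; split=> //; exists x.
  by exists (fr _ g h); rewrite ?rho_fr ?evx_fr // mulf_neq0 ?invr_eq0.
by apply: generically_and; [exists d, g|exists d, h].
Qed.

Lemma generically_poly (q : {poly E}) :
  generically (fun x => forall Da : D (pr x), exists G, q = map_poly (rho irrD Da) G).
Proof.
have := @generically_all nat (iota 0 (size q)) _ (fun i _ => generically_regular q`_i).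
apply: generically_sub => x Fx H Da.
suff /choice[g gE] : forall i, exists z, (i < size q)%N -> rho irrD Da z = q`_i.
  exists (\poly_(i < size q) g i); apply/polyP => i; rewrite coef_map coef_poly.
  case: ltnP => [/gE //|h]; rewrite [LHS]nth_default //; symmetry; exact: (rmorph0 (rho irrD Da)).
move=> i; case: (ltnP i (size q)) => [h|]; last by exists 0.
by have [|z zE] := H i _ Da; [rewrite mem_iota|exists z].
Qed.

Hypothesis pr_sep : separable_cover FD pr_surj irrF irrD.

(** A separable equation of each affine coordinate over L(D) has, outside the
  zeros of some form, regular coefficients and a derivative that is a unit at the coordinate, as
  [unramified_crit] requires. *)
Lemma generically_unramified : generically (fun x =>
  forall (Fx : F x) (Da : D (pr x)) (dom : dominates (center_point Fx) (center_point Da)),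
    ideal_gen (pullback dom @` (@nonunits (local_ring Da))) = @nonunits (local_ring Fx)).
Proof.
have [[x0 Fx0] _] := irrF.
have [i0 ni0] := proj_pt_neq0 x0.1; have [j0 nj0] := proj_pt_neq0 x0.2.
pose c := biproj_chart i0 j0.
have x0c : in_chart c (coord x0) by apply: biproj_chart_in; rewrite ?bicoordl ?bicoordr.
have chG (i : 'I_(r.+1 + m.+1)) : generically (fun x => coord x (den c i) != 0).
  exists (weight (den c i)), 'X_(den c i); split; first exact: Defs.formX.
    by exists x0 => //; rewrite /ev mevalXU; exact: x0c.
  by move=> x _; rewrite /ev mevalXU.
pose et (k : 'I_m.+1) : M := zeta (center_self irrF) c (rshift r.+1 k).
have kG (k : 'I_m.+1) : generically (fun x => in_chart c (coord x) ->
    forall (Fx : F x) (Da : D (pr x)) (dom : dominates (center_point Fx) (center_point Da)),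
    exists2 G : {poly stalk (center_point Da)}, pev (pullback dom) (zeta (center_point Fx) c (rshift _ k)) G = 0 &
    evx irrF Fx (pev (pullback dom) (zeta (center_point Fx) c (rshift _ k)) G^`()) != 0).
  have [q [qs rq]] := pr_sep (et k).
  have q'n : (map_poly ffp q)^`().[et k] != 0.
    have : separable_poly (map_poly ffp q) by rewrite separable_map.
    by rewrite unlock => /coprimep_root; apply.
  apply: generically_sub (generically_and (generically_poly q) (generically_unit q'n)).
  move=> x Fx [hG hu] xc Fx' Da dom; have [G qG] := hG Da; have [z zE zn] := hu Fx'.
  have rz : rho irrF Fx' (zeta (center_point Fx') c (rshift r.+1 k)) = et k.
    by apply: res_zeta; exists x.
  have pE (H : {poly stalk (center_point Da)}) :
      rho irrF Fx' (pev (pullback dom) (zeta (center_point Fx') c (rshift r.+1 k)) H) =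
      (map_poly ffp (map_poly (rho irrD Da) H)).[et k].
    rewrite -map_poly_comp; transitivity (pev (ffp \o rho irrD Da) (et k) H) => //.
    by apply: pev_comp => // u; exact: rho_pullback.
  exists G.
    apply: (@rho_inj _ _ _ irrF _ Fx'); rewrite pE -qG rmorph0; exact/eqP.
  suff -> : pev (pullback dom) (zeta (center_point Fx') c (rshift r.+1 k)) G^`() = z by [].
  by apply: (@rho_inj _ _ _ irrF _ Fx'); rewrite pE -!deriv_map -qG zE deriv_map.
have h1 := generically_all (l := enum 'I_(r.+1 + m.+1)) (fun i _ => chG i).
have h2 := generically_all (l := enum 'I_m.+1) (fun k _ => kG k).
apply: generically_sub (generically_and h1 h2) => x Fx [hc hk] Fx' Da dom.
have xc : in_chart c (coord x) by move=> i; apply: hc; rewrite mem_enum.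
apply: (unramified_crit (dom := dom) xc) => k.
by apply: hk => //; rewrite mem_enum.
Qed.

End Cover.

(** * Local parameters at a nonsingular point *)

Lemma unif_assoc (R : comNzRingType) (s s0 u w : R) : uniformizing s0 -> w * u = 1 -> s = u * s0 -> uniformizing s.
Proof.
move=> sU wu sE; have s0E : s0 = w * s by rewrite sE mulrA wu mul1r.
split; first exact: unif_dom sU.
  move=> z; rewrite (unif_nonunit sU); split=> -[y ->].
    by exists (y * w); rewrite s0E mulrA.
  by exists (y * u); rewrite sE mulrA.
move=> g /(unif_dec sU) [k [u' [w' [wu' gE]]]]; exists k, (u' * w ^+ k), (w' * u ^+ k); split.
  transitivity ((w' * u') * (w * u) ^+ k); first by rewrite exprMn; ring.
  by rewrite wu' wu mul1r expr1n.
by rewrite gE s0E exprMn mulrA.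
Qed.

Section Near.
Variables (A : ambient) (L : fieldType) (X : set (pts A L)) (x : pts A L) (Xx : X x).
Local Notation Z := (center_point Xx).
Local Notation O := (stalk (center_point Xx)).

Definition nearby (P : pts A L -> Prop) :=
  exists U, [/\ open U, U x & forall y, X y -> U y -> P y].

Lemma nearby_and (P Q : pts A L -> Prop) : nearby P -> nearby Q -> nearby (fun y => P y /\ Q y).
Proof.
move=> [U [oU Ux UP]] [W [oW Wx WQ]]; exists (U `&` W); split=> //; first exact: openI.
by move=> y Xy [Uy Wy]; split; [exact: UP|exact: WQ].
Qed.

Lemma nearby_sub (P Q : pts A L -> Prop) : (forall y, X y -> P y -> Q y) -> nearby P -> nearby Q.
Proof. by move=> PQ [U [oU Ux UP]]; exists U; split=> // y Xy Uy; apply: PQ => //; exact: UP. Qed.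

Lemma nearby_all (I : eqType) (l : seq I) (P : I -> pts A L -> Prop) :
  (forall i, i \in l -> nearby (P i)) -> nearby (fun y => forall i, i \in l -> P i y).
Proof.
elim: l => [|i l IH] H; first by exists setT; split=> //; exact: openT.
have h2 : nearby (fun y => forall i, i \in l -> P i y).
  by apply: IH => j jl; apply: H; rewrite inE jl orbT.
apply: nearby_sub (nearby_and (H i (mem_head _ _)) h2) => y Xy [h3 h4] j.
by rewrite inE => /orP[/eqP ->|/h4].
Qed.

Lemma germ_nearby (u w : local_fun Z) : germ u = germ w -> nearby (fun y => u y = w y).
Proof. by move/germE => [U [oU [_ [-> Ux]] H]]; exists U. Qed.

(** A germ at x has no definite value at another point; this is the value of a chosen
  representative, so its properties only hold near x. *)
Definition fval (z : O) (y : pts A L) : L := (repr z : local_fun Z) y.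

Lemma fvalM z z' : nearby (fun y => fval (z * z') y = fval z y * fval z' y).
Proof.
by apply: (@germ_nearby (repr (z * z')) (repr z * repr z')); rewrite germK /germ rmorphM /=; congr (_ * _);
  rewrite reprK.
Qed.

Lemma fvalB z z' : nearby (fun y => fval (z - z') y = fval z y - fval z' y).
Proof.
by apply: (@germ_nearby (repr (z - z')) (repr z - repr z')); rewrite germK /germ rmorphB /=; congr (_ - _);
  rewrite reprK.
Qed.

Lemma fval_cst e : nearby (fun y => fval (cst Z e) y = e).
Proof. by apply: (@germ_nearby (repr (cst Z e)) (LocalFun (cst_regular Z e))); rewrite germK. Qed.

Lemma fvalX z k : nearby (fun y => fval (z ^+ k) y = fval z y ^+ k).
Proof.
elim: k => [|k IH].
  apply: nearby_sub (fval_cst 1) => y Xy; rewrite expr0 rmorph1 //.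
by apply: nearby_sub (nearby_and (fvalM z (z ^+ k)) IH) => y Xy [E1 E2]; rewrite exprS E1 E2 exprS.
Qed.

Variable c : chart A.
Hypothesis xc : in_chart c (coord x).

Lemma fval_hev q : nearby (fun y => fval (hev (cst Z) (zeta Z c) q) y = q.@[aff c (coord y)]).
Proof.
have [|p E] := hev_zeta (Z := Z) (c := c) _ q; first by exists x.
by apply: (@germ_nearby (repr _) (LocalFun p)); rewrite germK.
Qed.

Lemma fval_zeta i : nearby (fun y => fval (zeta Z c i) y = aff c (coord y) i).
Proof.
apply: nearby_sub (fval_hev 'X_i) => y Xy; rewrite hevX => ->.
by rewrite mevalXU.
Qed.

End Near.

Section LocalParameter.
Variables (A : ambient) (L : closedFieldType).
Hypothesis chA : charted A.
Variables (X : set (pts A L)) (irrX : irreducible X) (x : pts A L) (Xx : X x).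
Local Notation Z := (center_point Xx).
Local Notation O := (stalk (center_point Xx)).
Variable s : local_ring Xx.
Hypothesis sU : uniformizing s.
Variable c : chart A.
Hypothesis xc : in_chart c (coord x).

Lemma zeta_diff i : exists y, zeta Z c i - cst Z (aff c (coord x) i) = y * (s : O).
Proof.
have /(nonunitP irrX (_ : local_ring Xx)) /(unif_nonunit sU) [y yE] :
    evx irrX Xx (zeta Z c i - cst Z (aff c (coord x) i)) = 0.
  by rewrite -(evx_zeta irrX Xx xc) residue.
by exists y.
Qed.

(** The germ of q is a unit times a power of s, and the differences of coordinates are
  multiples of s: where q vanishes, so does s, and the coordinates are those of x. *)
Lemma isolated_zero d q : is_form d q -> nzero X q -> nearby X x (fun y => ev q y = 0 -> y = x).
Proof.
move=> qd qz.
have chX : exists2 z, X z & in_chart c (coord z) by exists x.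
pose g := hev (cst Z) (zeta Z c) q.
have g0 : (g : local_ring Xx) != 0.
  apply/eqP => E; have := hev_zeta_neq0 irrX chX qd qz.
  move/eqP; apply; rewrite -[RHS](rmorph0 (rho irrX Xx)) -E /g.
  symmetry; apply: hev_comp => [e|i]; [exact: rho_cst|by apply: res_zeta; exists x].
have [k [u [w [wu gE]]]] := unif_dec sU g0.
have sk : (s : O) ^+ k = (w : O) * g by rewrite gE; transitivity ((w * u) * s ^+ k); [rewrite wu mul1r|rewrite mulrA].
have /choice[y yE] : forall i, exists y, zeta Z c i - cst Z (aff c (coord x) i) = y * (s : O).
  exact: zeta_diff.
have N1 : nearby X x (fun p => fval s p ^+ k = fval (w : O) p * q.@[aff c (coord p)]).
  apply: nearby_sub (nearby_and (fvalX (s : O) k) (nearby_and (fvalM (w : O) g) (fval_hev Xx xc q))).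
  by move=> p Xp [<- [E1 E2]]; rewrite sk E1 E2.
have N2 : nearby X x (fun p => forall i, i \in enum 'I_(nvars A) ->
    aff c (coord p) i - aff c (coord x) i = fval (y i) p * fval s p).
  apply: nearby_all => i _.
  apply: nearby_sub (nearby_and (nearby_and (fvalM (y i) s) (fval_zeta Xx xc i))
    (nearby_and (fvalB (zeta Z c i) (cst Z (aff c (coord x) i))) (fval_cst Xx (aff c (coord x) i)))).
  by move=> p Xp [[E1 E2] [E3 E4]]; rewrite -E1 -yE E3 E4 E2.
have N3 : nearby X x (fun p => in_chart c (coord p)).
  exists [set p | in_chart c (coord p)]; split=> //; exact: chart_open.
apply: nearby_sub (nearby_and N1 (nearby_and N2 N3)) => p Xp [E1 [E2 pc]] qp.
have [chi chn chiE] := sim_form idfun (den_sim pc).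
have qa : q.@[aff c (coord p)] = 0.
  by have := chiE d q qd; rewrite !hev_meval /aff => ->; rewrite -/(ev q p) qp mulr0.
have s0 : fval s p = 0.
  by apply/eqP; move/eqP: E1; rewrite qa mulr0 expf_eq0 => /andP[].
apply: chA.2; apply: (aff_sim xc pc) => i; apply/eqP; rewrite -subr_eq0.
by rewrite E2 ?mem_enum // s0 mulr0.
Qed.

(** The coefficients run over the moment curve, so that one parameter gives enough
  linear combinations. *)
Definition diff_combination (th : L) : O :=
  \sum_(i < nvars A) cst Z (th ^+ i) * (zeta Z c i - cst Z (aff c (coord x) i)).

(** The i-th difference is y_i s, and not all the y_i are nonunits, as the
  differences generate the maximal ideal (s). So th only has to avoid the roots of T and
  those of the polynomial with coefficients y_i(x). *)
Lemma generic_uniformizer (T : {poly L}) : (s : O) != 0 -> T != 0 ->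
  exists2 th, T.[th] != 0 & uniformizing (diff_combination th : local_ring Xx).
Proof.
move=> s0 T0.
have /choice[y yE] : forall i, exists y, zeta Z c i - cst Z (aff c (coord x) i) = y * (s : O).
  exact: zeta_diff.
pose T1 : {poly L} := \sum_(i < nvars A) evx irrX Xx (y i) *: 'X^i.
have T1c (i : 'I_(nvars A)) : T1`_i = evx irrX Xx (y i).
  rewrite coef_sum (bigD1 i) //= coefZ coefXn eqxx mulr1 big1 ?addr0 // => j ji.
  by rewrite coefZ coefXn eq_sym (negbTE (_ : val j != val i)) ?mulr0.
(* Otherwise the differences, hence also s, would be multiples of s^2. *)
have T10 : T1 != 0.
  apply/eqP => T10.
  have : exists w : O, (s : O) = w * (s * s).
    have ss : evx irrX Xx s = 0.
      by apply/nonunitP/(unif_nonunit sU); exists 1; rewrite mul1r.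
    apply: (@max_gen _ _ _ irrX _ Xx _ xc (fun z : O => exists w : O, z = w * (s * s))) ss.
    - by exists 0; rewrite mul0r.
    - by move=> z z' [w ->] [w' ->]; exists (w + w'); rewrite mulrDl.
    - by move=> z z' [w ->]; exists (z * w); rewrite mulrA.
    move=> i; have /(nonunitP irrX (_ : local_ring Xx)) /(unif_nonunit sU) [w wE] : evx irrX Xx (y i) = 0.
      by rewrite -T1c T10 coef0.
    by exists w; rewrite yE [y i]wE; exact: (esym (mulrA (w : O) s s)).
  move=> [w wE]; have := @unif_pow_dvd _ _ sU 1 2 (w : local_ring Xx) s0.
  by rewrite expr1 expr2 => /(_ wE).
have [th] := nonroot_exists (mulf_neq0 T0 T10).
rewrite hornerM mulf_eq0 negb_or => /andP[Tt T1t]; exists th => //.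
have [w wE] : exists w, w * (\sum_(i < nvars A) cst Z (th ^+ i) * y i) = 1.
  apply: (unitP (irrX := irrX)); rewrite rmorph_sum /=.
  suff -> : \sum_(i < nvars A) evx irrX Xx (cst Z (th ^+ i) * y i) = T1.[th] by [].
  rewrite horner_sum; apply: eq_bigr => i _.
  by rewrite rmorphM /= evx_cst hornerZ hornerXn mulrC.
apply: (unif_assoc sU (u := \sum_(i < nvars A) cst Z (th ^+ i) * y i) (w := w) wE).
transitivity ((\sum_(i < nvars A) cst Z (th ^+ i) * y i) * (s : O)) => //.
by rewrite mulr_suml; apply: eq_bigr => i _; rewrite yE mulrA.
Qed.

End LocalParameter.

(** * Extending an embedding with a prescribed root *)

Section AffineCoordinates.
Variables (r m : nat) (i0 : 'I_r.+1) (j0 : 'I_m.+1) (k : fieldType).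

Lemma biaffl (w : 'I_(r.+1 + m.+1) -> k) i :
  aff (biproj_chart i0 j0) w (lshift _ i) = w (lshift _ i) / w (lshift _ i0).
Proof. by congr (_ / w _); exact: bdenl. Qed.

Lemma biaffr (w : 'I_(r.+1 + m.+1) -> k) i :
  aff (biproj_chart i0 j0) w (rshift _ i) = w (rshift _ i) / w (rshift _ j0).
Proof. by congr (_ / w _); exact: bdenr. Qed.

Lemma biaff_coordl (x : pts (biproj_space r m) k) i :
  aff (biproj_chart i0 j0) (coord x) (lshift _ i) = pcoord x.1 i / pcoord x.1 i0.
Proof. by rewrite biaffl !bicoordl. Qed.

Lemma biaff_coordr (x : pts (biproj_space r m) k) i :
  aff (biproj_chart i0 j0) (coord x) (rshift _ i) = pcoord x.2 i / pcoord x.2 j0.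
Proof. by rewrite biaffr !bicoordr. Qed.

End AffineCoordinates.

Section ExtendRoot.
Variables (E : fieldType) (M : fieldType) (K : closedFieldType).
Variables (j : {rmorphism E -> M}) (phi : {rmorphism E -> K}).

Lemma field_compat : compat j phi.
Proof. by move=> e /eqP; rewrite fmorph_eq0 => /eqP ->; rewrite rmorph0. Qed.

(** Sending z to e is compatible with the relations on z by [compat_root]. The obstruction
  to extending further, given by [ext_ring], is a nonzero element of E(z), which divides a nonzero
  constant by [alg_inv] and hence survives. *)
Lemma ext_root (z : M) (G : {poly E}) (e : K) (l : seq M) : min_rel j z G -> pev phi e G = 0 ->
  exists (B : comNzRingType) (i : {rmorphism E -> B}) (jB : {rmorphism B -> M}) (phiB : {rmorphism B -> K}),
  [/\ (forall x, jB (i x) = j x) /\ (forall x, phiB (i x) = phi x),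
      forall w, w \in l -> exists x, jB x = w, compat jB phiB &
      exists x, jB x = z /\ phiB x = e].
Proof.
move=> mG eG; have [Gz lG Gmin] := mG.
have lG' : phi (lead_coef G) != 0 by rewrite fmorph_eq0 -(fmorph_eq0 j).
have c1 := compat_root mG field_compat lG' eG.
have [B [i [jB [ji surj ext]]]] := ext_ring K l (pev j z).
have [|a [na H]] := ext 1; first by rewrite rmorph1 oner_neq0.
have na' : pev phi e a != 0.
  have [a0 [U [a0n /c1]]] := alg_inv mG na.
  rewrite rmorphB rmorphM /= pevC => /eqP; rewrite subr_eq0 => /eqP E0.
  apply/eqP => h; move: E0; rewrite h mulr0 => /eqP.
  by rewrite fmorph_eq0 -(fmorph_eq0 j) (negbTE a0n).
have [phiB [phiBi phiBc _]] := H (pev phi e) c1 na'.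
exists B, (i \o polyC), jB, phiB; split=> //.
  split=> x; first by transitivity (pev j z x%:P); [exact: ji|exact: pevC].
  by transitivity (pev phi e x%:P); [exact: phiBi|exact: pevC].
exists (i 'X); split; first by transitivity (pev j z 'X); [exact: ji|exact: pevX].
by transitivity (pev phi e 'X); [exact: phiBi|exact: pevX].
Qed.

(** The minimal relation divides the separable q. *)
Lemma min_rel_separable (z : M) (q : {poly E}) : separable_poly q -> root (map_poly j q) z ->
  exists G, min_rel j z G /\ separable_poly G.
Proof.
move=> qs rq; have q0 := separable_poly_neq0 qs.
have [|G mG] := @min_relP _ _ j z.
  by exists q; [exact/eqP|rewrite map_poly_eq0].
exists G; split=> //; apply: dvdp_separable qs.
have [e [p [u [E1 /eqP]]]] := min_dvd mG (eqP rq : pev j z q = 0).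
rewrite map_poly_eq0 => /eqP u0.
have lG : lead_coef G ^+ e != 0 by rewrite expf_neq0 // lead_coef_eq0 (min_neq0 mG).
rewrite -(dvdpZr _ _ lG) E1 u0 addr0; exact: dvdp_mull.
Qed.

End ExtendRoot.

(** * Properness of projective space *)

Lemma max_coordinate (K : fieldType) (v : valuation K) (n : nat) (u : 'I_n -> K) : (exists i, u i != 0) ->
  exists i0, u i0 != 0 /\ forall i, valuation_ring v (u i / u i0).
Proof.
move=> [j nj].
have H (l : seq 'I_n) : exists i0, u i0 != 0 /\ forall i, i \in l -> valuation_ring v (u i / u i0).
  elim: l => [|k l [i0 [n0 H]]]; first by exists j.
  have [h|h] := pselect (valuation_ring v (u k / u i0)).
    by exists i0; split=> // i; rewrite inE => /orP[/eqP ->|/H].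
  have mk := videalVN h; rewrite invf_div in mk.
  have nk : u k != 0 by apply/eqP => E; apply: h; rewrite E mul0r; left.
  exists k; split=> // i; rewrite inE => /orP[/eqP ->|/H Vi].
    by rewrite divff //; exact: vring1.
  have -> : u i / u k = (u i / u i0) * (u i0 / u k) by rewrite mulrA divfK.
  by apply: vringM => //; exact: videalW.
by have [i0 [n0 H0]] := H (enum 'I_n); exists i0; split=> // i; apply: H0; rewrite mem_enum.
Qed.

Section SpecialisationFacts.
Variables (L K : closedFieldType) (iota : {rmorphism L -> K}) (v : valuation K).
Hypothesis K_model : nonstandard_model iota v.
Local Notation mv := (valuation_ideal v).

(** A form vanishing on X vanishes at x', and reduces to its value at x. *)
Lemma spec_closed (A : ambient) (X : set (pts A L)) x x' : closed X -> spec iota v x x' ->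
  Kpoints iota X x' -> X x.
Proof.
move=> cX [w ws wx] Xx'; apply: contrapT => nx; have [d [q [qd qx qX]]] := closed_form cX nx.
move/eqP: qx; apply; apply: (iota_videal K_model).
have [_] := spec_cong K_model q wx.
have [chi _ /(_ d q qd) ->] := sim_form iota ws.
by rewrite (Kpoints_hev Xx' qd qX) mulr0 sub0r => /videalN; rewrite opprK.
Qed.

(** After division by a coordinate of least valuation, all the coordinates are in the
  valuation ring and their residues are not all zero. *)
Lemma specialise_point n (g : 'I_n.+1 -> K) : (exists k, g k != 0) ->
  exists (b1 : pts (proj_space n) L) (c : K), c != 0 /\ forall k, mv (c * g k - iota (pcoord b1 k)).
Proof.
move=> /(max_coordinate v) [k0 [n0 gV]]; have [_ _ res] := K_model.
have /choice[e eE] : forall k, exists e, mv (g k / g k0 - iota e).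
  by move=> k; exact: res (gV k).
have e0 : e k0 != 0.
  apply/eqP => h; have := eE k0; rewrite h rmorph0 subr0 divff //; exact: videal1.
have [|b1 [c [c0 bE]]] := @proj_pt_exists n L e; first by exists k0.
exists b1, ((g k0)^-1 * (iota c)^-1); split.
  by rewrite mulf_neq0 ?invr_eq0 // fmorph_eq0.
move=> k; have -> : (g k0)^-1 * (iota c)^-1 * g k - iota (pcoord b1 k) =
    (g k / g k0 - iota (e k)) * iota c^-1.
  by rewrite bE rmorphM fmorphV; field; rewrite fmorph_eq0 c0 n0.
by apply: videalM => //; exact: iota_vring.
Qed.

Lemma spec_bipoint r m (a : pts (proj_space r) L) (b : pts (proj_space m) L) a' b' :
  infinitesimal_nbhd iota v a a' -> infinitesimal_nbhd iota v b b' ->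
  spec iota v (bipoint a b) (bipoint a' b').
Proof.
move=> [c1 c10 H1] [c2 c20 H2].
exists (fun i => match fintype.split i with inl k => c1 * pcoord a' k | inr k => c2 * pcoord b' k end).
  apply: (@biproj_sim _ _ _ _ _ c1 c2) => // i.
    by rewrite bicoordl (unsplitK (inl _ i)).
  by rewrite bicoordr (unsplitK (inr _ i)).
by move=> i /=; case: (fintype.split i).
Qed.

End SpecialisationFacts.

(** * The points of the fibre near a nonsingular point *)

Section Main.
Variables (L : closedFieldType) (r m : nat).
Variables (D : set (pts (proj_space r) L)) (F : set (pts (biproj_space r m) L)).
Variables (cD : closed D) (irrD : irreducible D).
Hypothesis dimD : dim_le1 D.
Variables (cF : closed F) (irrF : irreducible F).
Hypothesis dimF : dim_le1 F.
Variables (FD : F `<=` @pr r m L @^-1` D) (pr_surj : D `<=` @pr r m L @` F).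
Hypothesis pr_sep : separable_cover FD pr_surj irrF irrD.
Variables (a : pts (proj_space r) L) (b : pts (proj_space m) L) (Fab : F (bipoint a b)).
Variables (K : closedFieldType) (iota : {rmorphism L -> K}) (v : valuation K).
Hypothesis K_model : nonstandard_model iota v.
Variables (a' : pts (proj_space r) K) (Da' : Kpoints iota D a').
Hypothesis a'_inf : infinitesimal_nbhd iota v a a'.
Hypothesis a'_gen : ~ standard iota D a'.

Local Notation V := (valuation_ring v).
Local Notation mv := (valuation_ideal v).
Local Notation E := (function_field irrD).
Local Notation M := (function_field irrF).
Local Notation ffp := (@ff_pullback r m L F D FD pr_surj irrF irrD).
Local Notation Da := (base_point FD Fab).
Local Notation R := (local_ring Da).
Local Notation O := (local_ring Fab).
Local Notation f := (@local_pullback r m L F D FD (bipoint a b) Fab).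
Local Notation rD := (rho irrD Da : {rmorphism R -> E}).
Local Notation rF := (rho irrF Fab : {rmorphism O -> M}).
Variables (t : R) (tU : uniformizing t).

Lemma spec_a : spec iota v a a'.
Proof.
have [c c0 H] := a'_inf; exists (fun i => c * pcoord a' i) => //.
exact: (@proj_sim _ _ _ _ c).
Qed.

Lemma generic_nonzero d h : is_form d h -> nzero (center_self irrD) h -> hev iota (coord a') h != 0.
Proof. exact: (proj_generic cD dimD K_model (base_point FD Fab : D a) spec_a Da' a'_gen). Qed.

Definition alE : {rmorphism E -> K} := evalZ irrD Da' generic_nonzero.

(** This compares evaluation at a' on L(D), defined by genericity, with evaluation on R,
  defined by specialisation to a. *)
Lemma alR_evs (z : R) : alR rD alE z = evs K_model (Da : D a) irrD spec_a Da' z.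
Proof. exact: evalZ_res. Qed.

Lemma alR_V (z : R) : V (alR rD alE z).
Proof. by rewrite alR_evs; case: (evs_spec K_model irrD spec_a Da' (z : stalk (center_point (Da : D a)))). Qed.

Lemma alR_m (z : R) : evx irrD Da z = 0 -> mv (alR rD alE z).
Proof.
move=> z0; rewrite alR_evs.
have [_] := evs_spec K_model irrD spec_a Da' (z : stalk (center_point (Da : D a))).
by rewrite (_ : evx irrD _ _ = 0) // rmorph0 subr0.
Qed.

Lemma alE_cst e : alE (cst (center_self irrD) e) = iota e.
Proof. exact: evalZ_cst. Qed.

Lemma t_ev : evx irrD Da t = 0.
Proof. by apply/nonunitP/(unif_nonunit tU); exists 1; rewrite mul1r. Qed.

Lemma rD_frac : forall e : E, exists r1 r2 : R, rD r2 != 0 /\ e * rD r2 = rD r1.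
Proof. by move=> e; exact: (rho_frac (proj_charted r) Da e). Qed.

Lemma rD_inj : injective rD. Proof. exact: rho_inj. Qed.

Lemma alR_t : mv (alR rD alE t). Proof. exact: alR_m t_ev. Qed.

Section Chart.
Variables (i0 : 'I_r.+1) (j0 : 'I_m.+1).
Hypothesis ai0 : pcoord a i0 != 0.
Local Notation c := (biproj_chart i0 j0).

(** Being primitive, the equation remains nontrivial modulo the maximal ideal of
  R. *)
Lemma primitive_equation b1 (Fb1 : F (bipoint a b1)) (dom : dominates (center_point Fb1) (center_point Da))
  (z : stalk (center_point Fb1)) : exists2 G : {poly R}, (exists i, G`_i = 1) & pev (pullback dom) z G = 0.
Proof.
have [q [qs rq]] := pr_sep (rho irrF Fb1 z).
have [e [G [e0 qE G1]]] := primitive_multiple rD_inj rD_frac tU (separable_poly_neq0 qs).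
exists G => //; apply: (@rho_inj _ _ _ irrF _ Fb1); rewrite rmorph0.
move: rq; rewrite qE map_polyZ rootE hornerZ mulf_eq0 fmorph_eq0 (negbTE e0) /= => /eqP <-.
rewrite -map_poly_comp; transitivity (pev (ffp \o rD) (rho irrF Fb1 z) G) => //.
by apply: pev_comp => // u; exact: rho_pullback.
Qed.

Lemma dom_at b1 (Fb1 : F (bipoint a b1)) : dominates (center_point Fb1) (center_point Da).
Proof. by split=> // U oU [_ [-> Ux]]; exists (bipoint a b1). Qed.

(** A ratio of two coordinates satisfies a primitive equation over R, as an element
  of the function field of F; so the same equation holds at all the points over a where the
  ratio is defined, and its reduction at a has finitely many roots. *)
Lemma fibre_coordinates : exists S : seq L, forall b1 k, F (bipoint a b1) -> pcoord b1 k \in S.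
Proof.
have key (j k : 'I_m.+1) : exists S : seq L, forall b1, F (bipoint a b1) -> pcoord b1 j != 0 ->
    pcoord b1 k / pcoord b1 j \in S.
  have [[b2 [Fb2 n2]]|no] := pselect (exists b2, F (bipoint a b2) /\ pcoord b2 j != 0); last first.
    by exists [::] => b1 Fb1 n1; case: no; exists b1.
  have xc b1 : pcoord b1 j != 0 -> in_chart (biproj_chart i0 j) (coord (bipoint a b1)).
    by move=> n1; apply: biproj_chart_in; rewrite ?bicoordl ?bicoordr.
  have [G [l Gl] G2] := primitive_equation (dom_at Fb2) (zeta (center_point Fb2) (biproj_chart i0 j) (rshift _ k)).
  have [rs rsE] := closed_field_poly_normal (map_poly (evx irrD Da) G).
  exists rs => b1 Fb1 n1.
  have G0 : pev (pullback (dom_at Fb1)) (zeta (center_point Fb1) (biproj_chart i0 j) (rshift _ k)) G = 0.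
    have pE b3 (Fb3 : F (bipoint a b3)) : pcoord b3 j != 0 ->
        rho irrF Fb3 (pev (pullback (dom_at Fb3)) (zeta (center_point Fb3) (biproj_chart i0 j) (rshift _ k)) G) =
        pev (ffp \o rD) (zeta (center_self irrF) (biproj_chart i0 j) (rshift _ k)) G.
      move=> n3; apply: pev_comp => [u|]; first exact: rho_pullback.
      by apply: res_zeta; exists (bipoint a b3) => //; exact: xc.
    by apply: (@rho_inj _ _ _ irrF _ Fb1); rewrite pE // -(pE b2 Fb2) // G2 !rmorph0.
  have : (map_poly (evx irrD Da) G).[pcoord b1 k / pcoord b1 j] = 0.
    have /(congr1 (evx irrF Fb1)) := G0; rewrite rmorph0 => <-; symmetry.
    apply: pev_comp => [u|]; first exact: evx_pullback.
    by rewrite evx_zeta ?biaff_coordr //; exact: xc.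
  rewrite rsE hornerZ => /eqP; rewrite mulf_eq0 lead_coef_eq0 => /orP[/eqP E0|].
    have := congr1 (fun p : {poly L} => p`_l) E0; rewrite coef_map Gl coef0 => h.
    have /eqP := rmorph1 (evx irrD Da); rewrite (h : evx irrD Da 1 = 0) eq_sym.
    by rewrite oner_eq0.
  by rewrite -rootE root_prod_XsubC.
have /choice[S SP] : forall j, exists S : 'I_m.+1 -> seq L, forall k b1, F (bipoint a b1) -> pcoord b1 j != 0 ->
    pcoord b1 k / pcoord b1 j \in S k.
  by move=> j; have /choice[S SP] := key j; exists S.
exists (flatten [seq S p.1 p.2 | p <- enum {: 'I_m.+1 * 'I_m.+1}]) => b1 k Fb1.
have /existsP[j /andP[/eqP bj _]] := valP b1.
have n1 : pcoord b1 j != 0 by rewrite /pcoord bj oner_neq0.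
apply/flattenP; exists (S j k); first by apply/mapP; exists (j, k) => //; rewrite mem_enum.
by have := SP j k b1 Fb1 n1; rewrite {2}/pcoord bj divr1.
Qed.

Hypothesis bj0 : pcoord b j0 != 0.
Let ab_chart : in_chart c (coord (bipoint a b)).
Proof. by apply: biproj_chart_in; rewrite ?bicoordl ?bicoordr. Qed.
Local Notation z i := (aff c (coord (bipoint a b)) i).

(** The sum is a polynomial in th, and it is zero only when b1 is proportional to b. One
  takes the product over the vectors with entries in the finite set of [fibre_coordinates] that
  are points other than b. *)
Lemma separating_poly : exists2 T : {poly L}, T != 0 & forall th b1, T.[th] != 0 -> F (bipoint a b1) ->
  \sum_(k < m.+1) th ^+ (rshift r.+1 k) * (pcoord b1 k - z (rshift _ k) * pcoord b1 j0) = 0 -> b1 = b.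
Proof.
have [S SP] := fibre_coordinates.
pose T (w : 'rV[L]_m.+1) : {poly L} :=
  \sum_(k < m.+1) (w ord0 k - z (rshift _ k) * w ord0 j0) *: 'X^(rshift r.+1 k).
pose P (w : 'rV[L]_m.+1) := exists b1 : pts (proj_space m) L, b1 <> b /\ val b1 = w.
have TP w : P w -> T w != 0.
  move=> [b1 [nb <-]]; apply/eqP => T0; apply: nb.
  have E1 k : pcoord b1 k = (pcoord b1 j0 / pcoord b j0) * pcoord b k.
    have := congr1 (fun p : {poly L} => p`_(rshift r.+1 k)) T0.
    rewrite coef0 coef_sum (bigD1 k) //= coefZ coefXn eqxx mulr1 big1 => [|l lk]; last first.
      by rewrite coefZ coefXn eqn_add2l eq_sym (negbTE (_ : val l != val k)) ?mulr0.
    rewrite addr0 => /eqP; rewrite subr_eq0 => /eqP.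
    rewrite -[(val b1) ord0 k]/(pcoord b1 k) -[(val b1) ord0 j0]/(pcoord b1 j0) => ->.
    have -> : z (rshift r.+1 k) = pcoord b k / pcoord b j0 by exact: biaff_coordr.
    by field.
  apply: (proj_pt_inj (c := pcoord b1 j0 / pcoord b j0)) => //.
  have [k nk] := proj_pt_neq0 b1; apply: contra_neq nk => h0; by rewrite E1 h0 mul0r.
(* Vectors that are not points other than b contribute the factor 1. *)
pose l := [seq map_mx val w | w : 'rV[seq_sub S]_m.+1].
exists (\prod_(w <- l) (if `[< P w >] then T w else 1)).
  rewrite prodf_seq_neq0; apply/allP => w _ /=; case: asboolP => [/TP //|_]; exact: oner_neq0.
move=> th b1 nT Fb1 E0; apply: contrapT => nb.
have bl : val b1 \in l.
  apply/mapP; exists (\row_k SeqSub (SP b1 k Fb1)); first by rewrite mem_enum.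
  by apply/rowP => k; rewrite !mxE.
have pb : P (val b1) by exists b1.
move/negP: nT; apply; rewrite horner_prod prodf_seq_eq0; apply/hasP; exists (val b1) => //=.
rewrite asboolT // /T horner_sum; apply/eqP; rewrite -[RHS]E0; apply: eq_bigr => k _.
by rewrite hornerZ hornerXn mulrC.
Qed.

(** A form that does not vanish at (a, b) does not vanish at (a', b'), so evaluation at
  (a', b') is defined on O. *)
Lemma point_hom b' : zariski_fibre iota v F a' b b' -> exists psi : {rmorphism O -> K},
  [/\ point_over v rD alE f psi, forall e, psi (cst (center_point Fab) e) = iota e,
      forall w, mv (psi w - iota (evx irrF Fab w)) &
      forall i, psi (zeta (center_point Fab) c i) = aff c (coord (bipoint a' b')) i].
Proof.
move=> [b'_inf Fx']; have sp := spec_bipoint a'_inf b'_inf.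
exists (evs K_model Fab irrF sp Fx'); split.
- split=> [w|w]; last by case: (evs_spec K_model irrF sp Fx' w).
  rewrite alR_evs; have [g [h [gh ->]]] := stalkP (w : stalk (center_point Da)).
  transitivity (evs K_model Fab irrF sp Fx' (@fr (biproj_space r m) L F (center_point Fab) (pr_form m g) (pr_form m h))).
    by congr (evs _ _ _ _ _ _); exact: pullback_fr.
  rewrite /evs !evalZ_fr //; last exact: (frac_on_pr (dominates_point FD Fab) gh).
  by rewrite !hev_pr.
- by move=> e; exact: evs_cst.
- by move=> w; case: (evs_spec K_model irrF sp Fx' w).
- by move=> i; exact: evs_zeta.
Qed.

(** The image under psi of an equation of w over R. *)
Lemma psi_algebraic (psi : {rmorphism O -> K}) (w : O) : point_over v rD alE f psi -> algebraicOver alE (psi w).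
Proof.
move=> [pf pV]; have [G [l Gl] G0] := primitive_equation (dominates_point FD Fab) w.
exists (map_poly rD G).
  apply/eqP => /(congr1 (fun p : {poly E} => p`_l)); rewrite coef_map Gl coef0 => h.
  have /eqP := rmorph1 rD; rewrite (h : rD 1 = 0) eq_sym.
  by rewrite oner_eq0.
rewrite rootE -map_poly_comp; apply/eqP; have := congr1 psi G0; rewrite rmorph0 => <-.
symmetry; transitivity (pev (alR rD alE) (psi w) G) => //.
by apply: pev_comp.
Qed.

(** The value at (a', b') of the uniformiser [diff_combination]. *)
Definition sigma (th : L) (b' : pts (proj_space m) K) : K :=
  \sum_(i < nvars (biproj_space r m)) iota (th ^+ i) * (aff c (coord (bipoint a' b')) i - iota (z i)).

Lemma psi_diff_combination (psi : {rmorphism O -> K}) th b' : (forall e, psi (cst (center_point Fab) e) = iota e) ->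
  (forall i, psi (zeta (center_point Fab) c i) = aff c (coord (bipoint a' b')) i) ->
  psi (diff_combination Fab c th) = sigma th b'.
Proof.
move=> pc pz; rewrite rmorph_sum; apply: eq_bigr => i _.
by rewrite rmorphM rmorphB /= pc pz; congr (_ * (_ - _)); exact: pc.
Qed.

(** [ext_root] sends s to e and the affine coordinates of F to elements of K, which form a
  K-point (a', b') of F. By properness b' specialises to some b1, with (a, b1) on F. Since e
  reduces to 0, the combination of differences defining s vanishes at b1, and the first
  hypothesis gives b1 = b. *)
Lemma lift_root th (G : {poly E}) (e : K) :
  (forall b1, F (bipoint a b1) ->
    \sum_(k < m.+1) th ^+ (rshift r.+1 k) * (pcoord b1 k - z (rshift _ k) * pcoord b1 j0) = 0 -> b1 = b) ->
  min_rel ffp (rF (diff_combination Fab c th)) G -> pev alE e G = 0 -> mv e ->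
  exists2 b', zariski_fibre iota v F a' b b' & sigma th b' = e.
Proof.
move=> sep mG eG me.
pose zF i : M := zeta (center_self irrF) c i.
have chF : exists2 z, center_set (center_self irrF) z & in_chart c (coord z) by exists (bipoint a b).
have [B [i [jB [phiB [[ji phi_i] surj comp [s' [js ps]]]]]]] :=
  ext_root [seq zF i | i <- enum 'I_(r.+1 + m.+1)] mG eG.
have /choice[x xE] : forall l, exists x, jB x = zF l.
  by move=> l; apply: surj; apply: map_f; rewrite mem_enum.
pose cB : {rmorphism L -> B} := i \o cst (center_self irrD).
have jcB u : jB (cB u) = cst (center_self irrF) u.
  by transitivity (ffp (cst (center_self irrD) u)); [exact: ji|exact: ffp_cst].
have pcB u : phiB (cB u) = iota u.
  by transitivity (alE (cst (center_self irrD) u)); [exact: phi_i|exact: alE_cst].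
pose g l := phiB (x l).
have jhev p : jB (hev cB x p) = hev (cst (center_self irrF)) zF p by exact: hev_comp.
have phev p : phiB (hev cB x p) = hev iota g p by exact: hev_comp.
have comp_eq u w : jB u = jB w -> phiB u = phiB w.
  move=> E0; apply/eqP; rewrite -subr_eq0 -rmorphB; apply/eqP/comp.
  by rewrite rmorphB E0 subrr.
(* The first block is that of a', since phiB extends evaluation at a'. *)
have gl l : g (lshift _ l) = pcoord a' l / pcoord a' i0.
  transitivity (alE (zeta (center_self irrD) (proj_chart i0) l)); last first.
    by rewrite /alE evalZ_zeta //; exists a => //; exact: (base_point FD Fab).
  rewrite -phi_i; apply: comp_eq; rewrite xE ji; symmetry.
  by apply: pullback_zeta; exists a => //; exact: (base_point FD Fab).
have gden : g (rshift _ j0) = 1.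
  rewrite -(rmorph1 phiB); apply: comp_eq; rewrite xE rmorph1.
  transitivity (cst (center_self irrF) 1); last exact: rmorph1.
  rewrite cstE; apply/(fr_eqP irrF); [exact: zeta_frac|exact: frac_on1|].
  move=> p _; rewrite /= bdenr mpolyC1 /ev meval1 mulr1 mul1r //.
have a'i0 : pcoord a' i0 != 0.
  have aa' := spec_chart K_model (base_point FD Fab : D a) spec_a (c := proj_chart i0) (fun _ => ai0).
  exact: (aa' i0).
have [b1 [c1 [c10 b1E]]] : exists (b1 : pts (proj_space m) L) (c : K), c != 0 /\
    forall k, mv (c * g (rshift _ k) - iota (pcoord b1 k)).
  by apply: specialise_point => //; exists j0; rewrite gden oner_neq0.
have [|b' [c2 [c20 b'E]]] := @proj_pt_exists m K (fun k => g (rshift _ k)).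
  by exists j0; rewrite gden oner_neq0.
have simg : sim (A := biproj_space r m) g (coord (bipoint a' b')).
  apply: (@biproj_sim _ _ _ _ _ (pcoord a' i0)^-1 c2) => // [|l|l]; first by rewrite invr_eq0.
    by rewrite gl bicoordl mulrC.
  by rewrite b'E bicoordr.
have Fx' : Kpoints iota F (bipoint a' b').
  move=> d q qd q0; rewrite /ev map_mpoly_hev.
  have [psi psin psiE] := sim_form iota simg.
  have := psiE d q qd; rewrite -phev (comp_eq _ 0); last first.
    by rewrite rmorph0 jhev; exact: (hev_zeta_eq0 chF qd q0).
  by rewrite rmorph0 => /esym/eqP; rewrite mulf_eq0 (negbTE (psin d)) => /eqP.
have inf1 : infinitesimal_nbhd iota v b1 b'.
  exists (c1 * c2); first by rewrite mulf_neq0.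
  by move=> k; rewrite -mulrA -b'E.
have Fb1 : F (bipoint a b1).
  exact: (spec_closed K_model cF (spec_bipoint a'_inf inf1) Fx').
have gaff l : aff c (coord (bipoint a' b')) l = g l.
  have gc : in_chart c g.
    by apply: biproj_chart_in; rewrite ?gden ?oner_neq0 // gl divff ?oner_neq0.
  have [_ E1] := sim_aff (sim_sym simg) gc; rewrite E1.
  case: (fintype.split_ordP l) => k ->; first by rewrite biaffl (gl i0) divff // divr1.
  by rewrite biaffr gden divr1.
have se : sigma th b' = e.
  rewrite /sigma -ps; transitivity (phiB (\sum_(l < r.+1 + m.+1) cB (th ^+ l) * (x l - cB (z l)))).
    rewrite rmorph_sum; apply: eq_bigr => l _.
    by rewrite rmorphM rmorphB /= gaff pcB; congr (_ * (_ - _)); rewrite pcB.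
  apply: comp_eq; rewrite js /diff_combination !rmorph_sum; apply: eq_bigr => l _.
  transitivity (cst (center_self irrF) (th ^+ l) * (zF l - cst (center_self irrF) (z l))).
    by rewrite (rmorphM jB) (rmorphB jB) xE !jcB.
  rewrite (rmorphM rF) (rmorphB rF); congr (_ * (_ - _)); symmetry.
  - exact: rho_cst.
  - by apply: res_zeta; exists (bipoint a b).
  - exact: rho_cst.
exists b' => //; suff <- : b1 = b by split.
apply: sep => //; apply: (iota_videal K_model).
(* The first block of differences reduces to 0 on its own, so the second one does too. *)
have za l : mv (g (lshift _ l) - iota (z (lshift _ l))).
  have [_] := evs_spec K_model irrD spec_a Da' (zeta (center_point (base_point FD Fab : D a)) (proj_chart i0) l).
  rewrite evs_zeta // evx_zeta //; rewrite gl; congr (mv (_ - iota _)).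
  by symmetry; exact: biaff_coordl.
pose S0 := \sum_(k < m.+1) iota (th ^+ (rshift r.+1 k)) * (g (rshift _ k) - iota (z (rshift _ k))).
have mS0 : mv S0.
  move: me; rewrite -se /sigma big_split_ord /=.
  set S1 := \sum_(l < r.+1) _; have mS1 : mv S1.
    by apply: videal_sum => l _; apply: videalMl; [exact: iota_vring|rewrite gaff].
  have -> : S0 = \sum_(k < m.+1) iota (th ^+ (rshift r.+1 k)) *
     (aff c (coord (bipoint a' b')) (rshift r.+1 k) - iota (z (rshift r.+1 k))).
    by apply: eq_bigr => k _; rewrite gaff.
  by move=> mS; have := videalB mS mS1; rewrite addrAC subrr add0r.
have Vc1 : valuation_ring v c1.
  have := b1E j0; rewrite gden mulr1 => h; rewrite -[c1](subrK (iota (pcoord b1 j0))).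
  by apply: vringD; [exact: videalW|exact: iota_vring].
have := videalMl Vc1 mS0.
set S2 := iota _; move=> mcS; rewrite -[S2](subrK (c1 * S0)); apply: videalD => //.
rewrite -opprB; apply: videalN; rewrite /S2 /S0 rmorph_sum mulr_sumr -sumrB; apply: videal_sum => k _.
rewrite [X in mv X](_ : _ = iota (th ^+ (r.+1 + k)) * ((c1 * g (rshift r.+1 k) - iota (pcoord b1 k)) -
     iota (z (rshift r.+1 k)) * (c1 * g (rshift r.+1 j0) - iota (pcoord b1 j0)))); last first.
  rewrite gden; move: (z (rshift r.+1 k)) => zk; rewrite (rmorphM iota) (rmorphB iota) (rmorphM iota) /=; ring.
apply: videalMl; first exact: iota_vring.
by apply: videalB => //; apply: videalMl => //; exact: iota_vring.
Qed.

(** If t = 0 then the coordinates are constant near a, and a' would have those of a. *)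
Lemma t_neq0 : t != 0.
Proof.
apply/eqP => t0; apply: a'_gen; apply: (sim_standard (u := a)); first exact: (base_point FD Fab).
have ac : in_chart (proj_chart i0) (coord (a : pts (proj_space r) L)) by move=> i; exact: ai0.
have a'c := spec_chart K_model (base_point FD Fab : D a) spec_a ac.
have ac' : in_chart (proj_chart i0) (iota \o coord (a : pts (proj_space r) L)).
  by move=> i; rewrite /= fmorph_eq0; exact: ai0.
apply: (aff_sim (c := proj_chart i0) ac' a'c) => i.
pose Z := center_point (base_point FD Fab : D a).
have : zeta Z (proj_chart i0) i - cst Z (aff (proj_chart i0) (coord (a : pts (proj_space r) L)) i) = 0.
  have : nonunits (zeta Z (proj_chart i0) i - cst Z (aff (proj_chart i0) (coord (a : pts (proj_space r) L)) i) : R).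
    by apply/(nonunitP irrD); rewrite -(evx_zeta irrD (base_point FD Fab : D a) ac); exact: residue.
  by move=> /(unif_nonunit tU) [y ->]; rewrite t0 mulr0.
move/(congr1 (evs K_model (base_point FD Fab : D a) irrD spec_a Da')).
rewrite rmorphB rmorph0 /= evs_cst evs_zeta // => /eqP; rewrite subr_eq0 => /eqP ->.
by rewrite /aff fmorph_div.
Qed.

Lemma root_proportional (G0 : {poly E}) e0 (G : {poly R}) (x : K) : e0 != 0 -> G0 = e0 *: map_poly rD G ->
  (pev alE x G0 == 0) = root (map_poly (alR rD alE) G) x.
Proof.
move=> n0 ->; rewrite pevZ mulf_eq0 fmorph_eq0 (negbTE n0) /= rootE pevE -map_poly_comp //.
Qed.

(** The value of s is a bijection from the fibre to the roots, in the maximal ideal, of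
  the minimal equation of s: injective by [point_over_sep], onto by [lift_root]. There are at
  least n such roots by [equation_coef] and [roots_in_ideal], distinct by separability, and
  at most n by [points_at_most]. *)
Theorem zariski_mult_order (s0 : O) : uniformizing s0 -> exists n (s u w : O),
  [/\ uniformizing s, s != 0, w * u = 1, f t = u * s ^+ n & zariski_mult iota v F a' b n].
Proof.
move=> s0U.
have finj : injective f := pullback_inj irrD irrF FD pr_surj (dom := dominates_point FD Fab).
have ft0 : f t != 0.
  by apply/eqP => h; move: t_neq0; rewrite (finj t 0) ?eqxx // h rmorph0.
have ft_nu : evx irrF Fab (f t) = 0.
  by rewrite -t_ev; exact: (evx_pullback irrD irrF (dominates_point FD Fab)).
have s00 : s0 != 0.
  apply/eqP => h; have /(nonunitP irrF) /(unif_nonunit s0U) [y yE] := ft_nu.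
  by move: ft0; rewrite yE h mulr0 eqxx.
have [T T0 Tsep] := separating_poly.
have [th Tth sU] := generic_uniformizer irrF s0U ab_chart s00 T0.
pose s : O := diff_combination Fab c th.
have s_nz : s != 0.
  apply/eqP => h; have /(nonunitP irrF) /(unif_nonunit sU) [y yE] := ft_nu.
  by move: ft0; rewrite yE -/s h mulr0 eqxx.
have s_ev : evx irrF Fab s = 0.
  by apply/(nonunitP irrF)/(unif_nonunit sU); exists 1; rewrite mul1r.
have [n [u [w [wu ftE]]]] := unif_dec sU ft0.
have uu : exists w, w * u = 1 by exists w.
have resid (y : O) : exists (e : R) (y' : O), y = f e + y' * s.
  pose d : stalk (center_point Fab) := (y : stalk (center_point Fab)) - cst (center_point Fab) (evx irrF Fab y).
  have [y' yE] := iffLR (unif_nonunit sU d) (iffRL (nonunitP irrF (d : O)) (residue irrF (y : stalk (center_point Fab)))).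
  exists (cst (center_point Da) (evx irrF Fab y)), y'; rewrite -yE /d.
  have -> : f (cst (center_point Da) (evx irrF Fab y)) = cst (center_point Fab) (evx irrF Fab y).
    exact: pullback_cst.
  exact: (esym (etrans (addrC _ _) (subrK _ _))).
exists n, s, u, w; split=> //.
have [q [qs rq]] := pr_sep (rF s).
have [G0 [mG G0s]] := min_rel_separable qs rq.
have [e0 [G [e0n GE G1]]] := primitive_multiple rD_inj rD_frac tU (separable_poly_neq0 G0s).
have Gs : pev f s G = 0.
  apply: (@rho_inj _ _ _ irrF _ Fab); rewrite rmorph0.
  have [/eqP h _ _] := mG; move: h; rewrite GE pevZ mulf_eq0 fmorph_eq0 (negbTE e0n) /= => /eqP <-.
  rewrite [RHS]pevE -map_poly_comp; transitivity (pev (ffp \o rD) (rF s) G) => //.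
  by apply: pev_comp => // y; exact: rho_pullback.
pose H := map_poly (alR rD alE) G.
have HV i : V H`_i by rewrite coef_map; exact: alR_V.
have H1 : exists i, H`_i = 1 by have [i Gi] := G1; exists i; rewrite coef_map Gi; exact: (rmorph1 (alR rD alE)).
have Hm i : (i < n)%N -> mv H`_i.
  move=> ilt; have [y yE] := equation_coef tU sU ftE s_nz Gs ilt.
  rewrite coef_map yE; apply: alR_m; rewrite -[evx _ _ _]/(evx irrD Da (y * t : stalk (center_point Da))).
  by rewrite rmorphM t_ev mulr0.
have [rs [HE cnt]] := roots_in_ideal HV H1 Hm.
have H0 : H != 0.
  by have [i Hi] := H1; apply/eqP => h; move: Hi; rewrite h coef0 => /esym/eqP; rewrite oner_eq0.
have urs : uniq rs.
  rewrite -separable_prod_XsubC -(eqp_separable (eqp_scale _ (_ : lead_coef H != 0))) ?lead_coef_eq0 //.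
  rewrite -HE /H (_ : map_poly _ G = map_poly alE (map_poly rD G)); last by rewrite -map_poly_comp.
  by rewrite separable_map -(eqp_separable (eqp_scale _ e0n)) -GE.
have rootH x : (x \in rs) = root H x.
  by rewrite HE rootZ ?lead_coef_eq0 // root_prod_XsubC.
(* The roots that reduce to 0; the fibre is in bijection with them through sigma. *)
pose es := [seq x <- rs | `[< mv x >]].
have ues : uniq es by exact: filter_uniq.
have esP e : e \in es -> exists2 b', zariski_fibre iota v F a' b b' & sigma th b' = e.
  rewrite mem_filter => /andP[/asboolP me]; rewrite rootH -(root_proportional _ e0n GE) => /eqP eG.
  by apply: (lift_root _ mG eG me) => b1 Fb1; exact: Tsep Tth Fb1.
have fibP b' : zariski_fibre iota v F a' b b' -> sigma th b' \in es.
  move=> /point_hom [psi [po pc pm pz]]; rewrite -(psi_diff_combination th pc pz) mem_filter; apply/andP; split.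
    by apply/asboolP; have := pm s; rewrite s_ev rmorph0 subr0.
  rewrite rootH; apply/rootP; have := congr1 psi Gs; rewrite rmorph0 => <-.
  symmetry; transitivity (pev (alR rD alE) (psi s) G) => //.
  by have [pf _] := po; apply: pev_comp.
have sz : size es = n.
  apply/eqP; rewrite eqn_leq size_filter cnt andbT -size_filter.
  apply: (points_at_most rD_inj rD_frac tU alR_V alR_t t_neq0 resid uu ftE ues) => e /esP [b' /point_hom [psi [po pc pm pz]] <-].
  rewrite -(psi_diff_combination th pc pz); split; first exact: psi_algebraic.
  by exists psi.
have b'j0 b' : zariski_fibre iota v F a' b b' -> pcoord b' j0 != 0.
  move=> [[c2 _ H2] _]; have [h _] := residue_unit K_model bj0 (H2 j0).
  by apply: contra_neq h => ->; rewrite mulr0.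
have sinj : {in zariski_fibre iota v F a' b &, injective (sigma th)}.
  move=> b1 b2; rewrite !inE => f1 f2 ss.
  have [psi1 [po1 pc1 pm1 pz1]] := point_hom f1; have [psi2 [po2 pc2 pm2 pz2]] := point_hom f2.
  have psis : psi1 s = psi2 s by rewrite (psi_diff_combination th pc1 pz1) (psi_diff_combination th pc2 pz2).
  have E1 k : pcoord b1 k / pcoord b1 j0 = pcoord b2 k / pcoord b2 j0.
    transitivity (psi1 (zeta (center_point Fab) c (rshift _ k))).
      by rewrite pz1; symmetry; exact: biaff_coordr.
    transitivity (psi2 (zeta (center_point Fab) c (rshift _ k))); last by rewrite pz2; exact: biaff_coordr.
    apply: (point_over_sep rD_inj rD_frac tU alR_V alR_t t_neq0 resid uu ftE po1 po2 psis).
    by apply: algebraic_sub; exact: psi_algebraic.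
  have n1 := b'j0 b1 f1; have n2 := b'j0 b2 f2.
  apply: (proj_pt_inj (c := pcoord b1 j0 / pcoord b2 j0)); first by rewrite mulf_neq0 ?invr_eq0.
  by move=> k; rewrite -[LHS](divfK n1) E1; field.
rewrite /zariski_mult -(card_eql (inj_card_eq sinj)).
have nthinj : {in `I_n &, injective (nth 0 es)}.
  by move=> i l; rewrite !inE => il ll /eqP; rewrite nth_uniq ?sz // => /eqP.
rewrite -(card_eqr (inj_card_eq nthinj)).
rewrite (_ : sigma th @` _ = nth 0 es @` `I_n) ?card_eqxx //.
apply/seteqP; split=> [_ [b' fb' <-]|_ [i il <-]].
  exists (index (sigma th b') es); last by rewrite nth_index // fibP.
  by rewrite /= -sz index_mem fibP.
have [|b' fb' <-] := esP (nth 0 es i); first by rewrite mem_nth ?sz.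
by exists b'.
Qed.

End Chart.
End Main.

(** * Flatness and ramification of the cover *)

Section Etale.
Variables (L : closedFieldType) (r m : nat).
Variables (D : set (pts (proj_space r) L)) (F : set (pts (biproj_space r m) L)).
Variables (irrD : irreducible D) (irrF : irreducible F).
Variables (FD : F `<=` @pr r m L @^-1` D) (pr_surj : D `<=` @pr r m L @` F).
Variables (x : pts (biproj_space r m) L) (Fx : F x).
Local Notation f := (@local_pullback r m L F D FD x Fx).
Local Notation R := (local_ring (base_point FD Fx)).
Local Notation O := (local_ring Fx).
Variables (t : R) (tU : uniformizing t).

(** O is a domain that contains R. *)
Lemma cover_flat : flat f.
Proof.
apply: torsion_free_flat; first exact: unif_total tU.
move=> y z /(stalk_domain irrF) [E|]; [left|by right].
apply: (pullback_inj irrD irrF FD pr_surj (dom := dominates_point FD Fx)).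
by rewrite [LHS]E rmorph0.
Qed.

Lemma pullback_max_ideal (s u w : O) n : w * u = 1 -> f t = u * s ^+ n ->
  ideal_gen (f @` @nonunits R) = princ s n.
Proof.
move=> wu ft; apply/seteqP; split=> [z [l lP ->]|z [y ->]].
  suff /choice[g gE] : forall p, exists g : O, p \in l -> p.2 = g * s ^+ n.
    exists (\sum_(p <- l) p.1 * g p); rewrite mulr_suml.
    by apply: eq_big_seq => p /gE ->; rewrite mulrA.
  move=> p; have [pl|] := boolP (p \in l); last by exists 0.
  have [y /(unif_nonunit tU) [y' ->] <-] := lP p pl.
  exists (f y' * u) => _; transitivity (f y' * f t); first exact: rmorphM.
  by rewrite ft mulrA.
exists [:: (y * w, f t)]; last first.
  rewrite big_seq1; change (y * s ^+ n = y * w * f t :> O).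
  by rewrite ft -[RHS]mulrA [w * _]mulrA wu mul1r.
move=> p; rewrite inE => /eqP -> /=; exists t => //.
by apply/(unif_nonunit tU); exists 1; rewrite mul1r.
Qed.

End Etale.

Theorem theorem2p8
  (L : closedFieldType) (p : nat) (charL : p \in [pchar L]) (r m : nat)
  (D : set (pts (proj_space r) L))
  (D_closed : closed D) (D_irr : irreducible D) (D_dim : dimension D 1)
  (D_smooth : smooth D)
  (F : set (pts (biproj_space r m) L))
  (F_closed : closed F) (F_irr : irreducible F) (F_dim : dimension F 1)
  (FD : F `<=` @pr r m L @^-1` D)
  (pr_finite : finite_morphism F D (@pr r m L))
  (pr_surj : D `<=` @pr r m L @` F)
  (pr_sep : separable_cover FD pr_surj F_irr D_irr)
  (a : pts (proj_space r) L) (b : pts (proj_space m) L) (Fab : F (bipoint a b))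
  (ab_nonsing : nonsingular Fab)
  (K : closedFieldType) (iota : {rmorphism L -> K}) (v : valuation K)
  (K_model : nonstandard_model iota v)
  (a' : pts (proj_space r) K) (Da' : Kpoints iota D a')
  (a'_inf : infinitesimal_nbhd iota v a a') (a'_gen : ~ standard iota D a') :
  (exists2 n : nat, zariski_mult iota v F a' b n &
     algebraic_mult FD Fab n) /\
  (zariski_unramified iota v F a' b <->
     exists U : set (pts (biproj_space r m) L),
       [/\ open U, U (bipoint a b) & etale_on FD U]).
Proof.
have [_ dimD] := D_dim; have [_ dimF] := F_dim.
have [y y_transc] := model_transc K_model.
have unifD c (Dc : D c) : exists t : local_ring Dc, uniformizing t.
  exact: (regular_unif (proj_charted r) D_irr D_closed dimD y_transc (D_smooth c Dc : regular_local (local_ring Dc))).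
have [t tU] := unifD _ (base_point FD Fab).
have [s0 s0U] := regular_unif (biproj_charted r m) F_irr F_closed dimF y_transc (ab_nonsing : regular_local (local_ring Fab)).
have [i0 ai0] := proj_pt_neq0 a; have [j0 bj0] := proj_pt_neq0 b.
have [n [s [u [w [sU s_nz wu ftE zm]]]]] :=
  zariski_mult_order D_closed dimD F_closed pr_sep K_model Da' a'_inf a'_gen tU ai0 bj0 s0U.
have idE := pullback_max_ideal tU wu ftE.
split.
  by exists n => //; rewrite /algebraic_mult idE; exact: princ_length sU n s_nz.
(* m_a O = (s^n) is the maximal ideal (s) exactly when n = 1. *)
have n1P : n = 1%N <-> unramified (@local_pullback r m L F D FD _ Fab).
  rewrite /unramified idE; split=> [->|E].
    by apply/seteqP; split=> z; rewrite (unif_nonunit sU) /princ /= expr1.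
  have : nonunits s by apply/(unif_nonunit sU); exists 1; rewrite mul1r.
  rewrite -E => -[z zE]; apply/eqP; rewrite eqn_leq.
  have := @unif_pow_dvd _ _ sU 1 n z s_nz; rewrite expr1 => /(_ zE) -> /=.
  have : princ s n (s ^+ n) by exists 1; rewrite mul1r.
  rewrite E => /(unif_nonunit sU) [z' z'E].
  by apply: (@unif_pow_dvd _ _ sU n 1 z' s_nz); rewrite expr1.
have n1Z : zariski_unramified iota v F a' b <-> n = 1%N.
  rewrite /zariski_unramified /zariski_mult; split=> [h|<-//].
  by apply/card_eq_II; rewrite -(card_eql zm).
rewrite n1Z n1P; split=> [unr|[U [oU Uab et]]]; last by have [_] := et _ Fab Uab.
have [d [q [qd qz qP]]] := generically_unramified pr_sep.
have ab_chart : in_chart (biproj_chart i0 j0) (coord (bipoint a b)).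
  by apply: biproj_chart_in; rewrite ?bicoordl ?bicoordr.
have [U [oU Uab HU]] := isolated_zero (biproj_charted r m) F_irr sU ab_chart qd qz.
exists U; split=> // x Fx Ux; split.
  have [tx txU] := unifD _ (base_point FD Fx).
  exact: (cover_flat D_irr F_irr pr_surj txU).
have [qx|/eqP qx] := pselect (ev q x = 0); last exact: (qP x Fx qx Fx (base_point FD Fx) (dominates_point FD Fx)).
(* The only point of U where q may vanish is (ab), unramified by assumption. *)
have xab := HU x Fx Ux qx.
move: Fx Ux {qx}; rewrite xab => Fx Ux.
by rewrite (Prop_irrelevance Fx Fab).
Qed.
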